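(* Let $k$ be a positive integer, let $c\ge2$ be an integer, let $G$ be a $k$-strong digraph with $n$ vertices, and let $\mathcal{B}$ be a (given) bramble in $G$ of congestion $c$ with $|\mathcal{B}|\ge 2k(c\cdot k-c+2)+c(k-1)$. Then for any ordered sets $S=\{s_1,\ldots,s_k\}\subseteq V(G)$ and $T=\{t_1,\ldots,t_k\}\subseteq V(G)$, both of size $k$, the instance $(G,S,T)$ of the $k$-Directed $c$-Congested Disjoint Paths problem is positive (that is, there are paths $P_1,\ldots,P_k$ in $G$ such that each $P_i$ is a path from $s_i$ to $t_i$ and every vertex of $G$ occurs in at most $c$ of these paths), and such a solution can be found in time $O(k^4\cdot n^2)$.
   Context: Digraphs are finite; loops and parallel edges are allowed. A separator of a digraph $G$ is a set $X\subseteq V(G)$ such that $G\setminus X$ has a single vertex or is not strongly connected. $G$ is $k$-strong ($k$-strongly connected) if it has at least $k+1$ vertices and every separator of $G$ has size at least $k$. A bramble in $G$ is a collection $\mathcal{B}$ of strongly connected subgraphs of $G$ (called bags) such that for all $B,B'\in\mathcal{B}$, either $V(B)\cap V(B')\ne\emptyset$, or $G$ has an edge from $V(B)$ to $V(B')$ and an edge from $V(B')$ to $V(B)$. Its size $|\mathcal{B}|$ is its number of bags. It has congestion $c$ if every vertex of $G$ appears in at most $c$ bags. *)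

(* Defs.v *)
From mathcomp Require Import all_boot.

Set Implicit Arguments.
Unset Strict Implicit.
Unset Printing Implicit Defensive.

(* Edges are a type of their own, so loops and parallel edges are allowed. *)
Record digraph := Digraph {
  vert : finType;
  edge : finType;
  tail : edge -> vert;
  head : edge -> vert
}.

(* A set of vertices with a set of edges; a subgraph of G when [is_subgraph]
   (below) holds. *)
Notation subgraph G := ({set vert G} * {set edge G})%type.

Section Digraphs.
Variable G : digraph.
Local Notation V := (vert G).
Local Notation E := (edge G).

Definition sub_verts (H : subgraph G) : {set V} := H.1.
Definition sub_edges (H : subgraph G) : {set E} := H.2.

Definition is_subgraph (H : subgraph G) : bool :=
  [forall e in sub_edges H,
     (tail e \in sub_verts H) && (head e \in sub_verts H)].

Definition sub_adj (H : subgraph G) : rel V := fun u v =>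
  [exists e in sub_edges H, (tail e == u) && (head e == v)].

Definition whole : subgraph G := ([set: V], [set: E]).

Definition adj : rel V := sub_adj whole.

(* The digraph with no vertex does not count as strongly connected. *)
Definition strongly_connected (H : subgraph G) : bool :=
  (sub_verts H != set0) &&
  [forall u in sub_verts H, forall v in sub_verts H, connect (sub_adj H) u v].

Definition delete (X : {set V}) : subgraph G :=
  (~: X, [set e | (tail e \notin X) && (head e \notin X)]).

Definition separator (X : {set V}) : bool :=
  (#|sub_verts (delete X)| == 1) || ~~ strongly_connected (delete X).

Definition k_strong (k : nat) : bool :=
  (k.+1 <= #|V|) && [forall X : {set V}, separator X ==> (k <= #|X|)].

Definition edge_between (A A' : {set V}) : bool :=
  [exists e : E, (tail e \in A) && (head e \in A')].

Definition touch (H H' : subgraph G) : bool :=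
  (sub_verts H :&: sub_verts H' != set0) ||
  (edge_between (sub_verts H) (sub_verts H') &&
   edge_between (sub_verts H') (sub_verts H)).

(* The bags are listed in some order, without repetition: |B| is [size B]. *)
Definition bramble (B : seq (subgraph G)) : Prop :=
  [/\ uniq B,
      {in B, forall H, is_subgraph H && strongly_connected H} &
      {in B &, forall H H', touch H H'}].

Definition has_congestion (c : nat) (B : seq (subgraph G)) : Prop :=
  forall v : V, count (fun H => v \in sub_verts H) B <= c.

(* A path is given by the nonempty sequence of its vertices; parallel edges
   are thereby not distinguished, which is immaterial to vertex congestion. *)
Definition is_dipath (s t : V) (p : seq V) : bool :=
  if p is x :: q then [&& x == s, path adj x q, last x q == t & uniq p]
  else false.

Definition congested_solution (k c : nat) (S T : k.-tuple V)
    (P : 'I_k -> seq V) : Prop :=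
  (forall i, is_dipath (tnth S i) (tnth T i) (P i)) /\
  (forall v : V, #|[set i | v \in P i]| <= c).

Definition positive_instance (k c : nat) (S T : k.-tuple V) : Prop :=
  exists P : 'I_k -> seq V, congested_solution c S T P.

End Digraphs.

(* Running times refer to a unit-cost random access machine whose only
   arithmetic is addition and truncated subtraction (no multiplication, so that
   unit cost is a reasonable measure).  Its programs are structured, and its
   memory is split into arrays of naturals: [m a i] is cell [i] of array [a].
   Array names are literals of the program, indices are computed, so this is
   the usual one-dimensional memory with indirect addressing, interleaved. *)

Definition memory := nat -> nat -> nat.

Definition update (m : memory) (a i x : nat) : memory :=
  fun a' i' => if (a' == a) && (i' == i) then x else m a' i'.

Inductive expr :=
| Const of nat
| Read of nat & expr
| Plus of expr & expr
| Minus of expr & expr.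

Fixpoint eval (m : memory) (e : expr) : nat :=
  match e with
  | Const x => x
  | Read a e1 => m a (eval m e1)
  | Plus e1 e2 => eval m e1 + eval m e2
  | Minus e1 e2 => eval m e1 - eval m e2
  end.

Fixpoint expr_cost (e : expr) : nat :=
  match e with
  | Const _ => 1
  | Read _ e1 => (expr_cost e1).+1
  | Plus e1 e2 | Minus e1 e2 => (expr_cost e1 + expr_cost e2).+1
  end.

Inductive program :=
| Skip
| Write of nat & expr & expr
| Seq of program & program
| If of expr & program & program
| While of expr & program.

(* [exec p m t m']: started in memory [m], [p] halts in memory [m'] after [t]
   steps.  A test succeeds when its value is nonzero. *)
Inductive exec : program -> memory -> nat -> memory -> Prop :=
| ExecSkip m : exec Skip m 1 m
| ExecWrite m a e1 e2 :
    exec (Write a e1 e2) m (expr_cost e1 + expr_cost e2).+1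
      (update m a (eval m e1) (eval m e2))
| ExecSeq p q m1 m2 m3 t u :
    exec p m1 t m2 -> exec q m2 u m3 -> exec (Seq p q) m1 (t + u) m3
| ExecIfTrue e p q m m' t :
    eval m e != 0 -> exec p m t m' ->
    exec (If e p q) m (expr_cost e + t).+1 m'
| ExecIfFalse e p q m m' t :
    eval m e = 0 -> exec q m t m' ->
    exec (If e p q) m (expr_cost e + t).+1 m'
| ExecWhileDone e p m :
    eval m e = 0 -> exec (While e p) m (expr_cost e).+1 m
| ExecWhileStep e p m1 m2 m3 t u :
    eval m1 e != 0 -> exec p m1 t m2 -> exec (While e p) m2 u m3 ->
    exec (While e p) m1 (expr_cost e + t + u).+1 m3.

Section InputOutput.
Variable G : digraph.
Local Notation V := (vert G).
Local Notation n := #|V|.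

Definition vnum (v : V) : nat := enum_rank v.

Definition bag (B : seq (subgraph G)) (b : nat) : subgraph G :=
  nth (set0, set0) B b.

(* Array 0 holds n, k, c, |B|; array 1 the adjacency matrix of G; array 2 the
   incidence matrix bags/vertices; array 3 the adjacency matrices of the bags;
   arrays 4 and 5 hold S and T.  Matrices are stored row by row, and all
   remaining cells contain 0. *)
Definition input_memory (k c : nat) (B : seq (subgraph G))
    (S T : k.-tuple V) : memory := fun a i =>
  match a with
  | 0 => nth 0 [:: n; k; c; size B] i
  | 1 => [exists u : V, exists v : V, (i == vnum u * n + vnum v) && adj u v]
  | 2 => [exists b : 'I_(size B), exists v : V,
            (i == b * n + vnum v) && (v \in sub_verts (bag B b))]
  | 3 => [exists b : 'I_(size B), exists u : V, exists v : V,
            (i == (b * n + vnum u) * n + vnum v) && sub_adj (bag B b) u v]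
  | 4 => nth 0 (map vnum S) i
  | 5 => nth 0 (map vnum T) i
  | _ => 0
  end.

(* Array 6 holds the numbers of vertices of the paths; row i of the k x n
   matrix in array 7 starts with the vertices of the i-th path in order. *)
Definition outputs (k : nat) (m : memory) (P : 'I_k -> seq V) : Prop :=
  forall i : 'I_k,
    m 6 i = size (P i) /\
    forall j, j < size (P i) -> m 7 (i * n + j) = nth 0 (map vnum (P i)) j.

Definition solved_within (p : program) (bound k c : nat)
    (B : seq (subgraph G)) (S T : k.-tuple V) : Prop :=
  exists (t : nat) (m : memory) (P : 'I_k -> seq V),
    [/\ exec p (input_memory c B S T) t m, t <= bound,
        outputs m P & congested_solution c S T P].

End InputOutput.

(* Main.v *)
Require Import Defs.
From mathcomp Require Import all_boot.
From mathcomp Require Import zify.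

Set Implicit Arguments.
Unset Strict Implicit.
Unset Printing Implicit Defensive.

(** If [c >= k], any [k] paths joining [s_i] to [t_i] will do, and they exist
because a [k]-strong digraph is strongly connected. So let [c < k] and
[m = c (k - 1) + 1]. Since [m + 1 = c k - c + 2], the bramble has at least
[2 k (m + 1) + c (k - 1)] bags; just so many of them are considered.

Every set of fewer than [k] vertices meets at most [c (k - 1) < m] bags. In
[2 m] rounds, [m] of them for the sources and [m] for the sinks, at most [k]
bags are set aside per round, for the side to which the round belongs. All paths
of the sources obey one rule: a vertex of an available bag may be an end, but it
may be passed through only if it also lies in a bag set aside for the sources. A
round for the sources takes [k] disjoint paths from [S] to vertices of available
bags, and then sets aside one available bag through each end that has one left.
Such paths exist by Menger's theorem: after the deletion of fewer than [k]
vertices some available bag is intact, and as the digraph is still strongly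
connected, a remaining source reaches it ([round_linkable]). The group of bags
set aside in the round is then robust: the vertices reached from [S] by the
rule, while fewer than [k] vertices are avoided, include one in a bag of the
group, because one of the [k] paths is avoided entirely ([round_robust]). The
sinks are treated likewise in the reversed digraph.

At least [2 k + c (k - 1)] bags stay available. The sources, moving in the
digraph, and the sinks, moving in a separate copy of the reversed digraph, are
linked to [2 k] distinct available bags by disjoint paths that obey the rule of
their side. The paths exist by Menger's theorem again ([final_linkable]): a set
of fewer than [2 k] vertices and bags has fewer than [k] vertices in one of the
two copies, hence misses all bags of one of the [m] groups of that side. A bag
of this group is reached, may be traversed entirely and touches every available
bag, and one of the latter has not been deleted.

The path of [s_i], the bag where it ends, the bag where the path of [t_i] ends
and the latter path, reversed, contain a path from [s_i] to [t_i]
([territory_connected]). Let [v] be a vertex of an available bag. A path of the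
linkage that passes through [v] is charged to a bag through [v] set aside for
its side, and a path that ends in an available bag through [v] is charged to
that bag; different paths are charged to different bags, so that at most [c] of
the final paths contain [v] ([territory_congestion]). A vertex outside the
available bags lies on at most one path of each side, and [2 <= c].

The algorithm follows this proof. A linkage is a flow of unit value per path in
a network with split vertices, found by augmentation along paths of breadth
first search. The [2 m] rounds, [m <= k^2], take [k] augmentations each in a
network of [O(n)] nodes. The last linkage takes [2 k] augmentations in a network
of [O(n + k^3)] nodes. Counting the pairs of a bag and a vertex in it gives
[|B| <= c n], whence [k^2 <= n], and everything stays within [O(k^4 n^2)]
([total_bound]). Programs are written in a language of bounded loops, whose
meaning is a function of the memory and whose cost is bounded by an expression
in the values of the loop bounds; [compile] translates them to the machine. *)

(** * Bounded programs and their running time *)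
(** Programs whose loops have a bound that is computed beforehand always halt, so
their meaning and their cost can be given by recursion on the program.  In
[CFor i e p], cell 0 of array [i] counts the iterations of [p]. *)
Inductive cmd :=
| CSkip
| CWrite of nat & expr & expr
| CSeq of cmd & cmd
| CIf of expr & cmd & cmd
| CFor of nat & expr & cmd.

(* Variables are kept in cell 0 of an array of their own, which [$x] reads and
   [x <~ e] writes. *)
Notation "# x" := (Const x) (at level 1, format "# x").
Notation "$ x" := (Read x (Const 0)) (at level 1, format "$ x").
Notation "a ~[ e ]" := (Read a e) (at level 2, left associativity, format "a ~[ e ]").
Notation "x <~ e" := (CWrite x (Const 0) e) (at level 70).
Notation "a @[ e1 ] <~ e2" := (CWrite a e1 e2) (at level 70).
Notation "p ;; q" := (CSeq p q) (at level 80, right associativity).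

Fixpoint compile (p : cmd) : program :=
  match p with
  | CSkip => Skip
  | CWrite a e1 e2 => Write a e1 e2
  | CSeq p q => Seq (compile p) (compile q)
  | CIf e p q => If e (compile p) (compile q)
  | CFor i e p =>
      Seq (Write i #0 #0)
          (While (Minus e $i) (Seq (compile p) (Write i #0 (Plus $i #1))))
  end.

Fixpoint sem (p : cmd) (m : memory) : memory :=
  match p with
  | CSkip => m
  | CWrite a e1 e2 => update m a (eval m e1) (eval m e2)
  | CSeq p q => sem q (sem p m)
  | CIf e p q => if eval m e != 0 then sem p m else sem q m
  | CFor i e p =>
      iter (eval m e) (fun m1 => let m2 := sem p m1 in
                                 update m2 i 0 (m2 i 0 + 1))
           (update m i 0 0)
  end.

Fixpoint writes (p : cmd) : seq nat :=
  match p with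
  | CSkip => [::]
  | CWrite a _ _ => [:: a]
  | CSeq p q | CIf _ p q => writes p ++ writes q
  | CFor i _ p => i :: writes p
  end.

Fixpoint reads (e : expr) : seq nat :=
  match e with
  | Const _ => [::]
  | Read a e => a :: reads e
  | Plus e1 e2 | Minus e1 e2 => reads e1 ++ reads e2
  end.

Fixpoint bound_reads (p : cmd) : seq nat :=
  match p with
  | CSkip | CWrite _ _ _ => [::]
  | CSeq p q | CIf _ p q => bound_reads p ++ bound_reads q
  | CFor _ e p => reads e ++ bound_reads p
  end.

Fixpoint counters_kept (p : cmd) : bool :=
  match p with
  | CSkip | CWrite _ _ _ => true
  | CSeq p q | CIf _ p q => counters_kept p && counters_kept q
  | CFor i _ p => (i \notin writes p) && counters_kept p
  end.

(** No array that a loop bound depends on is written, so that the bounds can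
all be evaluated in the initial memory; [cost] relies on it. *)
Definition bounds_kept (p : cmd) : bool :=
  all (fun a => a \notin writes p) (bound_reads p).

Definition well_formed (p : cmd) : bool := counters_kept p && bounds_kept p.

(** The constants cover the bookkeeping of a loop: clearing, testing and
incrementing its counter. *)
Fixpoint cost (m : memory) (p : cmd) : nat :=
  match p with
  | CSkip => 1
  | CWrite _ e1 e2 => (expr_cost e1 + expr_cost e2).+1
  | CSeq p q => cost m p + cost m q
  | CIf e p q => (expr_cost e + (cost m p + cost m q)).+1
  | CFor i e p =>
      eval m e * (cost m p + expr_cost e + 10) + expr_cost e + 10
  end.

Definition agree (L : seq nat) (m m' : memory) : Prop :=
  forall a, a \notin L -> forall x, m' a x = m a x.

Lemma agree_trans L m1 m2 m3 : agree L m1 m2 -> agree L m2 m3 -> agree L m1 m3.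
Proof. by move=> h1 h2 a ha x; rewrite h2 // h1. Qed.

Lemma agree_sub L L' m m' : {subset L <= L'} -> agree L m m' -> agree L' m m'.
Proof.
by move=> sLL' h a ha x; apply: h; apply: contra ha; apply: sLL'.
Qed.

Ltac subset_literals :=
  let x := fresh "x" in move=> x; rewrite /= !inE; by do ![case: (x == _) => //].

Lemma agree_update L m a i x : a \in L -> agree L m (update m a i x).
Proof.
by move=> ha b hb y; rewrite /update; case: eqP => // e; rewrite e ha in hb.
Qed.

Lemma agree_then_update L m m' a i x :
  a \in L -> agree L m m' -> agree L m (update m' a i x).
Proof. by move=> ha h; apply: agree_trans h _; apply: agree_update. Qed.

Lemma update_same m a i x : update m a i x a i = x.
Proof. by rewrite /update !eqxx. Qed.

Lemma update_array m a i x b j : b != a -> update m a i x b j = m b j.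
Proof. by rewrite /update => /negPf->. Qed.

Lemma update_cell m a i x j : j != i -> update m a i x a j = m a j.
Proof. by rewrite /update => /negPf->; rewrite andbF. Qed.

Lemma updateE m a i x j : update m a i x a j = if j == i then x else m a j.
Proof. by rewrite /update eqxx. Qed.

Lemma sem_agree p m : agree (writes p) m (sem p m).
Proof.
elim: p m => [|a e1 e2|p IHp q IHq|e p IHp q IHq|i e p IHp] m //=.
- by apply: agree_update; rewrite inE.
- apply: agree_trans.
    by apply: agree_sub (IHp m) => a; rewrite mem_cat => ->.
  by apply: agree_sub (IHq _) => a; rewrite mem_cat orbC => ->.
- case: ifP => _.
    by apply: agree_sub (IHp m) => a; rewrite mem_cat => ->.
  by apply: agree_sub (IHq _) => a; rewrite mem_cat orbC => ->.
- elim: (eval m e) => [|k IHk] /=; first by apply: agree_update; rewrite inE eqxx.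
  apply: (agree_trans IHk).
  set m1 := iter _ _ _.
  apply: (@agree_trans _ _ (sem p m1)).
    by apply: agree_sub (IHp m1) => a; rewrite inE orbC => ->.
  by apply: agree_update; rewrite inE eqxx.
Qed.

Lemma eval_agree L m m' e :
  agree L m m' -> all (fun a => a \notin L) (reads e) -> eval m' e = eval m e.
Proof.
move=> h; elim: e => [//|a e IHe|e1 IH1 e2 IH2|e1 IH1 e2 IH2] /=.
- by case/andP=> ha /IHe ->; apply: h.
- by rewrite all_cat => /andP[/IH1 -> /IH2 ->].
- by rewrite all_cat => /andP[/IH1 -> /IH2 ->].
Qed.

Lemma cost_agree L m m' p :
  agree L m m' -> all (fun a => a \notin L) (bound_reads p) ->
  cost m' p = cost m p.
Proof.
move=> h; elim: p => [|a e1 e2|p IHp q IHq|e p IHp q IHq|i e p IHp] //=.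
- by rewrite all_cat => /andP[/IHp -> /IHq ->].
- by rewrite all_cat => /andP[/IHp -> /IHq ->].
- by rewrite all_cat => /andP[/(eval_agree h) -> /IHp ->].
Qed.

(** The invariant may use that everything which the body does not write still has
its value from before the loop. *)
Lemma sem_For_ind i e p m (I : nat -> memory -> Prop) :
  i \notin writes p ->
  I 0 (update m i 0 0) ->
  (forall j m1, j < eval m e -> agree (i :: writes p) m m1 -> m1 i 0 = j ->
     I j m1 -> I j.+1 (update (sem p m1) i 0 j.+1)) ->
  I (eval m e) (sem (CFor i e p) m).
Proof.
move=> hi I0 IS /=.
set f := fun m1 => _.
have H j : j <= eval m e ->
    [/\ I j (iter j f (update m i 0 0)),
        agree (i :: writes p) m (iter j f (update m i 0 0)) &
        iter j f (update m i 0 0) i 0 = j].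
  elim: j => [|j IHj] hj.
    split=> //=; last by rewrite update_same.
    by apply: agree_update; rewrite inE eqxx.
  have [h1 h2 h3] := IHj (ltnW hj).
  rewrite iterS; set m1 := iter j f _ in h1 h2 h3 *.
  have e1 : sem p m1 i 0 = j by rewrite (sem_agree m1 hi).
  rewrite /f e1 addn1; split; first exact: IS.
    apply: (agree_trans h2); apply: (@agree_trans _ _ (sem p m1)).
      by apply: agree_sub (@sem_agree p m1) => a; rewrite inE orbC => ->.
    by apply: agree_update; rewrite inE eqxx.
  by rewrite update_same.
by have [] := H _ (leqnn _).
Qed.

(** All iterations obey the same cost bound, since the body leaves the bounds of its
inner loops alone ([cost_agree]); this is where [bounds_kept] is used. *)
Lemma exec_compile p m :
  well_formed p ->
  exists2 t, exec (compile p) m t (sem p m) & t <= cost m p.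
Proof.
rewrite /well_formed /bounds_kept.
elim: p m => [|a e1 e2|p IHp q IHq|e p IHp q IHq|i e p IHp] m /=.
- by exists 1 => //; apply: ExecSkip.
- by exists (expr_cost e1 + expr_cost e2).+1 => //; apply: ExecWrite.
- rewrite all_cat => /andP[/andP[cp cq] /andP[bp bq]].
  have sp : all (fun a => a \notin writes p) (bound_reads p).
    by apply: sub_all bp => a; rewrite mem_cat negb_or => /andP[].
  have sq : all (fun a => a \notin writes q) (bound_reads q).
    by apply: sub_all bq => a; rewrite mem_cat negb_or => /andP[].
  have sqp : all (fun a => a \notin writes p) (bound_reads q).
    by apply: sub_all bq => a; rewrite mem_cat negb_or => /andP[].
  have [|t1 ex1 le1] := IHp m; first by rewrite cp.
  have [|t2 ex2 le2] := IHq (sem p m); first by rewrite cq.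
  exists (t1 + t2); first exact: ExecSeq ex1 ex2.
  by rewrite leq_add // -(cost_agree (@sem_agree p m) sqp).
- rewrite all_cat => /andP[/andP[cp cq] /andP[bp bq]].
  have sp : all (fun a => a \notin writes p) (bound_reads p).
    by apply: sub_all bp => a; rewrite mem_cat negb_or => /andP[].
  have sq : all (fun a => a \notin writes q) (bound_reads q).
    by apply: sub_all bq => a; rewrite mem_cat negb_or => /andP[].
  case: ifPn => [he|/negPn/eqP he].
    have [|t1 ex1 le1] := IHp m; first by rewrite cp.
    exists (expr_cost e + t1).+1; first exact: ExecIfTrue.
    by rewrite ltnS leq_add2l (leq_trans le1) ?leq_addr.
  have [|t1 ex1 le1] := IHq m; first by rewrite cq.
  exists (expr_cost e + t1).+1; first exact: ExecIfFalse.
  by rewrite ltnS leq_add2l (leq_trans le1) ?leq_addl.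
- rewrite all_cat => /andP[/andP[hi cp] /andP[be bp]].
  have sp : all (fun a => a \notin writes p) (bound_reads p).
    by apply: sub_all bp => a; rewrite inE negb_or => /andP[].
  have {}IHp m1 : exists2 t, exec (compile p) m1 t (sem p m1) & t <= cost m1 p.
    by apply: IHp; rewrite cp.
  set f := (X in iter _ X); set B := eval m e.
  set W := (X in Seq _ X).
  (* The while loop from its [j]-th iteration on. *)
  have keep j m1 : j <= B -> agree (i :: writes p) m m1 -> m1 i 0 = j ->
      exists2 t, exec W m1 t (iter (B - j) f m1) &
        t <= (B - j) * (cost m p + expr_cost e + 10) + expr_cost e + 4.
    have [d hd] : exists d, B - j = d by exists (B - j).
    rewrite hd; elim: d j hd m1 => [|d IHd] j hd m1 hj h1 h2.
      exists (expr_cost (Minus e $i)).+1; last by rewrite /=; lia.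
      by apply: (@ExecWhileDone (Minus e $i)); rewrite /= h2 (eval_agree h1).
    have [t1 ex1 le1] := IHp m1.
    have e1 : sem p m1 i 0 = j by rewrite (sem_agree m1 hi).
    have [||||t2 ex2 le2] := IHd j.+1 _ (f m1).
    - by lia.
    - by lia.
    - apply: (agree_trans h1); apply: (@agree_trans _ _ (sem p m1)).
        by apply: agree_sub (@sem_agree p m1) => a; rewrite inE orbC => ->.
      by apply: agree_update; rewrite inE eqxx.
    - by rewrite /f e1 update_same addn1.
    have ex3 : exec (Seq (compile p) (Write i #0 (Plus $i #1))) m1
                 (t1 + (1 + 4).+1) (f m1).
      by apply: (ExecSeq ex1); apply: ExecWrite.
    exists (expr_cost (Minus e $i) + (t1 + (1 + 4).+1) + t2).+1.
      rewrite iterSr; refine (ExecWhileStep _ ex3 ex2) => /=.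
      by rewrite h2 (eval_agree h1) //; change (B - j != 0); lia.
    have ec : cost m1 p = cost m p by apply: cost_agree h1 bp.
    rewrite ec in le1; move: le2; rewrite /= mulSn.
    set X := d * _; lia.
  have [||| t ex le] := keep 0 (update m i 0 0) => //.
  - by apply: agree_update; rewrite inE eqxx.
  - by rewrite update_same.
  rewrite subn0 in ex le.
  exists ((1 + 1).+1 + t); last by lia.
  exact: (ExecSeq (ExecWrite m i #0 #0) ex).
Qed.

(** Tests with values that need not be 0 or 1: everything nonzero is true, so a sum
is a disjunction.  All comparisons are made with truncated subtraction. *)
Notation truth m e := (eval m e != 0).
Definition Le a b := Minus #1 (Minus a b).
Definition Lt a b := Le (Plus a #1) b.
Definition Eq a b := Minus #1 (Plus (Minus a b) (Minus b a)).
Definition Not a := Minus #1 a.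
Definition And a b := Not (Plus (Not a) (Not b)).
Definition Or a b := Plus a b.

Lemma truth_Le m a b : truth m (Le a b) = (eval m a <= eval m b).
Proof. by rewrite /=; lia. Qed.
Lemma truth_Lt m a b : truth m (Lt a b) = (eval m a < eval m b).
Proof. by rewrite /=; lia. Qed.
Lemma truth_Eq m a b : truth m (Eq a b) = (eval m a == eval m b).
Proof. by rewrite /=; lia. Qed.
Lemma truth_Not m a : truth m (Not a) = ~~ truth m a.
Proof. by rewrite /=; lia. Qed.
Lemma truth_And m a b : truth m (And a b) = truth m a && truth m b.
Proof. by rewrite /=; lia. Qed.
Lemma truth_Or m a b : truth m (Or a b) = truth m a || truth m b.
Proof. by rewrite /=; lia. Qed.

(** * Counting below a bound *)
(** Vertices, bags and network nodes are numbered, as they are in memory; sets are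
boolean predicates of which only the values below a bound matter. *)
Definition cnt (P : nat -> bool) (n : nat) : nat := \sum_(i < n) P i.

Lemma cnt0 (P : nat -> bool) : cnt P 0 = 0. Proof. by rewrite /cnt big_ord0. Qed.
Lemma cntS (P : nat -> bool) n : cnt P n.+1 = cnt P n + P n.
Proof. by rewrite /cnt big_ord_recr. Qed.

Lemma leq_cnt (P Q : nat -> bool) n : (forall i, i < n -> P i -> Q i) -> cnt P n <= cnt Q n.
Proof.
move=> h; apply: leq_sum => i _; have := h i (ltn_ord i).
by case: (P i) => [->|].
Qed.

Lemma cnt_leqn (P : nat -> bool) n : cnt P n <= n.
Proof. by rewrite -[leqRHS]card_ord -sum1_card leq_sum // => i _; case: (P i). Qed.

Lemma cnt_or (P Q : nat -> bool) n : cnt (fun i => P i || Q i) n <= cnt P n + cnt Q n.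
Proof. by rewrite -big_split leq_sum // => i _ /=; case: (P i); case: (Q i). Qed.

Lemma cnt_shift (P : nat -> bool) n1 n2 :
  cnt P (n1 + n2) = cnt P n1 + cnt (fun i => P (n1 + i)) n2.
Proof. by rewrite /cnt big_split_ord. Qed.

Lemma cntC (P : nat -> bool) n : cnt P n + cnt (fun i => ~~ P i) n = n.
Proof.
elim: n => [|n IHn]; first by rewrite !cnt0.
by rewrite !cntS -[in RHS]IHn; case: (P n) => /=; lia.
Qed.

Lemma cnt_eq0 (P : nat -> bool) n : cnt P n = 0 -> forall i, i < n -> ~~ P i.
Proof.
move/eqP; rewrite sum_nat_eq0 => /forallP h i hi.
by have := h (Ordinal hi); rewrite /=; case: (P i).
Qed.

Lemma cnt_gt0 (P : nat -> bool) n i : i < n -> P i -> 0 < cnt P n.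
Proof. by move=> hi Pi; case: posnP => // /cnt_eq0 /(_ i hi); rewrite Pi. Qed.

Lemma cnt_gt0E (P : nat -> bool) n : 0 < cnt P n -> exists2 i, i < n & P i.
Proof.
elim: n => [|n IHn]; first by rewrite cnt0.
rewrite cntS; case Pn: (P n); first by exists n.
by rewrite addn0 => /IHn [i hi Pi]; exists i => //; lia.
Qed.

Lemma cntE (P : nat -> bool) n : cnt P n = count P (iota 0 n).
Proof.
elim: n => [|n IHn]; first by rewrite cnt0.
by rewrite cntS -[in RHS]addn1 iotaD count_cat /= IHn add0n addn0.
Qed.

Lemma has_iotaP (P : nat -> bool) n :
  reflect (exists2 i : nat, i < n & P i) (has P (iota 0 n)).
Proof.
apply: (iffP hasP) => -[i hi Pi]; exists i => //; move: hi;
  by rewrite mem_iota.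
Qed.

Lemma finite_choice (P : nat -> nat -> Prop) k :
  (forall i, i < k -> exists b, P i b) ->
  exists h : nat -> nat, forall i, i < k -> P i (h i).
Proof.
elim: k => [|k IHk] H; first by exists id.
have [|h hh] := IHk; first by move=> i hi; apply: H; lia.
have [b hb] := H k (ltnSn k).
exists (fun i => if i == k then b else h i) => i; rewrite ltnS leq_eqVlt.
by case: eqP => [->|_] //= hi; apply: hh.
Qed.

(** Most cardinality bounds below are instances: [R i b] says that [i] is charged to
[b], and nothing is charged twice. *)
Lemma leq_cnt_inj (P Q : nat -> bool) (R : nat -> nat -> Prop) k n :
  (forall i, i < k -> P i -> exists b, [/\ b < n, Q b & R i b]) ->
  (forall i i' b, i < k -> i' < k -> P i -> P i' -> b < n -> Q b ->
     R i b -> R i' b -> i = i') ->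
  cnt P k <= cnt Q n.
Proof.
move=> ex inj.
have [|h hh] := @finite_choice (fun i b => P i -> [/\ b < n, Q b & R i b]) k.
  move=> i hi; case Pi: (P i); last by exists 0.
  by have [b hb] := ex i hi Pi; exists b.
rewrite !cntE -!size_filter -(size_map h).
apply: uniq_leq_size.
  rewrite map_inj_in_uniq ?filter_uniq ?iota_uniq // => i i'.
  rewrite !mem_filter !mem_iota /= !add0n => /andP[Pi hi] /andP[Pi' hi'] e.
  have [h1 h2 h3] := hh i hi Pi; have [h1' h2' h3'] := hh i' hi' Pi'.
  by apply: (inj i i' (h i)) => //; rewrite e.
move=> _ /mapP[i + ->]; rewrite !mem_filter !mem_iota /= !add0n => /andP[Pi hi].
by have [-> ->] := hh i hi Pi.
Qed.

(** * Unit flows as reorientations *)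
Section Flow.
Variables (M a b : nat) (r0 : nat -> nat -> bool).

Definition across (Z : nat -> bool) (r : nat -> nat -> bool) : nat :=
  \sum_(u < M) \sum_(v < M) [&& Z u, ~~ Z v & r u v].

(** A 0/1 flow of value [t] from [a] to [b] in [r0] is represented by its residual
digraph [r]: the edges that carry flow are reversed.  Conservation says that no
out-degree changes, except that the source loses [t].  Augmentation then just
reverses the edges of a path of [r]. *)
Record is_flow (r : nat -> nat -> bool) (t : nat) : Prop := IsFlow {
  flow_pair : forall u v, u < M -> v < M -> r u v + r v u = r0 u v + r0 v u;
  flow_deg : forall u, u < M -> u != b ->
    cnt (r u) M + (u == a) * t = cnt (r0 u) M
}.

Definition carries (r : nat -> nat -> bool) (u v : nat) : bool :=
  r0 u v && ~~ r u v.

Section Fixed.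
Variables (r : nat -> nat -> bool) (t : nat).
Hypothesis fl : is_flow r t.

Lemma carries_rev u v : u < M -> v < M -> carries r u v = r v u && ~~ r0 v u.
Proof.
move=> hu hv; have := flow_pair fl hu hv; rewrite /carries.
by case: (r u v); case: (r v u); case: (r0 u v); case: (r0 v u).
Qed.

(** Reversal does not change the number of edges inside [Z], so the change of the
out-degrees in [Z] is the change of the number of edges that leave [Z]. *)
Lemma flow_across Z : a < M -> ~~ Z b ->
  across Z r0 = Z a * t + across Z r.
Proof.
move=> ha Zb.
pose inside (s : nat -> nat -> bool) :=
  \sum_(u < M) \sum_(v < M) [&& Z u, Z v & s u v].
have split_deg (s : nat -> nat -> bool) : \sum_(u < M) Z u * cnt (s u) M = inside s + across Z s.
  rewrite -big_split /=; apply: eq_bigr => u _.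
  rewrite -big_split /= big_distrr /=; apply: eq_bigr => v _.
  by case: (Z u); case: (Z v); case: (s u v).
have double (s : nat -> nat -> bool) : (inside s).*2 = \sum_(u < M) \sum_(v < M) (Z u && Z v) * (s u v + s v u).
  rewrite -addnn {2}/inside exchange_big -big_split /=; apply: eq_bigr => u _.
  rewrite -big_split /=; apply: eq_bigr => v _.
  by case: (Z u); case: (Z v); case: (s u v); case: (s v u).
have eq_in : inside r = inside r0.
  apply: double_inj; rewrite !double; apply: eq_bigr => u _; apply: eq_bigr => v _.
  by rewrite (flow_pair fl).
have eq_deg : \sum_(u < M) Z u * cnt (r0 u) M =
              \sum_(u < M) Z u * cnt (r u) M + Z a * t.
  have -> : Z a * t = \sum_(u < M) Z u * ((val u == a) * t).
    rewrite (bigD1 (Ordinal ha)) //= eqxx mul1n big1 ?addn0 // => u.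
    by rewrite -val_eqE /= => /negPf->; rewrite muln0.
  rewrite -big_split /=; apply: eq_bigr => u _; rewrite -mulnDr.
  case: (altP (val u =P b)) => [->|ub]; first by rewrite (negPf Zb) !mul0n.
  by rewrite (flow_deg fl).
by move: eq_deg; rewrite !split_deg eq_in; lia.
Qed.

Lemma carries_across Z : a < M -> ~~ Z b -> Z a -> t <= across Z (carries r).
Proof.
move=> ha Zb Za; have := flow_across ha Zb; rewrite Za mul1n => e.
have : across Z r0 <= across Z (carries r) + across Z r.
  rewrite -big_split leq_sum // => u _; rewrite -big_split leq_sum // => v _ /=.
  by rewrite /carries; case: (Z u); case: (Z v); case: (r u v); case: (r0 u v).
by rewrite e; lia.
Qed.

Lemma carries_conserved x : x < M -> x != a -> x != b ->
  cnt (carries r x) M = cnt (fun v => carries r v x) M.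
Proof.
move=> hx xa xb; have := flow_deg fl hx xb; rewrite (negPf xa) mul0n addn0 => e.
have : cnt (r0 x) M + cnt (fun v => carries r v x) M =
       cnt (r x) M + cnt (carries r x) M.
  rewrite -!big_split; apply: eq_bigr => v _ /=; rewrite (carries_rev (ltn_ord v) hx).
  by rewrite /carries; case: (r x v); case: (r0 x v).
by rewrite e; lia.
Qed.

Lemma carries_source : a < M -> a != b ->
  cnt (carries r a) M = t + cnt (fun v => carries r v a) M.
Proof.
move=> ha ab; have := flow_deg fl ha ab; rewrite eqxx mul1n => e.
have : cnt (r0 a) M + cnt (fun v => carries r v a) M =
       cnt (r a) M + cnt (carries r a) M.
  rewrite -!big_split; apply: eq_bigr => v _ /=; rewrite (carries_rev (ltn_ord v) ha).
  by rewrite /carries; case: (r a v); case: (r0 a v).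
by rewrite -e; lia.
Qed.

Lemma carries_sink : a < M -> b < M -> a != b -> (forall v, v < M -> ~~ r0 b v) ->
  cnt (fun u => carries r u b) M = t.
Proof.
move=> ha hb ab hr0.
have Zb : ~~ (fun u => u != b) b by rewrite /= eqxx.
have := @flow_across (fun u => u != b) ha Zb; rewrite ab mul1n.
have acr (s : nat -> nat -> bool) : across (fun u => u != b) s = cnt (fun u => (u != b) && s u b) M.
  rewrite /across /cnt; apply: eq_bigr => u _.
  rewrite (bigD1 (Ordinal hb)) //= eqxx big1 ?addn0 //= => v.
  by rewrite -val_eqE /= => ->; rewrite andbF.
rewrite !acr => e; apply/eqP; rewrite -(eqn_add2r (cnt (fun u => (u != b) && r u b) M)).
rewrite -e -big_split; apply/eqP; apply: eq_bigr => u _ /=.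
have := carries_rev (ltn_ord u) hb; rewrite (negPf (hr0 u (ltn_ord u))) andbT.
have := flow_pair fl (ltn_ord u) hb; rewrite (negPf (hr0 u (ltn_ord u))) /carries.
case: eqP => [->|_]; first by rewrite (negPf (hr0 b hb)).
by case: (r u b); case: (r0 u b); case: (r b u).
Qed.

(** If no augmenting path exists, the set [Z] reached from the source is a cut whose
edges all carry flow. *)
Lemma flow_augment_cut (Z : nat -> bool) : a < M -> Z a -> ~~ Z b ->
  (forall u v, u < M -> v < M -> Z u -> r u v -> Z v) -> across Z r0 = t.
Proof.
move=> ha Za Zb cl; rewrite flow_across // Za mul1n.
rewrite [across Z r]big1 ?addn0 // => u _; rewrite big1 // => v _.
case Zu: (Z u) => //=; case: (boolP (Z v)) => //= Zv.
by case ruv: (r _ _) => //; rewrite (cl u v) in Zv.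
Qed.

(** A set without source and sink that the flow does not leave cannot be entered
by it either.  It follows that what enters a node can be followed to the sink. *)
Lemma flow_closed (Z : nat -> bool) x : a < M -> ~~ Z a -> ~~ Z b ->
  (forall u v, u < M -> v < M -> Z u -> carries r u v -> Z v) ->
  x < M -> Z x -> ~~ carries r a x.
Proof.
move=> ha Za Zb cl hx Zx; have := flow_across ha Zb.
rewrite (negPf Za) mul0n add0n => e; apply/negP => ax.
have le u v : u < M -> v < M -> [&& Z u, ~~ Z v & r0 u v] <= [&& Z u, ~~ Z v & r u v].
  move=> hu hv; case Zu: (Z u) => //=; case: (boolP (Z v)) => //= Zv.
  case ruv: (r u v); first by case: (r0 u v).
  case r0uv: (r0 u v) => //; case/negP: Zv; apply: (cl u v) => //.
  by rewrite /carries r0uv ruv.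
have : across Z r0 < across Z r.
  rewrite /across (bigD1 (Ordinal hx)) //= [X in _ < X](bigD1 (Ordinal hx)) //=.
  rewrite -addSn leq_add //; last by apply: leq_sum => u _; apply: leq_sum => v _; apply: le.
  rewrite (bigD1 (Ordinal ha)) //= [X in _ < X](bigD1 (Ordinal ha)) //=.
  rewrite -addSn leq_add //; last by apply: leq_sum => v _; apply: le.
  by move: ax; rewrite carries_rev // Zx (negPf Za) /= => /andP[-> /negPf->].
by rewrite e ltnn.
Qed.

End Fixed.

(** One step of augmentation: it moves one unit of out-degree from [x] to [y]. *)
Definition reverse (r : nat -> nat -> bool) (x y : nat) : nat -> nat -> bool :=
  fun u v => if (u == x) && (v == y) then false
             else if (u == y) && (v == x) then true else r u v.

(* Antiparallel edges are excluded, for reversing one would merge it with the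
other; the networks below satisfy this because their vertices are split. *)
Hypothesis simple0 : forall u v, u < M -> v < M -> r0 u v -> ~~ r0 v u.

Lemma reverse_pair (r : nat -> nat -> bool) x y : x < M -> y < M -> r x y ->
  (forall u v, u < M -> v < M -> r u v + r v u = r0 u v + r0 v u) ->
  forall u v, u < M -> v < M ->
    reverse r x y u v + reverse r x y v u = r0 u v + r0 v u.
Proof.
move=> hx hy rxy pr u v hu hv.
have s u' v' : u' < M -> v' < M -> r0 u' v' + r0 v' u' <= 1.
  move=> hu' hv'; case e: (r0 u' v'); last by case: (r0 v' u').
  by rewrite (negPf (simple0 hu' hv' e)).
have xy : x != y.
  apply/eqP => e; have := pr x y hx hy; have := s x y hx hy.
  by rewrite -e in rxy *; rewrite rxy => h1 h2; rewrite -h2 in h1.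
have ryx : r y x = false.
  by have := s x y hx hy; rewrite -pr // rxy; case: (r y x).
have p1 := pr x y hx hy; have p2 := pr y x hy hx; rewrite rxy ryx /= in p1 p2.
have := pr u v hu hv; rewrite /reverse.
case ux: (u == x); case vy: (v == y); case uy: (u == y); case vx: (v == x) => //=;
  move: ux vy uy vx;
  do ?[by do 4!case: eqP => // ?; subst; rewrite ?eqxx // in xy].
Qed.

Lemma reverse_deg (r : nat -> nat -> bool) x y u :
  x < M -> y < M -> x != y -> r x y -> ~~ r y x ->
  cnt (reverse r x y u) M + (u == x) = cnt (r u) M + (u == y).
Proof.
move=> hx hy xy rxy ryx.
have delta z : z < M -> 1 = \sum_(v < M) (val v == z).
  move=> hz; rewrite (bigD1 (Ordinal hz)) //= eqxx big1 // => v.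
  by rewrite -val_eqE /= => /negPf->.
have E (c : bool) z : z < M -> nat_of_bool c = \sum_(v < M) (c && (val v == z)).
  move=> hz; case: c => /=; first exact: delta.
  by rewrite big1.
rewrite (E (u == x) y hy) (E (u == y) x hx) -!big_split /=.
apply: eq_bigr => v _; rewrite /reverse.
case: (altP (u =P x)) => [->|ux]; case: (altP (val v =P y)) => [->|vy] //=;
 rewrite ?(negPf xy) ?rxy ?andbF //= ?(eq_sym y x) ?(negPf xy) //=.
  by case: (u == y) => //=; rewrite ?addn0.
case: (altP (u =P y)) => [->|uy] //=; case: eqP => [->|] //=.
  by rewrite (negPf ryx).
Qed.

End Flow.

(** * The linkage network *)
Inductive reach (M : nat) (e : nat -> nat -> bool) (x : nat) : nat -> Prop :=
| reach_refl : reach M e x x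
| reach_step u v : reach M e x u -> v < M -> e u v -> reach M e x v.

Lemma reach_lt M e x y : x < M -> reach M e x y -> y < M.
Proof. by move=> hx; case. Qed.

Lemma reach_decidable M (e : nat -> nat -> bool) x : x < M ->
  exists Z : nat -> bool, forall y, y < M -> (reach M e x y <-> Z y).
Proof.
move=> hx; pose er := [rel u v : 'I_M | e u v].
exists (fun y => if insub y is Some z then connect er (Ordinal hx) z else false).
move=> y hy; rewrite insubT; split=> [r|].
  elim: r hy => [|u v r IH hv uv] hy.
    by rewrite (_ : Sub x hy = Ordinal hx) ?connect0 //; apply: val_inj.
  by apply: connect_trans (IH (reach_lt hx r)) (connect1 _).
have path_reach p : path er (Ordinal hx) p -> reach M e x (last (Ordinal hx) p).
  elim/last_ind: p => [|p z IH]; first by move=> _; apply: reach_refl.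
  by rewrite rcons_path last_rcons => /andP[/IH r lz]; apply: reach_step r _ lz.
by case/connectP=> p /path_reach r e'; rewrite -e' in r.
Qed.

(* A network for disjoint paths that start in [term], follow the edges of [adj2]
through vertices in [pass], and end in distinct targets, [tgt x j] meaning that
the path may go from [x] to target [j].  Each of the [n2] vertices [x] is split
into the node [x] where paths enter and the node [vout x] where they leave.  A
vertex outside [pass] can be left for a target only. *)
Section Network.
Variables (n2 q : nat) (pass : nat -> bool) (adj2 tgt : nat -> nat -> bool).
Variable (term : nat -> bool).

Definition src : nat := n2 + n2 + q.
Definition snk : nat := src + 1.
Definition nnodes : nat := src + 2.
Definition vout x : nat := n2 + x.
Definition tg j : nat := n2 + n2 + j.

Definition net (u v : nat) : bool :=
  [|| [&& u < n2 & v == n2 + u],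
      [&& n2 <= u, u < n2 + n2, v < n2, v != u - n2, pass (u - n2) & adj2 (u - n2) v],
      [&& n2 <= u, u < n2 + n2, n2 + n2 <= v, v < src & tgt (u - n2) (v - (n2 + n2))],
      [&& n2 + n2 <= u, u < src & v == snk] |
      [&& u == src, v < n2 & term v]].

(** The edges of [net] by kind, for case analysis; [net] itself is the formula that
the program evaluates. *)
Inductive net_spec : nat -> nat -> Prop :=
| NetVertex x : x < n2 -> net_spec x (vout x)
| NetEdge x y : x < n2 -> y < n2 -> y != x -> pass x -> adj2 x y ->
    net_spec (vout x) y
| NetTarget x j : x < n2 -> j < q -> tgt x j -> net_spec (vout x) (tg j)
| NetSink j : j < q -> net_spec (tg j) snk
| NetSource x : x < n2 -> term x -> net_spec src x.

Lemma netP u v : reflect (net_spec u v) (net u v).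
Proof.
apply: (iffP idP); last first.
  rewrite /net /vout /tg; case=> [x hx|x y hx hy yx px axy|x j hx hj t|j hj|x hx t].
  - by rewrite hx eqxx.
  - by rewrite addKn leq_addr ltn_add2l hx hy yx px axy orbT.
  - by rewrite !addKn !leq_addr !ltn_add2l hx hj t !orbT.
  - by rewrite !leq_addr !ltn_add2l hj eqxx !orbT.
  - by rewrite eqxx hx t !orbT.
rewrite /net; case/or4P=> [|||/orP[]].
- by case/andP=> hu /eqP->; apply: NetVertex.
- case/and5P=> h1 h2 h3 h4 /andP[h5 h6]; rewrite -(subnKC h1); apply: NetEdge => //.
  by lia.
- case/and5P=> h1 h2 h3 h4 h5; rewrite -(subnKC h1) -(subnKC h3).
  by move: h4; rewrite /src => h4; apply: NetTarget => //; lia.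
- case/and3P=> h1 h2 /eqP->; rewrite -(subnKC h1); apply: NetSink.
  by move: h2; rewrite /src; lia.
- by case/and3P=> /eqP-> h2 h3; apply: NetSource.
Qed.

Ltac netlia := unfold nnodes, snk, src, tg, vout in *; lia.

Lemma net_simple u v : net u v -> ~~ net v u.
Proof.
move=> uv; apply/negP => /netP; case/netP: uv => [x hx|x y hx hy yx _ _|x j hx hj _|j hj|x hx _] h;
 inversion h; netlia.
Qed.

Lemma net_lt u v : net u v -> (u < nnodes) && (v < nnodes).
Proof.
by case/netP=> [x hx|x y hx hy yx _ _|x j hx hj _|j hj|x hx _]; netlia.
Qed.

Lemma src_lt : src < nnodes. Proof. by netlia. Qed.
Lemma snk_lt : snk < nnodes. Proof. by netlia. Qed.
Lemma src_snk : src != snk. Proof. by netlia. Qed.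

(** The hypothesis of Menger's theorem for this network: fewer than [K] vertices
[Y] and targets [J] do not separate the terminals from the targets.  A
set [W] that contains everything reachable is used to avoid speaking of paths:
it must contain a vertex with a remaining target. *)
Definition linkable (K : nat) : Prop :=
  forall Y J W : nat -> bool, cnt Y n2 + cnt J q < K ->
    (forall x, x < n2 -> term x -> ~~ Y x -> W x) ->
    (forall x y, x < n2 -> y < n2 -> W x -> pass x -> adj2 x y -> ~~ Y y -> W y) ->
    exists x j, [/\ x < n2, j < q, W x, tgt x j & ~~ J j].

Lemma across_cols (Z : nat -> bool) (s : nat -> nat -> bool) M :
  across M Z s = \sum_(v < M) \sum_(u < M) [&& Z u, ~~ Z v & s u v].
Proof. exact: exchange_big. Qed.

Lemma big_nodes (F : nat -> nat) :
  \sum_(v < nnodes) F v =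
    \sum_(x < n2) F x + \sum_(x < n2) F (vout x) + \sum_(j < q) F (tg j)
    + F src + F snk.
Proof.
rewrite /nnodes /snk addn2 addn1 !big_ord_recr /= /src !big_split_ord /=.
by [].
Qed.

Lemma bool_sum_ge (P : nat -> bool) M u : u < M -> P u ->
  1 <= \sum_(v < M) P v.
Proof. by move=> hu Pu; rewrite -/(cnt P M); apply: cnt_gt0 Pu. Qed.

(** A cut of edges is turned into a set of vertices and targets of at most the same
size: every edge that leaves [Z] enters a node which is charged with it. *)
Lemma net_cut K (Z : nat -> bool) : linkable K -> Z src -> ~~ Z snk ->
  K <= across nnodes Z net.
Proof.
move=> lk Zs Zt; rewrite leqNgt; apply/negP => lt.
pose fromZ v := has (fun u => Z u && net u v) (iota 0 nnodes).
have fromZI u v : Z u -> net u v -> fromZ v.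
  move=> Zu uv; apply/has_iotaP; exists u; last by rewrite Zu.
  by case/andP: (net_lt uv).
(* [Y x] holds if one of the two nodes of [x] is entered by an edge from [Z], and
[J j] if such an edge enters either target [j] or, from it, the sink. *)
pose Y x := if Z x then ~~ Z (vout x) else fromZ x.
pose J j := Z (tg j) || fromZ (tg j).
have small : cnt Y n2 + cnt J q <= across nnodes Z net.
  have col v : ~~ Z v -> fromZ v -> 1 <= \sum_(u < nnodes) [&& Z u, ~~ Z v & net u v].
    move=> Zv /has_iotaP[u hu] /andP[Zu uv].
    apply: (@bool_sum_ge (fun u => [&& Z u, ~~ Z v & net u v]) _ u) => //.
    by rewrite Zu Zv uv.
  rewrite across_cols.
  rewrite (big_nodes (fun v => \sum_(u < nnodes) [&& Z u, ~~ Z v & net u v])).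
  set A := \sum_(x < n2) _; set B := \sum_(x < n2) _; set C := \sum_(j < q) _.
  set D := \sum_(u < _) _; set E := \sum_(u < _) _.
  have hY : cnt Y n2 <= A + B.
    rewrite -big_split leq_sum // => x _ /=.
    case Yx: (Y x) => //; move: Yx; rewrite /Y; case: ifP => Zx h.
      rewrite (leq_trans (col (vout x) h _)) ?leq_addl // (fromZI x) //.
      by apply/netP/NetVertex.
    apply: leq_trans (col x (negbT Zx) h) _. by rewrite Zx leq_addr.
  have hJ : cnt J q <= C + E.
    have -> : E = cnt (fun u => Z u && net u snk) nnodes.
      by rewrite /E; apply: eq_bigr => u _; rewrite Zt.
    have : cnt (fun j => Z (tg j)) q <= cnt (fun u => Z u && net u snk) nnodes.
      apply: (@leq_cnt_inj _ _ (fun j u => u = tg j)).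
        move=> j hj Zj; have uv : net (tg j) snk by apply/netP/NetSink.
        by exists (tg j); split; rewrite ?Zj ?uv //; case/andP: (net_lt uv).
      by move=> j j' u _ _ _ _ _ _ -> /eqP; rewrite eqn_add2l => /eqP.
    have : cnt (fun j => ~~ Z (tg j) && fromZ (tg j)) q <= C.
      apply: leq_sum => j _; case: (boolP (Z _)) => //= Zj; case e: (fromZ _) => //.
      by apply: leq_trans (col _ Zj e) _; rewrite Zj.
    have := cnt_or (fun j => ~~ Z (tg j) && fromZ (tg j)) (fun j => Z (tg j)) q.
    have -> : cnt J q = cnt (fun j => ~~ Z (tg j) && fromZ (tg j) || Z (tg j)) q.
      by apply: eq_bigr => j _; rewrite /J; case: (Z _); case: (fromZ _).
    by lia.
  by lia.
have [||x [j [hx hj Wx txj]]] := lk Y J (fun x => Z (vout x)) (leq_ltn_trans small lt).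
- move=> x hx tx; rewrite /Y; case: ifP => Zx; first by rewrite negbK.
  by rewrite (fromZI src) //; apply/netP/NetSource.
- move=> x y hx hy Wx px axy.
  case: (altP (y =P x)) => [->|yx] //.
  rewrite /Y; case: ifP => Zy; first by rewrite negbK.
  by rewrite (fromZI (vout x)) //; apply/netP/NetEdge.
- by rewrite /J (fromZI (vout x)) ?orbT //; apply/netP/NetTarget.
Qed.

(* A flow of value [K] consists of [K] paths.  They are never extracted; the path
from a terminal [x] is the set of nodes that [x] reaches along used edges. *)
Section Saturated.
Variables (r : nat -> nat -> bool) (K : nat).
Hypothesis fl : is_flow nnodes src snk net r K.

Local Notation used := (carries net r).

Lemma used_net u v : used u v -> net u v.
Proof. by case/andP. Qed.

Lemma net_to_src u : ~~ net u src.
Proof.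
by apply/negP => /netP h; inversion h; netlia.
Qed.

Lemma net_from_src v : net src v -> v < n2 /\ term v.
Proof. by move=> /netP h; inversion h; subst; try (exfalso; netlia). Qed.

Lemma net_from_snk v : ~~ net snk v.
Proof.
by apply/negP => /netP h; inversion h; netlia.
Qed.

Lemma used_into_target : \sum_(j < q) used (tg j) snk = K.
Proof.
rewrite -(carries_sink fl src_lt snk_lt src_snk); last first.
  by move=> v _; apply: net_from_snk.
rewrite /cnt (big_nodes (fun u => used u snk)).
rewrite [X in X + _ + _ + _ + _]big1 ?add0n; last first.
  move=> x _; apply/eqP; rewrite eqb0; apply/negP => /used_net /netP h.
  by have hx := ltn_ord x; inversion h; netlia.
rewrite [X in X + _ + _ + _]big1 ?add0n; last first.
  move=> x _; apply/eqP; rewrite eqb0; apply/negP => /used_net /netP h.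
  by have hx := ltn_ord x; inversion h; netlia.
have -> : used src snk = false.
  by apply/negP => /used_net /netP h; inversion h; netlia.
have -> : used snk snk = false.
  by apply/negP => /used_net; apply/negP/net_from_snk.
by rewrite !addn0.
Qed.

Lemma used_continues x : x < nnodes -> x != src -> x != snk ->
  (exists u, used u x) <-> (exists v, used x v).
Proof.
move=> hx xs xt; have e := carries_conserved fl hx xs xt.
split=> [[u ux]|[v xv]].
  have /cnt_gt0E [v _ xv] : 0 < cnt (used x) nnodes; last by exists v.
  rewrite e; apply: (@cnt_gt0 _ _ u) => //.
  by case/andP: (net_lt (used_net ux)).
have /cnt_gt0E [u _ ux] : 0 < cnt (fun u => used u x) nnodes; last by exists u.
rewrite -e; apply: (@cnt_gt0 _ _ v) => //.
by case/andP: (net_lt (used_net xv)).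
Qed.

Lemma used_to_sink j u : j < q -> used u (tg j) -> used (tg j) snk.
Proof.
move=> hj uj; have /used_continues : exists u, used u (tg j) by exists u.
case=> [|||v jv]; [netlia..|]; have /netP h := used_net jv.
by inversion h as [| | |j' hj' e1 e2|]; subst; try (exfalso; netlia); rewrite e1.
Qed.

Lemma cnt_unique (P : nat -> bool) m u u' : cnt P m <= 1 -> u < m -> u' < m ->
  P u -> P u' -> u = u'.
Proof.
move=> le hu hu' Pu Pu'; apply/eqP/negPn/negP => uu'.
move: le; rewrite /cnt (bigD1 (Ordinal hu)) //= Pu (bigD1 (Ordinal hu')) //=.
  by rewrite Pu'.
by rewrite -val_eqE /= eq_sym.
Qed.

(** Every node but source and sink has at most one edge of [net] in or at most one
edge out, and conservation does the rest.  Hence the paths of the flow do not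
merge before the sink. *)
Lemma used_unique u u' y : y != snk -> used u y -> used u' y -> u = u'.
Proof.
move=> yt uy u'y.
have key : y != src -> (forall v v', used y v -> used y v' -> v = v') -> u = u'.
  move=> ys uniq.
  have /andP[hu hy] := net_lt (used_net uy).
  have /andP[hu' _] := net_lt (used_net u'y).
  apply: (@cnt_unique (fun u => used u y) nnodes) => //.
  rewrite -(carries_conserved fl hy ys yt).
  rewrite -[leqRHS](_ : cnt predT 1 = 1); last by rewrite /cnt big_ord1.
  apply: (@leq_cnt_inj _ _ (fun _ _ => True)) => [v _ _|v v' _ _ _ h h' _ _ _ _].
    by exists 0.
  exact: uniq.
have := used_net uy; have := used_net u'y => /netP h /netP h'; move: yt key.
inversion h' as [x hx ex ey|x z hx hz zx px axz ex ez|x j hx hj t ex ej|j hj ej et|x hx tx es ex];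
  subst => yt key.
- by inversion h; subst; netlia.
- apply: key; first by netlia.
  move=> v v' /used_net /netP h1 /used_net /netP h2.
  inversion h1; subst; try (exfalso; netlia).
  by inversion h2; subst; try (exfalso; netlia).
- apply: key; first by netlia.
  move=> v v' /used_net /netP h1 /used_net /netP h2.
  inversion h1; subst; try (exfalso; netlia).
  by inversion h2; subst; try (exfalso; netlia).
- by rewrite eqxx in yt.
- apply: key; first by netlia.
  move=> v v' /used_net /netP h1 /used_net /netP h2.
  inversion h1; subst; try (exfalso; netlia).
  by inversion h2; subst; try (exfalso; netlia).
Qed.

Lemma reach_not_src x y : x < n2 -> reach nnodes used x y -> y != src.
Proof.
move=> hx; elim=> [|u v _ _ _ uv]; first by netlia.
by apply: contraL (used_net uv) => /eqP->; apply: net_to_src.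
Qed.

(** Fewer than [K] vertices miss one of the [K] paths of the flow entirely, so
whatever avoids only those can follow this path to its target. *)
Lemma used_reaches (Y W : nat -> bool) : cnt Y n2 < K ->
  (forall x, x < n2 -> term x -> ~~ Y x -> W x) ->
  (forall x y, x < n2 -> y < n2 -> W x -> pass x -> adj2 x y -> ~~ Y y -> W y) ->
  exists x j, [/\ x < n2, j < q, W x, tgt x j & used (vout x) (tg j)].
Proof.
move=> small start closed.
(* If no flow goes from [W] to a target, then all flow that leaves [Z] does so
between the two nodes of a vertex of [Y], one unit per vertex, while [K] units
have to leave [Z]. *)
pose Z u := if u < n2 then W u || Y u
            else if u < n2 + n2 then W (u - n2) && ~~ Y (u - n2) else u == src.
have Zsrc : Z src by rewrite /Z eqxx !ifN //; netlia.
have Zsnk : ~~ Z snk by rewrite /Z !ifN; netlia.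
have Zvout x : x < n2 -> Z (vout x) = W x && ~~ Y x.
  by move=> hx; rewrite /Z /vout ltnNge leq_addr /= ltn_add2l hx addKn.
have := leq_trans small (carries_across fl src_lt Zsnk Zsrc).
case: (boolP (has (fun x => W x && has (fun j => used (vout x) (tg j)) (iota 0 q))
                  (iota 0 n2))) => [/has_iotaP[x hx]|nbad].
  case/andP=> Wx /has_iotaP[j hj uj] _.
  exists x, j; split=> //; have /netP h := used_net uj.
  inversion h as [| |x' j' hx' hj' t e1 e2| |]; try (exfalso; netlia).
  have -> : x = x' by netlia.
  by have -> : j = j' by netlia.
suff : across nnodes Z used <= cnt Y n2 by lia.
have -> : across nnodes Z used = \sum_(v < nnodes) \sum_(u < nnodes) [&& Z u, ~~ Z v & used u v].
  exact: exchange_big.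
rewrite (big_nodes (fun v => \sum_(u < nnodes) [&& Z u, ~~ Z v & used u v])).
have zero v : (forall u, u < nnodes -> Z u -> ~~ Z v -> used u v -> False) ->
    \sum_(u < nnodes) [&& Z u, ~~ Z v & used u v] = 0.
  move=> h; rewrite big1 // => u _; apply/eqP; rewrite eqb0; apply/negP.
  by case/and3P=> Zu Zv uv; apply: (h u).
rewrite [X in X + _ + _ + _ + _]big1 ?add0n; last first.
  move=> x _; have hx := ltn_ord x; apply: zero => u _ Zu Zx ux.
  move: Zx; rewrite /Z hx negb_or => /andP[Wx Yx]; case/negP: Wx.
  have /netP h := used_net ux; inversion h as [|x' y hx' hy yx px axy eu ey| | |x' hx' t eu ex];
    subst; try (exfalso; netlia).
    by move: Zu; rewrite Zvout // => /andP[Wx' _]; apply: closed axy Yx.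
  exact: start.
rewrite [X in _ + X + _ + _]big1 ?addn0; last first.
  move=> j _; have hj := ltn_ord j; apply: zero => u _ Zu Zj uj.
  case/negP: nbad; have /netP h := used_net uj.
  inversion h as [| |x' j' hx' hj' t e1 e2| |]; subst; try (exfalso; netlia).
  move: Zu; rewrite Zvout // => /andP[Wx' _]; apply/has_iotaP; exists x' => //.
  rewrite Wx'; apply/has_iotaP; exists (val j) => //.
rewrite zero ?addn0; last by move=> u _ _; rewrite Zsrc.
rewrite zero ?addn0; last first.
  move=> u _ Zu _ us; have /netP h := used_net us.
  inversion h; subst; try (exfalso; netlia).
  by move: Zu; rewrite /Z !ifN; netlia.
apply: leq_sum => x _; have hx := ltn_ord x.
case Yx: (Y x).
  rewrite -[leqRHS](_ : cnt predT 1 = 1); last by rewrite /cnt big_ord1.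
  apply: (@leq_cnt_inj (fun u => [&& Z u, ~~ Z (vout x) & used u (vout x)]) predT (fun _ _ => True)) => [v _ _|v v' z _ _].
    by exists 0.
  case/and3P=> _ _ uv /and3P[_ _ uv'] _ _ _ _; apply: used_unique uv uv'; netlia.
rewrite zero // => u _ Zu Zx ux; have /netP h := used_net ux.
inversion h as [x' hx' eu ex| | | |]; subst; try (exfalso; netlia).
have ex' : u = x by netlia.
by move: Zu Zx; rewrite Zvout // ex' /Z hx Yx orbF andbT => ->.
Qed.

Lemma reach_target_in x j : x < n2 -> j < q -> reach nnodes used x (tg j) ->
  exists y, [/\ y < n2, tgt y j & reach nnodes used x (vout y)].
Proof.
move=> hx hj r'; inversion r' as [e|u v ru _ uv e]; first by exfalso; netlia.
subst; have /netP h := used_net uv.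
inversion h as [| |x' j' hx' hj' t e1 e2| |]; subst; try (exfalso; netlia).
have -> : j = j' by netlia.
by exists x'.
Qed.

Hypothesis terms : cnt term n2 <= K.

Lemma used_source x : x < n2 -> term x -> used src x.
Proof.
move=> hx tx; have := carries_source fl src_lt src_snk.
rewrite [cnt (fun v => used v src) _]big1 ?addn0; last first.
  by move=> v _; rewrite /carries (negPf (net_to_src _)).
move=> e; case: (boolP (used src x)) => // nx.
have : cnt (used src) nnodes < cnt term n2.
  have -> : cnt (used src) nnodes = cnt (used src) n2.
    rewrite -[nnodes](@subnKC n2) ?cnt_shift; last by netlia.
    rewrite [X in _ + X]big1 ?addn0 // => i _.
    apply/eqP; rewrite eqb0; apply/negP => /used_net /netP h.
    by inversion h; netlia.
  rewrite /cnt (bigD1 (Ordinal hx)) //= [X in _ < X](bigD1 (Ordinal hx)) //=.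
  rewrite (negPf nx) tx add0n add1n ltnS leq_sum // => y _.
  by case uy: (used src y) => //; have [_ ->] := net_from_src (used_net uy).
by rewrite e; lia.
Qed.

(** Going backwards from a common node, the two paths agree as long as neither is at
its terminal ([used_unique]), and the only used edge into a terminal
comes from the source, which no path contains. *)
Lemma reach_disjoint x x' y : x < n2 -> x' < n2 -> term x -> term x' ->
  reach nnodes used x y -> reach nnodes used x' y -> y != snk -> x = x'.
Proof.
move=> hx hx' tx tx'; elim=> [|u v ru IH _ uv] r'.
  inversion r' as [|u v ru _ ux ev] => // xt; subst.
  have e := used_unique xt ux (used_source hx tx); subst u.
  by have := reach_not_src hx' ru; rewrite eqxx.
move=> vt; inversion r' as [ev|u' w ru' _ u'v ev]; subst.
  have e := used_unique vt uv (used_source hx' tx'); subst u.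
  by have := reach_not_src hx ru; rewrite eqxx.
have e := used_unique vt uv u'v; subst u'.
apply: IH ru' _; apply: contraL (used_net uv) => /eqP->; exact: net_from_snk.
Qed.

(** Otherwise the set of nodes that [x] reaches would neither contain the sink nor be
left by the flow, but be entered from the source; see [flow_closed]. *)
Lemma reach_target (Z : nat -> bool) x : x < n2 -> term x -> Z x ->
  (forall u v, u < nnodes -> v < nnodes -> Z u -> used u v -> Z v) ->
  exists2 j, j < q & Z (tg j).
Proof.
move=> hx tx Zx closed.
case: (boolP (has (fun j => Z (tg j)) (iota 0 q))) => [/has_iotaP[j hj Zj]|no].
  by exists j.
have notg j : j < q -> ~~ Z (tg j).
  by move=> hj; apply: contra no => Zj; apply/has_iotaP; exists j.
pose Z' u := [&& Z u, u != src & u != snk].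
suff : ~~ used src x by rewrite used_source.
apply: (flow_closed fl (Z := Z') src_lt).
- by rewrite /Z' eqxx andbF.
- by rewrite /Z' eqxx !andbF.
- move=> u v hu hv /and3P[Zu us ut] uv; rewrite /Z' (closed u v) //=.
  apply/andP; split; first by apply: contraL (used_net uv) => /eqP->; apply: net_to_src.
  apply/eqP => e; subst v; have /netP h := used_net uv.
  inversion h; subst; try (exfalso; netlia).
  by case/negP: (notg _ H).
- by netlia.
- by rewrite /Z' Zx; netlia.
Qed.

Lemma reach_used_in x y : x < n2 -> term x -> reach nnodes used x y ->
  exists u, used u y.
Proof.
move=> hx tx r'; inversion r' as [e|u v ru _ uv e]; last by exists u.
by subst; exists src; apply: used_source.
Qed.

(** The flow that enters [y] leaves it again, for a target if [y] is not passable. *)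
Lemma reach_pass x y : x < n2 -> term x -> y < n2 -> reach nnodes used x y ->
  pass y \/ exists j, [/\ j < q, tgt y j & reach nnodes used x (tg j)].
Proof.
move=> hx tx hy ry.
have /used_continues : exists u, used u y by apply: reach_used_in ry.
case=> [|||v yv]; [netlia..|].
have /netP h := used_net yv; inversion h; subst; try (exfalso; netlia).
have ry2 : reach nnodes used x (vout y) by apply: reach_step ry _ yv; netlia.
have /used_continues : exists u, used u (vout y) by exists y.
case=> [|||w yw]; [netlia..|].
have /netP h2 := used_net yw.
inversion h2 as [|x' z hx' hz zx px axz e1 e2|x' j hx' hj t e1 e2| |]; subst; try (exfalso; netlia).
  left; have -> : y = x' by netlia.
  by [].
right; have e : y = x' by netlia.
by subst x'; exists j; split=> //; apply: reach_step ry2 _ yw; netlia.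
Qed.

End Saturated.
End Network.

(** * The linkages given by a bramble *)
(** With [P v b] saying that [b] contains [v]: if each [v] lies in at most [c] bags,
the vertices of [Q] meet at most [c] times as many. *)
Lemma leq_cnt_union (P : nat -> nat -> bool) (Q : nat -> bool) n m c :
  (forall v, v < n -> cnt (P v) m <= c) ->
  cnt (fun b => has (fun v => Q v && P v b) (iota 0 n)) m <= c * cnt Q n.
Proof.
move=> hc.
have -> : c * cnt Q n = \sum_(v < n) c * Q v by rewrite /cnt big_distrr.
apply: (@leq_trans (\sum_(v < n) \sum_(b < m) (Q v && P v b))); last first.
  apply: leq_sum => v _; case: (Q v); rewrite ?muln1 ?muln0 /=.
    exact: hc.
  by rewrite big1.
rewrite exchange_big leq_sum // => b _.
case: has_iotaP => // -[v hv Qv].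
exact: (@cnt_gt0 (fun v => Q v && P v b) n v).
Qed.

Lemma cnt_gap (P Q : nat -> bool) n : cnt Q n < cnt P n ->
  exists i, [/\ i < n, P i & ~~ Q i].
Proof.
move=> lt; case: (boolP (has (fun i => P i && ~~ Q i) (iota 0 n))).
  by case/has_iotaP=> i hi /andP[]; exists i.
move=> no; have : cnt P n <= cnt Q n; last by lia.
apply: leq_cnt => i hi Pi; apply: contraR no => Qi.
by apply/has_iotaP; exists i; rewrite ?Pi.
Qed.

(* Everything is done twice, for the sources and for the sinks, and [sig] tells the
sides apart: on the side [sig = true] of the sinks, arcs are reversed.  When both
sides are linked at once, the vertices of the sinks' side are shifted by [n]. *)
Section Instance.
Variables (n k c nb : nat) (A inc : nat -> nat -> bool).
Variables (s : bool -> nat -> nat).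

Definition darc (sig : bool) u v := if sig then A v u else A u v.
Definition copy (sig : bool) v := if sig then n + v else v.
Definition arc2 x y := [&& x < n, y < n & A x y] ||
  [&& n <= x, x < n + n, n <= y, y < n + n & A (y - n) (x - n)].

Record instance : Prop := Instance {
  k_gt0 : 0 < k;
  s_lt : forall sig i, i < k -> s sig i < n;
  s_inj : forall sig i j, i < k -> j < k -> s sig i = s sig j -> i = j;
  (* connectivity after deletion of [Y], again without paths: a closed set that
     is not empty is everything *)
  strong : forall sig (Y W : nat -> bool), cnt Y n < k ->
    (exists2 u, u < n & W u && ~~ Y u) ->
    (forall u v, u < n -> v < n -> W u -> darc sig u v -> ~~ Y v -> W v) ->
    forall v, v < n -> ~~ Y v -> W v
}.

Record bags : Prop := Bags {
  bag_ne : forall b, b < nb -> exists2 v, v < n & inc b v;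
  bag_conn : forall sig b (W : nat -> bool), b < nb ->
    (exists v, [/\ v < n, inc b v & W v]) ->
    (forall u v, u < n -> v < n -> inc b u -> inc b v -> W u -> darc sig u v -> W v) ->
    forall v, v < n -> inc b v -> W v;
  bag_touch : forall b b', b < nb -> b' < nb ->
    (exists v, [/\ v < n, inc b v & inc b' v]) \/
    (exists u v, [/\ u < n, v < n, inc b u, inc b' v & A u v]);
  bag_cong : forall v, v < n -> cnt (fun b => inc b v) nb <= c
}.

Lemma arc2_copy sig u v : u < n -> v < n ->
  arc2 (copy sig u) (copy sig v) = darc sig u v.
Proof.
move=> hu hv; rewrite /arc2 /copy /darc; case: sig; last first.
  by rewrite hu hv /= [n <= u]leqNgt hu /= orbF.
by rewrite ![n + _ < n]ltnNge !leq_addr !addKn !ltn_add2l hu hv.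
Qed.

Lemma arc2_side sig u y : u < n -> arc2 (copy sig u) y ->
  exists2 v, v < n & y = copy sig v.
Proof.
move=> hu; rewrite /arc2 /copy; case: sig; case/orP.
- by case/and3P; lia.
- by case/and5P=> _ _ h1 h2 _; exists (y - n); lia.
- by case/and3P=> _ h _; exists y.
- by case/and5P; lia.
Qed.

Lemma copy_lt sig v : v < n -> copy sig v < n + n.
Proof. by rewrite /copy; case: sig; lia. Qed.

Lemma copy_inj sig sig' u v : u < n -> v < n -> copy sig u = copy sig' v ->
  sig = sig' /\ u = v.
Proof. by rewrite /copy; case: sig; case: sig'; lia. Qed.

Lemma cnt_copy sig (P : nat -> bool) :
  cnt (fun v => P (copy sig v)) n <= cnt P (n + n).
Proof. by rewrite cnt_shift /copy; case: sig; rewrite ?leq_addl ?leq_addr. Qed.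

Definition term_of (f : bool -> bool) (x : nat) : bool :=
  has (fun i => f false && (x == s false i) || f true && (x == n + s true i))
      (iota 0 k).

Lemma term_ofP (f : bool -> bool) x : reflect (exists sig i, [/\ f sig, i < k & x = copy sig (s sig i)])
  (term_of f x).
Proof.
apply: (iffP (has_iotaP _ _)).
  case=> i hi /orP[] /andP[h /eqP->]; first by exists false, i.
  by exists true, i.
case=> -[] [i [h hi ->]]; exists i => //; rewrite h /copy eqxx ?orbT //.
Qed.

Lemma cnt_const (d : bool) l : cnt (fun _ => d) l = d * l.
Proof. by rewrite /cnt sum_nat_const card_ord mulnC. Qed.

Lemma cnt_term_of (f : bool -> bool) : cnt (term_of f) (n + n) <= (f false + f true) * k.
Proof.
rewrite mulnDl -!cnt_const.
have -> : cnt (fun _ => f false) k + cnt (fun _ => f true) k =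
          cnt (fun i => if i < k then f false else f true) (k + k).
  rewrite cnt_shift; congr (_ + _); apply: eq_bigr => i _.
    by rewrite (ltn_ord i).
  by rewrite ltnNge leq_addr.
apply: (@leq_cnt_inj _ _ (fun x i =>
  x = if i < k then s false i else n + s true (i - k))).
  move=> x hx /term_ofP[[] [i [h hi ->]]].
    by exists (k + i); rewrite ltn_add2l [k + i < k]ltnNge leq_addr addKn.
  by exists i; rewrite hi; split=> //; lia.
by move=> x x' i _ _ _ _ _ _ -> ->.
Qed.

Hypothesis inst : instance.

Lemma small_avoids sig (Y : nat -> bool) : cnt Y n < k ->
  exists2 i, i < k & ~~ Y (s sig i).
Proof.
move=> small; case: (boolP (has (fun i => ~~ Y (s sig i)) (iota 0 k))).
  by case/has_iotaP=> i; exists i.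
move=> no; have : cnt predT k <= cnt Y n.
  apply: (@leq_cnt_inj _ _ (fun i v => v = s sig i)).
    move=> i hi _; exists (s sig i); split=> //; first exact: (s_lt inst).
    by apply: contraR no => h; apply/has_iotaP; exists i.
  by move=> i i' v hi hi' _ _ _ _ -> /(s_inj inst hi hi').
by rewrite (cnt_const true) mul1n leqNgt small.
Qed.

Lemma strong_start sig (Y W : nat -> bool) : cnt Y n < k ->
  (forall i, i < k -> ~~ Y (s sig i) -> W (s sig i)) ->
  (forall u v, u < n -> v < n -> W u -> darc sig u v -> ~~ Y v -> W v) ->
  forall v, v < n -> ~~ Y v -> W v.
Proof.
move=> small start closed; apply: (strong inst small (sig := sig)) => //.
have [i hi Yi] := small_avoids sig small.
by exists (s sig i); rewrite ?(s_lt inst) ?start.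
Qed.

Hypothesis Bs : bags.

Lemma arc_touch sig b b' : b < nb -> b' < nb ->
  (exists v, [/\ v < n, inc b' v & inc b v]) \/
  (exists u v, [/\ u < n, v < n, inc b u, inc b' v & darc sig u v]).
Proof.
move=> hb hb'; rewrite /darc; case: sig.
  have [[v [hv bv b'v]]|[u [v [hu hv bu bv uv]]]] := bag_touch Bs hb' hb.
    by left; exists v.
  by right; exists v, u.
have [[v [hv bv b'v]]|[u [v [hu hv bu bv uv]]]] := bag_touch Bs hb hb'.
  by left; exists v.
by right; exists u, v.
Qed.

Variable m : nat.

(* The state [st b] of bag [b] is 0 while it is available (alive), and [r + 1] once
it has been set aside (dead) in round [r].  The first [m] rounds belong to the
sources, the other [m] to the sinks, so [m < st b] tells the side of [b]. *)
Section State.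
Variable st : nat -> nat.

Definition alive_at v := has (fun b => (st b == 0) && inc b v) (iota 0 nb).
Definition dead_at sig v :=
  has (fun b => [&& st b != 0, (m < st b) == sig & inc b v]) (iota 0 nb).
(** Where a path of side [sig] may pass through.  Passing through a vertex of an
available bag is paid for by a bag set aside for the same side. *)
Definition pass_at sig v := ~~ alive_at v || dead_at sig v.
Definition pass2 x := if x < n then pass_at false x else pass_at true (x - n).
Definition alive2 x := if x < n then alive_at x else alive_at (x - n).

Lemma pass2_copy sig v : v < n -> pass2 (copy sig v) = pass_at sig v.
Proof.
by rewrite /pass2 /copy; case: sig => [_|->//]; rewrite ltnNge leq_addr addKn.
Qed.

Lemma alive2_copy sig v : v < n -> alive2 (copy sig v) = alive_at v.
Proof.
by rewrite /alive2 /copy; case: sig => [_|->//]; rewrite ltnNge leq_addr addKn.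
Qed.

(** What starts in the terminals of side [sig], moves through [pass_at] and avoids
fewer than [k] vertices [Y] meets a bag of state [rho]. *)
Definition robust sig rho : Prop := forall Y W : nat -> bool, cnt Y n < k ->
  (forall i, i < k -> ~~ Y (s sig i) -> W (s sig i)) ->
  (forall u v, u < n -> v < n -> W u -> pass_at sig u -> darc sig u v -> ~~ Y v -> W v) ->
  exists b v, [/\ b < nb, v < n, st b = rho, inc b v & W v].

Definition n_alive := cnt (fun b => st b == 0) nb.

Lemma n_hit (Y : nat -> bool) : cnt (fun b => has (fun v => Y v && inc b v) (iota 0 n)) nb <= c * cnt Y n.
Proof. by apply: (@leq_cnt_union (fun v b => inc b v)); apply: (bag_cong Bs). Qed.

(** Each vertex is a target of its own, since in a round the ends of the paths must
be distinct vertices. *)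
Definition round_tgt x j := (x == j) && alive2 x.

(** Suppose that only deleted vertices could be targets.  Then the paths of the
network are not restricted outside the deleted set, so by strong connectivity
they get everywhere else, in particular into an available bag that the deleted
vertices miss, which is a contradiction. *)
Lemma round_linkable sig : c * (k - 1) < n_alive ->
  linkable (n + n) (n + n) pass2 arc2 round_tgt (term_of (fun b => b == sig)) k.
Proof.
move=> many Y J W small start closed.
(* Deleting the target [j] amounts to deleting the vertex [j] of the same number. *)
pose Y' v := Y (copy sig v) || J (copy sig v).
have small' : cnt Y' n < k.
  apply: leq_ltn_trans small; apply: leq_trans (cnt_or _ _ _) _.
  by rewrite leq_add // cnt_copy.
pose good x := [&& W x, alive2 x & ~~ J x].
case: (boolP (has good (iota 0 (n + n)))) => [/has_iotaP[x hx /and3P[Wx ax Jx]]|no].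
  by exists x, x; rewrite /round_tgt eqxx.
have nogood x : x < n + n -> W x -> ~~ J x -> ~~ alive2 x.
  move=> hx Wx Jx; apply: contra no => ax; apply/has_iotaP; exists x => //.
  by rewrite /good Wx ax.
have all_in v : v < n -> ~~ Y' v -> W (copy sig v) && ~~ Y' v.
  apply: (strong_start (sig := sig) (W := fun v => W (copy sig v) && ~~ Y' v)) => //.
    move=> i hi Yi; rewrite Yi andbT; apply: start; first by apply: copy_lt; apply: (s_lt inst).
      by apply/term_ofP; exists sig, i; rewrite eqxx.
    by move: Yi; rewrite /Y' negb_or => /andP[].
  move=> u w hu hw /andP[Wu Yu] uw Yw; rewrite Yw andbT.
  apply: (closed _ _ _ _ Wu); try exact: copy_lt.
  - rewrite pass2_copy // /pass_at -(alive2_copy sig hu) nogood ?copy_lt ?Wu //.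
    by move: Yu; rewrite /Y' negb_or => /andP[].
  - by rewrite arc2_copy.
  - by move: Yw; rewrite /Y' negb_or => /andP[].
have [|b [hb ab nhit]] :=
  @cnt_gap (fun b => st b == 0) (fun b => has (fun v => Y' v && inc b v) (iota 0 n)) nb.
  apply: leq_ltn_trans (n_hit _) _; apply: leq_ltn_trans many.
  by rewrite leq_mul2l; apply/orP; right; lia.
have [v hv bv] := bag_ne Bs hb.
have Yv : ~~ Y' v by apply: contra nhit => Yv; apply/has_iotaP; exists v; rewrite ?Yv.
have /andP[Wv _] := all_in v hv Yv.
have Jv : ~~ J (copy sig v) by move: Yv; rewrite /Y' negb_or => /andP[].
have := nogood _ (copy_lt sig hv) Wv Jv; rewrite alive2_copy // => /negP[].
by apply/has_iotaP; exists b; rewrite ?ab.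
Qed.

End State.

(** The flow [r] of a round contains a path that avoids [Y]; its end is reached by
[W], and a bag through this end has received the stamp [rho].  The state may have
changed since: this only makes more vertices passable. *)
Lemma round_robust sig rho r st st' :
  is_flow (nnodes (n + n) (n + n)) (src (n + n) (n + n)) (snk (n + n) (n + n))
    (net (n + n) (n + n) (pass2 st) arc2 (round_tgt st) (term_of (fun b => b == sig))) r k ->
  (forall v, v < n -> pass_at st sig v -> pass_at st' sig v) ->
  (forall v, v < n -> alive_at st v ->
     ~~ r (tg (n + n) (copy sig v)) (snk (n + n) (n + n)) ->
     exists b, [/\ b < nb, st' b = rho & inc b v]) ->
  robust st' sig rho.
Proof.
move=> fl mono pick Y W small start closed.
pose lift (P : nat -> bool) x := P (if sig then x - n else x).
have liftE P v : lift P (copy sig v) = P v.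
  by rewrite /lift /copy; case: (sig); rewrite ?addKn.
pose onside x := if sig then n <= x else x < n.
have onsideE v : v < n -> onside (copy sig v).
  by rewrite /onside /copy; case: (sig) => // _; apply: leq_addr.
have onsideP x : x < n + n -> onside x -> exists2 v, v < n & x = copy sig v.
  rewrite /onside /copy => hx; case: (sig) => h; last by exists x.
  by exists (x - n); lia.
have terms : cnt (term_of (fun b => b == sig)) (n + n) <= k.
  by apply: leq_trans (cnt_term_of _) _; case: (sig); rewrite mul1n.
have [||| x [j [hx hj /andP[ox Wx] /andP[/eqP ej ax] uj]]] :=
  @used_reaches _ _ _ _ _ _ _ _ fl (fun x => onside x && lift Y x)
                (fun x => onside x && lift W x).
- apply: leq_ltn_trans small.
  apply: (@leq_cnt_inj _ _ (fun x v => x = copy sig v)).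
    move=> x hx /andP[ox Yx]; have [v hv e] := onsideP x hx ox.
    by exists v; rewrite e liftE in Yx *.
  by move=> x x' v _ _ _ _ _ _ -> ->.
- move=> x hx /term_ofP[sg [i [/eqP-> hi ->]]].
  have hs := s_lt inst sig hi.
  by rewrite onsideE // !liftE /=; apply: start.
- move=> x y hx hy /andP[ox Wx] px; have [v hv e] := onsideP x hx ox; subst x.
  move=> xy; have [w hw e] := arc2_side hv xy; subst y.
  rewrite onsideE // !liftE /= in Wx *; rewrite arc2_copy // in xy.
  by apply: closed Wx _ xy => //; apply: mono; rewrite -?pass2_copy.
have [v hv e] := onsideP x hx ox; subst x; subst j.
rewrite alive2_copy // in ax; rewrite liftE in Wx.
have := used_to_sink fl hj uj; case/andP=> _ uj'.
have [b [hb eb bv]] := pick v hv ax uj'.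
by exists b, v.
Qed.

Section Final.
Variable st : nat -> nat.
Definition final_tgt x b := (st b == 0) && (if x < n then inc b x else inc b (x - n)).

Lemma final_tgt_copy sig v b : v < n -> final_tgt (copy sig v) b = (st b == 0) && inc b v.
Proof.
by rewrite /final_tgt /copy; case: sig => [_|->//]; rewrite ltnNge leq_addr addKn.
Qed.

Section FinalCut.
Hypothesis m_def : m = c * (k - 1) + 1.
Hypothesis many : k + k + c * (k - 1) <= n_alive st.
Hypothesis groups : forall sig r, r < m -> robust st sig ((if sig then m else 0) + r.+1).

(** A cut of fewer than [2 k] elements is small on one side [sig].  It meets at most
[c (k - 1)] bags there, so one of the [m] groups of this side is intact, and so is
one of the available bags that have not been deleted as targets.  By robustness a
bag [b'] of the group is reached, which can be traversed and leads to the
available bag [b]. *)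
Lemma final_linkable :
  linkable (n + n) nb (pass2 st) arc2 final_tgt (term_of (fun _ => true)) (k + k).
Proof.
move=> Y J W small start closed.
have [sig small_sig] : exists sig, cnt (fun v => Y (copy sig v)) n < k.
  rewrite cnt_shift in small.
  case: (ltnP (cnt Y n) k) => h; first by exists false.
  by exists true; rewrite /copy; lia.
set Y' := (fun v => Y (copy sig v)) in small_sig.
pose hit b := has (fun v => Y' v && inc b v) (iota 0 n).
have hits : cnt hit nb <= c * (k - 1).
  by apply: leq_trans (n_hit _) _; rewrite leq_mul2l; apply/orP; right; lia.
have [|b [hb /eqP ab]] := @cnt_gap (fun b => st b == 0) (fun b => hit b || J b) nb.
  apply: leq_ltn_trans (cnt_or _ _ _) _; apply: leq_trans many; lia.
rewrite negb_or => /andP[nhit Jb].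
have [|g [hg _ gfree]] := @cnt_gap predT
    (fun g => has (fun b => (st b == (if sig then m else 0) + g.+1) && hit b) (iota 0 nb)) m.
  have -> : cnt predT m = (c * (k - 1)).+1 by rewrite (cnt_const true) mul1n m_def addn1.
  rewrite ltnS; apply: leq_trans hits.
  apply: (@leq_cnt_inj _ _ (fun g b => st b = (if sig then m else 0) + g.+1)).
    by move=> g hg /has_iotaP[b' hb' /andP[/eqP e h]]; exists b'.
  by move=> g g' b' _ _ _ _ _ _ -> ; lia.
have [||b' [v [hb' hv eb' bv Wv]]] := groups (sig := sig) hg (W := fun v => W (copy sig v)) small_sig.
- move=> i hi Yi; have hs := s_lt inst sig hi; apply: start => //; first exact: copy_lt.
  by apply/term_ofP; exists sig, i.
- move=> u w hu hw Wu pu uw Yw; apply: (closed _ _ _ _ Wu) => //; try exact: copy_lt.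
    by rewrite pass2_copy.
  by rewrite arc2_copy.
have free_b' w : w < n -> inc b' w -> ~~ Y' w.
  move=> hw bw; apply: contra gfree => Yw; apply/has_iotaP; exists b' => //.
  by rewrite eb' eqxx; apply/has_iotaP; exists w; rewrite ?Yw.
have free_b w : w < n -> inc b w -> ~~ Y' w.
  by move=> hw bw; apply: contra nhit => Yw; apply/has_iotaP; exists w; rewrite ?Yw.
have pass_b' w : w < n -> inc b' w -> pass_at st sig w.
  move=> hw bw; apply/orP; right; apply/has_iotaP; exists b' => //.
  by rewrite bw eb' andbT; case: (sig); lia.
have all_b' : forall w, w < n -> inc b' w -> W (copy sig w).
  apply: (bag_conn Bs (sig := sig) hb'); first by exists v.
  move=> u w hu hw bu bw Wu uw; apply: (closed _ _ _ _ Wu) => //; try exact: copy_lt.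
  - by rewrite pass2_copy ?pass_b'.
  - by rewrite arc2_copy.
  - exact: free_b'.
have [w [hw bw Ww]] : exists w, [/\ w < n, inc b w & W (copy sig w)].
  have [[w [hw bw b'w]]|[u [w [hu hw bu bw uw]]]] := arc_touch sig hb' hb.
    by exists w; rewrite all_b'.
  exists w; split=> //; apply: (closed _ _ _ _ (all_b' u hu bu)); try exact: copy_lt.
  - by rewrite pass2_copy ?pass_b'.
  - by rewrite arc2_copy.
  - exact: free_b.
exists (copy sig w), b; split=> //; first exact: copy_lt.
by rewrite final_tgt_copy // ab bw.
Qed.

End FinalCut.

Variable r : nat -> nat -> bool.
Local Notation n2 := (n + n).
Local Notation netF := (net n2 nb (pass2 st) arc2 final_tgt (term_of (fun _ => true))).
Local Notation used := (carries netF r).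
Hypothesis fl : is_flow (nnodes n2 nb) (src n2 nb) (snk n2 nb) netF r (k + k).

Definition freach x y := reach (nnodes n2 nb) used x y.

(** The bags and paths from which the [i]-th solution path is taken: the paths of
both [s_i] and [t_i] in the last linkage, and the bags where they end. *)
Definition territory i v : Prop := exists sig,
  freach (copy sig (s sig i)) (copy sig v) \/
  exists b, [/\ b < nb, inc b v & freach (copy sig (s sig i)) (tg n2 b)].

Lemma all_terms : cnt (term_of (fun _ => true)) n2 <= k + k.
Proof. by apply: leq_trans (cnt_term_of _) _; rewrite mulnDl mul1n. Qed.

Lemma is_term sig i : i < k -> term_of (fun _ => true) (copy sig (s sig i)).
Proof. by move=> hi; apply/term_ofP; exists sig, i. Qed.

Lemma freach_inj sig sig' i j y : i < k -> j < k -> y != snk n2 nb ->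
  freach (copy sig (s sig i)) y -> freach (copy sig' (s sig' j)) y -> sig = sig' /\ i = j.
Proof.
move=> hi hj hy ri rj.
have e := reach_disjoint fl all_terms (copy_lt sig (s_lt inst sig hi))
  (copy_lt sig' (s_lt inst sig' hj)) (is_term sig hi) (is_term sig' hj) ri rj hy.
have [e1 e2] := copy_inj (s_lt inst sig hi) (s_lt inst sig' hj) e.
by subst sig'; have := s_inj inst hi hj e2.
Qed.

(** If [v] is in an available bag, [i] is charged to a bag through [v]: to the
available bag where one of its paths ends, or to a bag set aside for the side
where its path passes through [v], which determines the side.  If [v] is in no
available bag, [i] is charged to a side on which its path contains [v]. *)
Lemma territory_congestion (P : nat -> nat -> bool) v : v < n -> 2 <= c ->
  (forall i, i < k -> P i v -> territory i v) ->
  cnt (fun i => P i v) k <= c.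
Proof.
move=> hv c2 terr.
have passed i : i < k -> P i v ->
    (exists sig b, [/\ b < nb, inc b v, st b = 0 & freach (copy sig (s sig i)) (tg n2 b)]) \/
    (exists sig, pass_at st sig v /\ freach (copy sig (s sig i)) (copy sig v)).
  move=> hi Pi; have [sig [rv|[b [hb bv rb]]]] := terr i hi Pi.
    have := reach_pass fl all_terms (copy_lt sig (s_lt inst sig hi)) (is_term sig hi)
             (copy_lt sig hv) rv.
    case=> [pv|[b [hb]]]; first by right; exists sig; rewrite -pass2_copy.
    by rewrite final_tgt_copy // => /andP[/eqP ab bv] rb; left; exists sig, b.
  left; exists sig, b; split=> //.
  have [y [hy /andP[/eqP-> _] _]] :=
    reach_target_in (copy_lt sig (s_lt inst sig hi)) hb rb.
  by [].
have vsnk sig : copy sig v != snk n2 nb by have := copy_lt sig hv; rewrite /snk /src; lia.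
have tsnk b : b < nb -> tg n2 b != snk n2 nb by rewrite /tg /snk /src; lia.
case: (boolP (alive_at st v)) => av; last first.
  have {}c2 : cnt predT 2 <= c by rewrite (cnt_const true).
  apply: leq_trans c2.
  apply: (@leq_cnt_inj _ _ (fun i j => exists sig, j = nat_of_bool sig /\
             freach (copy sig (s sig i)) (copy sig v))).
    move=> i hi Pi; have [[sig [b [hb bv ab _]]]|[sig [_ rv]]] := passed i hi Pi.
      by case/negP: av; apply/has_iotaP; exists b; rewrite ?ab.
    by exists sig; split=> //; [case: (sig)|exists sig].
  move=> i i' j hi hi' _ _ _ _ [sig [-> ri]] [sig' [e ri']].
  have e' : sig = sig' by move: e; case: (sig); case: (sig').
  by subst sig'; have [] := freach_inj hi hi' (vsnk sig) ri ri'.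
apply: leq_trans (bag_cong Bs hv).
apply: (@leq_cnt_inj _ _ (fun i b => exists sig,
   if st b == 0 then freach (copy sig (s sig i)) (tg n2 b)
   else sig = (m < st b) /\ freach (copy sig (s sig i)) (copy sig v))).
  move=> i hi Pi; have [[sig [b [hb bv ab rb]]]|[sig [pv rv]]] := passed i hi Pi.
    by exists b; split=> //; exists sig; rewrite ab.
  move: pv; rewrite /pass_at av => /has_iotaP[b hb /and3P[db /eqP eb bv]].
  by exists b; split=> //; exists sig; rewrite (negPf db).
move=> i i' b hi hi' _ _ hb _ [sig ri] [sig' ri']; move: ri ri'.
case: eqP => _.
  by move=> ri ri'; have [] := freach_inj hi hi' (tsnk b hb) ri ri'.
by move=> [-> ri] [-> ri']; have [] := freach_inj hi hi' (vsnk _) ri ri'.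
Qed.

Lemma freach_target sig i : i < k ->
  exists2 b, b < nb & freach (copy sig (s sig i)) (tg n2 b).
Proof.
move=> hi; have hs := copy_lt sig (s_lt inst sig hi).
have [|Z hZ] := @reach_decidable (nnodes n2 nb) used (copy sig (s sig i)).
  by rewrite /nnodes /src; lia.
have [||b hb Zb] := @reach_target _ _ _ _ _ _ _ _ fl all_terms Z _ hs (is_term sig hi).
- by apply/hZ; [rewrite /nnodes /src; lia | apply: reach_refl].
- by move=> u v hu hv /hZ ru uv; apply/hZ => //; apply: reach_step (ru hu) hv uv.
- by exists b => //; apply/hZ => //; rewrite /nnodes /src /tg; lia.
Qed.

(** A path of the linkage stays on its side until it ends in a bag.  [W] is a set
closed under going backwards along arcs within [mark]; on the side of the sources
[W] spreads from [v] back to the terminal, on the other side, where arcs are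
reversed, from the terminal to [v]. *)
Lemma freach_copy sig i y : i < k -> freach (copy sig (s sig i)) y -> y < n2 + n2 ->
  exists2 v, v < n & (y = copy sig v \/ y = vout n2 (copy sig v)) /\
    freach (copy sig (s sig i)) (copy sig v) /\
    forall (mark W : nat -> bool),
    (forall v, v < n -> freach (copy sig (s sig i)) (copy sig v) -> mark v) ->
    (forall u v, u < n -> v < n -> W v -> mark u -> A u v -> W u) ->
    if sig then W (s true i) -> W v else W v -> W (s false i).
Proof.
move=> hi; have hs := copy_lt sig (s_lt inst sig hi); elim=> [|u v ru IH hv uv] hy.
  exists (s sig i); first exact: (s_lt inst).
  split; first by left.
  split; first exact: reach_refl.
  by move=> mark W _ _; clear hs hy; case: sig.
have /netP uv' := used_net uv; inversion uv' as [x hx e1 e2|x y0 hx hy' yx px xy e1 e2|x j hx hj t e1 e2|j hj e1 e2|x hx t e1 e2].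
- have [|w hw [ew [rw H]]] := IH; first by lia.
  have exw : x = copy sig w by case: ew => //; rewrite /vout; lia.
  by exists w => //; split; [right; rewrite -e1 exw | split].
- have [|w hw [ew [rw H]]] := IH; first by rewrite -e1 /vout; lia.
  have exw : x = copy sig w.
    by have hcw := copy_lt sig hw; case: ew; rewrite -e1 /vout; lia.
  rewrite exw in xy; have [w' hw' ey] := arc2_side hw xy.
  rewrite ey arc2_copy // in xy.
  have rw' : freach (copy sig (s sig i)) (copy sig w').
    by rewrite -ey; apply: reach_step ru hv uv.
  exists w' => //; split; first by left.
  split=> // mark W hm hW; have := H mark W hm hW.
  move: xy rw rw' hm; rewrite /darc; case: (sig) => xy rw rw' hm.
    by move=> h /h Ww; apply: hW xy => //; apply: hm.
  by move=> h Ww'; apply: h; apply: hW Ww' _ xy => //; apply: hm.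
- by exfalso; unfold tg in *; lia.
- by exfalso; unfold snk, src in *; lia.
- by have := reach_not_src hs ru; rewrite -e1 eqxx.
Qed.

(** Going backwards from [s true i], one traverses the path of the sinks' side, the
bag where it ends, the bag of the other side, which touches it, and the path
to [s false i]. *)
Lemma territory_connected (mark W : nat -> bool) i : i < k ->
  (forall v, v < n -> mark v <-> territory i v) ->
  (forall u v, u < n -> v < n -> W v -> mark u -> A u v -> W u) ->
  W (s true i) -> W (s false i).
Proof.
move=> hi hmark hW Wt.
have mark_copy sig v : v < n -> freach (copy sig (s sig i)) (copy sig v) -> mark v.
  by move=> hv rv; apply/hmark => //; exists sig; left.
have mark_bag sig b v : b < nb -> v < n -> inc b v ->
    freach (copy sig (s sig i)) (tg n2 b) -> mark v.
  by move=> hb hv bv rb; apply/hmark => //; exists sig; right; exists b.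
have spread sig b : b < nb -> freach (copy sig (s sig i)) (tg n2 b) ->
    (exists v, [/\ v < n, inc b v & W v]) -> forall v, v < n -> inc b v -> W v.
  move=> hb rb ex; apply: (bag_conn Bs (sig := true) hb ex) => u v hu hv bu bv Wu /= vu.
  by apply: (hW v u) => //; apply: mark_bag rb.
have entry sig b : b < nb -> freach (copy sig (s sig i)) (tg n2 b) ->
    exists2 v, v < n & inc b v /\ (if sig then is_true (W v) else W v -> W (s false i)).
  move=> hb rb; have [y [hy t ry]] := reach_target_in (copy_lt sig (s_lt inst sig hi)) hb rb.
  have [|v hv [ev [rv H]]] := freach_copy hi ry; first by rewrite /vout; lia.
  have eyv : y = copy sig v by have := copy_lt sig hv; case: ev; rewrite /vout; lia.
  exists v => //; move: t; rewrite eyv final_tgt_copy // => /andP[_ bv]; split=> //.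
  have := H mark W _ hW; move: mark_copy => /(_ sig) mc.
  by case: (sig) mc => mc /(_ mc) // h; apply: h.
have [b hb rb] := freach_target false hi; have [b' hb' rb'] := freach_target true hi.
have [v hv [bv Wv]] := entry _ _ hb rb; apply: Wv.
apply: (spread false b) => //.
have all_b' : forall v, v < n -> inc b' v -> W v.
  by apply: (spread true b') => //; have [w hw [bw Ww]] := entry _ _ hb' rb'; exists w.
have [[w [hw bw b'w]]|[u [w [hu hw bu b'w uw]]]] := bag_touch Bs hb hb'.
  by exists w; rewrite all_b'.
exists u; split=> //; apply: hW (all_b' w hw b'w) _ uw => //.
by apply: mark_bag rb.
Qed.

End Final.
End Instance.

(** * Breadth first search *)
Lemma sem_seq p q m : sem (p;; q) m = sem q (sem p m). Proof. by []. Qed.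
Lemma sem_write a e1 e2 m : sem (a@[e1] <~ e2) m = update m a (eval m e1) (eval m e2).
Proof. by []. Qed.
Lemma sem_if e p q m : sem (CIf e p q) m = if truth m e then sem p m else sem q m.
Proof. by []. Qed.
Lemma sem_skip m : sem CSkip m = m. Proof. by []. Qed.
Definition semE := (sem_seq, sem_write, sem_if, sem_skip).
Arguments sem : simpl never.

(* The working memory.  Arrays up to 9 are left to input and output.  Names in [a]
   are tables: multiples of [n] and of the number [vM] of nodes, which replace
   multiplication ([aoffn], [aoff]); residual digraph and network ([ares],
   [anet]); marks, parents and queue of the search ([avis], [apar], [aque]); state
   of the bags ([ast]); vertices in available bags, passable vertices, terminals,
   and the territory of the current path.  Names in [v] are variables. *)
Notation aoffn := 10.
Notation aoff := 11.
Notation ares := 12.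
Notation anet := 13.
Notation avis := 14.
Notation apar := 15.
Notation aque := 16.
Notation ast := 17.
Notation aalive := 18.
Notation apass := 19.
Notation aterm := 20.
Notation amark := 21.
Notation vM := 30.
Notation vn2 := 31.
Notation vn4 := 32.
Notation vsrc := 33.
Notation vsnk := 34.
Notation vq := 35.
Notation vK := 36.
Notation vnb := 37.
Notation vm := 38.
Notation vm2 := 39.
Notation vlen := 40.
Notation vfS := 41.
Notation vfT := 42.
Notation vu := 50.
Notation vv := 51.
Notation vh := 52.
Notation vit := 53.
Notation vj := 54.
Notation vi := 55.
Notation vb := 56.
Notation vr := 57.
Notation vz := 58.
Notation vtail := 59.
Notation vx := 60.
Notation vy := 61.
Notation vstart := 62.
Notation vpick := 63.
Notation vdone := 64.
Notation vcount := 65.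
Notation vtgt := 66.

Definition visit : cmd :=
  avis@[$vv] <~ #1;; apar@[$vv] <~ $vu;; aque@[$vtail] <~ $vv;;
  vtail <~ Plus $vtail #1.

Definition scan (E : expr) : cmd :=
  CFor vv $vM (CIf (And E (Not avis~[$vv])) visit CSkip).

(** The expression [E] decides whether there is an edge from [$vu] to [$vv], so that
one search serves residual networks, territories and paths. *)
Definition search (E : expr) : cmd :=
  CFor vv $vM (avis@[$vv] <~ #0);;
  avis@[$vstart] <~ #1;; aque@[#0] <~ $vstart;; vtail <~ #1;;
  CFor vh $vM (CIf (Lt $vh $vtail) (vu <~ aque~[$vh];; scan E) CSkip).

(** The position in the queue serves as [rank]; it decreases from a node to its
parent, so that the walk along the parents ends, namely in [s]. *)
Definition searched (M : nat) (e : nat -> nat -> bool) (s : nat) (m : memory) : Prop :=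
  exists rank : nat -> nat,
  [/\ m avis s != 0,
      forall u v, u < M -> v < M -> m avis u != 0 -> e u v -> m avis v != 0,
      forall v, v < M -> m avis v != 0 -> rank v < M &
      forall v, v < M -> m avis v != 0 -> v <> s ->
        [/\ m apar v < M, m avis (m apar v) != 0, e (m apar v) v &
            rank (m apar v) < rank v]].

Section Search.
Variables (M s : nat) (e : nat -> nat -> bool).

Record queue (q : seq nat) (m : memory) : Prop := Queue {
  q_tail : m vtail 0 = size q;
  q_que : forall i, i < size q -> m aque i = nth 0 q i;
  q_uniq : uniq q;
  q_lt : forall v, v \in q -> v < M;
  q_vis : forall v, v < M -> (m avis v != 0) = (v \in q);
  (* [s] stays in front, for it is never visited again *)
  q_head : exists q', q = s :: q';
  q_par : forall v, v \in q -> v <> s ->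
    [/\ m apar v \in q, e (m apar v) v & index (m apar v) q < index v q]
}.

Lemma queue_size q m : queue q m -> size q <= M.
Proof.
move=> Q; rewrite -[M](size_iota 0); apply: uniq_leq_size (q_uniq Q) _ => v.
by move=> /(q_lt Q); rewrite mem_iota.
Qed.

Lemma queue_same q m m' : agree [:: vv; vh; vu] m m' -> queue q m -> queue q m'.
Proof.
move=> ag [h1 h2 h3 h4 h5 h6 h7].
have g a : a \notin [:: vv; vh; vu] -> forall x, m' a x = m a x by move=> h x; apply: ag.
split=> // [|i hi|v hv|v hv vs].
- by rewrite g.
- by rewrite g // h2.
- by rewrite g // h5.
- by rewrite g //; apply: h7.
Qed.

Lemma queue_visit q m u v : queue q m -> v < M -> m avis v = 0 ->
  u \in q -> e u v -> m vu 0 = u -> m vv 0 = v ->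
  queue (rcons q v) (sem visit m).
Proof.
move=> [h1 h2 h3 h4 h5 h6 h7] hv nv uq uv eu ev.
have vq : v \notin q by rewrite -h5 // nv.
rewrite /visit !semE /= ev !update_array // ev eu h1.
split.
- by rewrite update_same size_rcons addn1.
- move=> i; rewrite size_rcons ltnS => hi; rewrite update_array // updateE nth_rcons.
  by case: eqP => [->|ne]; rewrite ?ltnn // ?eqxx // !update_array // ifT ?h2 //; lia.
- by rewrite rcons_uniq vq.
- by move=> w; rewrite mem_rcons inE => /predU1P[->|/h4].
- move=> w hw; rewrite /update /= mem_rcons inE.
  by case: (w =P v) => //= _; apply: h5.
- by have [q' ->] := h6; exists (rcons q' v).
- move=> w; rewrite mem_rcons inE => wq ws.
  rewrite /update /=; case: (w =P v) wq => [-> _|wv /= wq].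
    by rewrite mem_rcons inE uq orbT uv -cats1 !index_cat uq (negPf vq) ltn_addr // index_mem.
  have [i1 i2 i3] := h7 w wq ws.
  by rewrite mem_rcons inE i1 orbT i2 -cats1 !index_cat i1 wq.
Qed.

Lemma scan_spec E q m u h :
  (forall m' v, agree (writes (search E)) m m' -> m' vu 0 = u -> m' vv 0 = v ->
     v < M -> truth m' E = e u v) ->
  m vM 0 = M -> m vu 0 = u -> queue q m -> h < size q -> nth 0 q h = u ->
  exists q', [/\ queue q' (sem (scan E) m), prefix q q' &
                 forall v, v < M -> e u v -> v \in q'].
Proof.
move=> hE hM hu Q hq eq_u.
pose I j m' := m' vu 0 = u /\
  exists q', [/\ queue q' m', prefix q q' & forall v, v < j -> v < M -> e u v -> v \in q'].
have [||_ [q' [Q' pq H]]] := @sem_For_ind vv $vM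
    (CIf (And E (Not avis~[$vv])) visit CSkip) m I isT.
- split; first by rewrite update_array.
  exists q; split=> //; last by apply: prefix_refl.
  by apply: queue_same Q => a; rewrite !inE !negb_or => /and3P[h1 _ _] x; rewrite update_array.
- rewrite /= hM => j m1 hj ag ej [eu [q' [Q' pq H]]].
  have uq' : u \in q'.
    by case/prefixP: pq => q2 ->; rewrite mem_cat -eq_u mem_nth.
  have ag' : agree (writes (search E)) m m1.
    by apply: agree_sub ag => a; rewrite /= !inE; do ![case: (a == _) => //].
  split; first by rewrite update_array // (sem_agree (p := CIf _ _ _)).
  rewrite sem_if truth_And truth_Not (hE m1 j) //= ej.
  have upd q2 m2 : queue q2 m2 -> queue q2 (update m2 vv 0 j.+1).
    apply: queue_same => a; rewrite !inE !negb_or => /and3P[h1 _ _] x.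
    by rewrite update_array.
  case: ifPn => [/andP[ue]|].
    rewrite negbK => /eqP nv; exists (rcons q' j); split.
    + by apply: upd; apply: (@queue_visit _ _ u).
    + by apply: prefix_trans pq _; apply: prefix_rcons.
    + move=> v; rewrite ltnS leq_eqVlt mem_rcons inE => /predU1P[->|hv]; first by rewrite eqxx.
      by move=> hv' uv; rewrite H ?orbT.
  move=> no; exists q'; split=> //; first exact: upd.
  move=> v; rewrite ltnS leq_eqVlt => /predU1P[->|hv]; last exact: H.
  by move=> hv uv; move: no; rewrite uv /= negbK (q_vis Q').
- exists q'; split=> // v hv; apply: H => //.
  by rewrite /= hM.
Qed.

Lemma search_spec E m :
  (forall m' u v, agree (writes (search E)) m m' -> m' vu 0 = u -> m' vv 0 = v ->
     u < M -> v < M -> truth m' E = e u v) ->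
  m vM 0 = M -> m vstart 0 = s -> s < M ->
  searched M e s (sem (search E) m).
Proof.
move=> hE hM hs sM; rewrite /search !sem_seq.
set m1 := sem (CFor _ _ _) m.
have ag1 : agree [:: vv; avis] m m1.
  exact: (@sem_agree (CFor vv $vM (avis@[$vv] <~ #0)) m).
have clear v : v < M -> m1 avis v = 0.
  have := @sem_For_ind vv $vM (avis@[$vv] <~ #0) m
    (fun j m' => forall v, v < j -> m' avis v = 0) isT.
  rewrite -/m1 /= hM; apply=> // j m2 hj _ ej H w.
  rewrite ltnS sem_write /= ej update_array // updateE.
  by case: eqP => // ne hw; apply: H; lia.
rewrite !sem_write /=.
set m2 := update _ vtail _ _.
have e2 a x : a \notin [:: avis; aque; vtail] -> m2 a x = m1 a x.
  by rewrite !inE !negb_or => /and3P[h1 h2 h3]; rewrite /m2 !update_array.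
have es : m1 vstart 0 = s by rewrite ag1.
have Q2 : queue [:: s] m2.
  rewrite /m2 es; split=> //=.
  - by case=> // _; rewrite update_array // update_array //.
  - by move=> v; rewrite inE => /eqP->.
  - move=> v hv; rewrite /update /= inE.
    by case: (v =P s) => // _; rewrite clear.
  - by exists [::].
  - by move=> v; rewrite inE => /eqP.
pose I h m' := exists q, queue q m' /\
  forall i v, i < h -> i < size q -> v < M -> e (nth 0 q i) v -> v \in q.
have := @sem_For_ind vh $vM (CIf (Lt $vh $vtail) (vu <~ aque~[$vh];; scan E) CSkip) m2 I isT.
have hM2 : m2 vM 0 = M by rewrite e2 // ag1.
rewrite /= hM2; set m3 := sem _ m2.
case=> [||q [Q H]].
- by exists [:: s]; split=> //; apply: queue_same Q2 => a; rewrite !inE !negb_or => /and3P[_ h1 _] x; rewrite update_array.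
- move=> h m4 hh ag eh [q [Q H]].
  have agm4 : agree (writes (search E)) m m4.
    apply: (@agree_trans _ _ m2).
      apply: (@agree_trans _ _ m1).
        by apply: agree_sub ag1 => a; rewrite /= !inE; do ![case: (a == _) => //].
      move=> a ha x; rewrite e2 //; apply: contra ha; rewrite /= !inE.
      by do ![case: (a == _) => //].
    by apply: agree_sub ag => a; rewrite /= !inE; do ![case: (a == _) => //].
  have upd q2 m5 : queue q2 m5 -> queue q2 (update m5 vh 0 h.+1).
    apply: queue_same => a; rewrite !inE !negb_or => /and3P[_ h1 _] x.
    by rewrite update_array.
  rewrite sem_if truth_Lt /= eh (q_tail Q); case: ifPn => hq; last first.
    exists q; split; first exact: upd.
    by move=> i v hi hi'; apply: H => //; lia.
  rewrite sem_seq sem_write /= eh (q_que Q) //.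
  set m5 := update m4 vu _ _.
  have Q5 : queue q m5.
    by apply: queue_same Q => a; rewrite !inE !negb_or => /and3P[_ _ h1] x; rewrite /m5 update_array.
  have agm5 : agree (writes (search E)) m m5.
    apply: (agree_trans agm4); apply: agree_update; by rewrite /= !inE.
  have u5 : m5 vu 0 = nth 0 q h by rewrite /m5 update_same.
  have [||q' [Q' pq H']] := @scan_spec E q m5 (nth 0 q h) h _ _ u5 Q5 hq erefl.
  + move=> m' v ag' eu ev hv; apply: hE => //; first exact: agree_trans ag'.
    by apply: (q_lt Q); apply: mem_nth.
  + by rewrite /m5 update_array // ag // hM2.
  exists q'; split; first exact: upd.
  case/prefixP: pq Q' H' => q2 -> Q' H' i v; rewrite ltnS leq_eqVlt => /predU1P[->|hi] hi' hv.
    by rewrite nth_cat hq; apply: H'.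
  rewrite nth_cat ifT; last by lia.
  by move=> ev; rewrite mem_cat (H i v) //; lia.
have hsz := queue_size Q.
exists (index^~ q); split.
- by rewrite (q_vis Q) //; have [q' ->] := q_head Q; rewrite mem_head.
- move=> u v hu hv; rewrite !(q_vis Q) // => uq uv.
  apply: (H (index u q) v) => //; rewrite ?index_mem // ?nth_index //.
  by apply: leq_trans hsz; rewrite index_mem.
- by move=> v hv; rewrite (q_vis Q) // -index_mem => h; apply: leq_trans hsz.
- move=> v hv; rewrite (q_vis Q) // => vq vs; have [i1 i2 i3] := q_par Q vq vs.
  by rewrite (q_vis Q) // (q_lt Q i1).
Qed.
End Search.

Lemma searched_reach M e s m v : searched M e s m -> s < M -> v < M ->
  reach M e s v <-> m avis v != 0.
Proof.
move=> [rank [h1 h2 h3 h4]] sM hv; split=> [r|].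
  elim: r hv => [|u w r IH hw uw] hv //.
  by have hu := reach_lt sM r; apply: h2 (IH hu) uw.
have [d hd] : exists d, rank v < d by exists (rank v).+1.
elim: d v hv hd => [//|d IH] v hv hd nv.
case: (altP (v =P s)) => [->|/eqP vs]; first exact: reach_refl.
have [i1 i2 i3 i4] := h4 v hv nv vs.
by apply: reach_step (IH _ i1 _ i2) hv i3; lia.
Qed.

(** * Maximum flow by augmentation *)
Definition table (a : nat) (len stride : expr) : cmd :=
  vz <~ #0;; CFor vv len (a@[$vv] <~ $vz;; vz <~ Plus $vz stride).

Lemma table_spec a len stride m :
  a \notin [:: vz; vv] ->
  all (fun x => x \notin [:: a; vz; vv]) (reads len ++ reads stride) ->
  forall j, j < eval m len -> sem (table a len stride) m a j = j * eval m stride.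
Proof.
rewrite all_cat => ha /andP[hl hs].
rewrite /table sem_seq; set m1 := sem _ m.
have ag1 : agree [:: a; vz; vv] m m1 by rewrite /m1 /=; apply: agree_update; rewrite !inE eqxx orbT.
rewrite -(eval_agree ag1 hl).
have az : a != vz by move: ha; rewrite !inE negb_or => /andP[].
have av : a != vv by move: ha; rewrite !inE negb_or => /andP[].
have [|||_ H] := @sem_For_ind vv len (a@[$vv] <~ $vz;; vz <~ Plus $vz stride) m1
  (fun j m' => m' vz 0 = j * eval m stride /\
     forall i, i < j -> m' a i = i * eval m stride).
- by rewrite /= !inE negb_or eq_sym av.
- by split=> //; rewrite update_array // /m1 /= update_same.
- move=> j m2 hj ag ej [hz H].
  have es : eval m2 stride = eval m stride.
    apply: eval_agree hs; apply: (agree_trans ag1); apply: agree_sub ag => x.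
    by rewrite /= !inE; do ![case: (x == _) => //].
  rewrite !semE /= ej; split.
    rewrite update_array // update_same update_array; last by rewrite eq_sym.
    by rewrite (eval_agree (L := [:: a; vz; vv]) (m := m2)) ?es ?hz ?mulSn 1?addnC //; apply: agree_update; rewrite inE eqxx.
  move=> i; rewrite ltnS => hi; rewrite update_array // update_array // updateE.
  by case: eqP => [->//|ne]; apply: H; lia.
exact: H.
Qed.

Definition mat (a M : nat) (m : memory) (u v : nat) : bool := m a (u * M + v) != 0.

Lemma mat_inj M u v u' v' : v < M -> v' < M -> u * M + v = u' * M + v' -> u = u' /\ v = v'.
Proof.
move=> hv hv' e; have e1 : u = u'.
  have := congr1 (divn^~ M) e; have M0 : 0 < M by lia.
  by rewrite /= !divnMDl // !divn_small // !addn0.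
by split=> //; subst u'; lia.
Qed.

Definition cell : expr := Plus aoff~[$vu] $vv.

Definition fill (E : expr) : cmd :=
  CFor vu $vM (CFor vv $vM (anet@[cell] <~ E;; ares@[cell] <~ E)).

Definition augment : cmd :=
  vstart <~ $vsrc;; search ares~[cell];; vy <~ $vsnk;;
  CFor vj $vM (CIf (Not (Eq $vy $vsrc))
    (vx <~ apar~[$vy];; ares@[Plus aoff~[$vx] $vy] <~ #0;;
     ares@[Plus aoff~[$vy] $vx] <~ #1;; vy <~ $vx) CSkip).

Definition flow (E : expr) : cmd :=
  table aoff $vM $vM;; fill E;; CFor vit $vK augment.

Section FlowProgram.
Variables (M a b : nat) (r0 : nat -> nat -> bool).
Hypothesis aM : a < M.
Hypothesis bM : b < M.
Hypothesis ab : a != b.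

Definition set_up (m : memory) : Prop :=
  [/\ m vM 0 = M, m vsrc 0 = a, m vsnk 0 = b & forall j, j < M -> m aoff j = j * M].

Lemma set_up_agree L m m' : agree L m m' ->
  all (fun x => x \notin L) [:: vM; vsrc; vsnk; aoff] -> set_up m -> set_up m'.
Proof.
move=> ag /and5P[h1 h2 h3 h4 _] [e1 e2 e3 e4].
by split=> [|||j hj]; rewrite ag ?e4.
Qed.

Lemma fill_spec E m :
  (forall m' u v, agree (writes (fill E)) m m' -> m' vu 0 = u -> m' vv 0 = v ->
     u < M -> v < M -> truth m' E = r0 u v) ->
  set_up m ->
  forall u v, u < M -> v < M ->
    mat ares M (sem (fill E) m) u v = r0 u v /\ mat anet M (sem (fill E) m) u v = r0 u v.
Proof.
move=> hE su.
pose I j m' := forall u v, u < j -> u < M -> v < M ->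
  mat ares M m' u v = r0 u v /\ mat anet M m' u v = r0 u v.
have eM : m vM 0 = M by case: su.
suff HI : I (eval m $vM) (sem (fill E) m).
  by move=> u v hu hv; apply: HI; rewrite /= ?eM.
apply: sem_For_ind => // i m1; rewrite /= eM => hi ag1 ei H1.
pose J j m' := m' vu 0 = i /\ (forall u v, u < i \/ u = i /\ v < j -> u < M -> v < M ->
  mat ares M m' u v = r0 u v /\ mat anet M m' u v = r0 u v).
have ag1' : agree (writes (fill E)) m m1 by [].
have su1 : set_up m1 by apply: set_up_agree ag1 _ su.
have eM1 : m1 vM 0 = M by case: su1.
have [||_ H2] := @sem_For_ind vv $vM (anet@[cell] <~ E;; ares@[cell] <~ E) m1 J isT.
- split; first by rewrite update_array.
  move=> u v [hu|[_]] //.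
  by rewrite /mat !update_array //; apply: H1.
- rewrite /= eM1 => j m2 hj ag2 ej [ei2 H2].
  have ag2' : agree (writes (fill E)) m m2.
    by apply: (agree_trans ag1'); apply: agree_sub ag2 => x; rewrite /= !inE => ->; rewrite orbT.
  have su2 : set_up m2 by apply: set_up_agree ag2 _ su1.
  have eo : m2 aoff i = i * M by case: su2 => _ _ _; apply.
  rewrite !semE /= ej ei2 eo.
  set m3 := update m2 anet _ _.
  have E2 : truth m2 E = r0 i j by apply: hE.
  have E3 : truth m3 E = r0 i j.
    apply: hE => //; try by rewrite /m3 update_array.
    by apply: (agree_trans ag2'); apply: agree_update; rewrite /= !inE.
  have eo3 : m3 aoff i = i * M by rewrite /m3 update_array.
  have ei3 : m3 vu 0 = i by rewrite /m3 update_array.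
  have ej3 : m3 vv 0 = j by rewrite /m3 update_array.
  rewrite ei3 ej3 eo3.
  split; first by rewrite !update_array.
  move=> u v cas hu hv.
  rewrite /mat (update_array _ _ _ (a := vv)) // (update_array _ _ _ (a := vv)) //.
  rewrite updateE (update_array _ _ _ (a := ares)) // /m3 updateE.
  case: (u * M + v =P i * M + j) => [e|ne].
    by have [-> ->] := mat_inj hv hj e; rewrite E2 E3.
  rewrite update_array //; apply: H2 => //.
  case: cas => [h|[eu hv']]; [by left | right; split=> //].
  by have : v <> j; [move=> ev; apply: ne; rewrite ev eu | lia].
- move=> u v; rewrite ltnS leq_eqVlt => hu hu' hv.
  rewrite /mat !update_array //; apply: H2 => //.
  by rewrite /= eM1; case/predU1P: hu => [->|hu]; [right | left].
Qed.

Hypothesis simple0 : forall u v, u < M -> v < M -> r0 u v -> ~~ r0 v u.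

(** The search fails to reach the sink only if the flow has the value of a cut
([flow_augment_cut]), which [t] does not. *)
Lemma augment_spec t m : set_up m -> is_flow M a b r0 (mat ares M m) t ->
  (forall Z : nat -> bool, Z a -> ~~ Z b -> t < across M Z r0) ->
  is_flow M a b r0 (mat ares M (sem augment m)) t.+1.
Proof.
move=> su fl cut; rewrite /augment sem_seq sem_write /=.
set m1 := update m vstart _ _.
have su1 : set_up m1.
  by apply: (@set_up_agree [:: vstart] m) su => //; apply: agree_update; rewrite inE.
have [eM1 es1 et1 eo1] := su1.
have fl1 : is_flow M a b r0 (mat ares M m1) t by rewrite /m1 /mat; exact: fl.
have hs1 : m1 vstart 0 = a by rewrite /m1 update_same; case: su.
clearbody m1; clear fl su m.
rewrite sem_seq; set m2 := sem (search _) m1.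
have se : searched M (mat ares M m1) a m2.
  apply: search_spec => // m' u v ag eu ev hu hv.
  by rewrite /= eu ev /mat !ag // eo1.
have ag2 : agree (writes (search ares~[cell])) m1 m2 by apply: sem_agree.
have su2 : set_up m2 by apply: set_up_agree ag2 _ su1.
have eres x : m2 ares x = m1 ares x by rewrite ag2.
pose r := mat ares M m1.
have e2 u v : mat ares M m2 u v = r u v by rewrite /mat eres.
have [rank [Za closed rankM parP]] := se.
pose Z v := m2 avis v != 0.
have Zb : Z b.
  apply: contraT => Zb.
  have := cut Z Za Zb; rewrite (flow_augment_cut fl1 aM Za Zb closed).
  by rewrite ltnn.
rewrite sem_seq sem_write /=; set m3 := update m2 vy _ _.
have su3 : set_up m3.
  by apply: (@set_up_agree [:: vy] m2) su2 => //; apply: agree_update; rewrite inE.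
have [eM3 es3 et3 eo3] := su3.
(* After [j] steps from the sink along the parents, the edges between [y] and the
sink on the tree path have been reversed: this is a reorientation in which, apart
from the sink, just [y] has lost one unit of out-degree, and in which nothing of
rank at most that of [y] has changed. *)
pose I j m' := exists y, [/\ m' vy 0 = y, y < M /\ Z y, y = a \/ rank y + j <= rank b,
  (forall u v, u < M -> v < M ->
      mat ares M m' u v + mat ares M m' v u = r0 u v + r0 v u) /\
  (forall u, u < M -> u != b -> cnt (mat ares M m' u) M + (u == y) = cnt (r u) M) &
  rank y <= rank b /\ forall u v, u < M -> v < M -> Z u -> Z v -> rank u <= rank y -> rank v <= rank y ->
    mat ares M m' u v = r u v].
set body := (X in CFor _ _ X).
have HI : I (eval m3 $vM) (sem (CFor vj $vM body) m3).
  apply: sem_For_ind => //.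
  - exists b; split.
    + by rewrite update_array // /m3 update_same; case: su2.
    + by [].
    + by right; rewrite addn0.
    + have e0 u v : mat ares M (update m3 vj 0 0) u v = r u v by rewrite -e2.
      split=> [u v hu hv|u hu ub]; first by rewrite !e0; apply: (flow_pair fl1).
      by rewrite (negPf ub) addn0; apply: eq_bigr => v _; rewrite e0.
    + by split=> // u v *; rewrite -e2.
  - rewrite /= eM3 => j m4 hj ag ej [y [ey [hy Zy] cas [pr dg] [rb same]]].
    have su4 : set_up m4 by apply: set_up_agree ag _ su3.
    have [_ es4 _ eo4] := su4.
    have epar x : m4 apar x = m2 apar x.
      by rewrite ag // /m3 update_array.
    rewrite /body sem_if truth_Not truth_Eq /= ey es4.
    case: (altP (y =P a)) => [ya|ya] /=.
      by exists y; split=> //; left.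
    have [hx Zx rxy lt] := parP y hy Zy (elimN eqP ya).
    rewrite -epar in hx Zx rxy lt; set x := m4 apar y in hx Zx rxy lt.
    have xy : x != y by apply: contraTneq lt => ->; rewrite ltnn.
    have r4xy : mat ares M m4 x y by rewrite same // ltnW.
    have r4yx : ~~ mat ares M m4 y x.
      apply/negP => yx; have := pr x y hx hy; rewrite r4xy yx.
      case e: (r0 x y); first by rewrite (negPf (simple0 hx hy e)).
      by case: (r0 y x).
    rewrite !semE /= ey.
    rewrite -/x; set m5 := update m4 vx 0 x.
    have e5 z w : z != vx -> m5 z w = m4 z w by move=> h; rewrite /m5 update_array.
    have e5x : m5 vx 0 = x by rewrite /m5 update_same.
    rewrite e5x (e5 aoff) // (e5 vy) // ey eo4 //.
    set m6 := update m5 ares _ _.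
    have e6 z w : z != ares -> m6 z w = m5 z w by move=> h; rewrite /m6 update_array.
    rewrite !(e6 vy) // !(e6 aoff) // !(e6 vx) // !(e5 vy) // ey (e5 aoff) // eo4 // e5x.
    rewrite (update_array _ _ _ (a := ares)) // (e6 vx) // e5x.
    set m8 := update _ vj _ _.
    have er8 u v : u < M -> v < M -> mat ares M m8 u v = reverse (mat ares M m4) x y u v.
      move=> hu hv; rewrite /mat /m8 (update_array _ _ _ (a := vj)) // (update_array _ _ _ (a := vy)) //.
      rewrite updateE /m6 updateE e5 // /reverse.
      have E z w : z < M -> w < M -> (u * M + v == z * M + w) = (u == z) && (v == w).
        move=> hz hw; apply/eqP/andP => [e|[/eqP-> /eqP->]] //.
        by have [-> ->] := mat_inj hv hw e.
      rewrite !E //; case: (altP (u =P x)) => [->|ux] /=.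
        by rewrite (negPf xy) /=; case: (v == y).
      by case: (_ && _).
    exists x; split=> //.
    + by case: cas => [e|h]; [rewrite e eqxx in ya | right; lia].
    + split=> [u v hu hv|u hu ub]; first by rewrite !er8 //; apply: (reverse_pair simple0 hx hy r4xy pr).
      rewrite -(dg u hu ub) -(reverse_deg u hx hy xy r4xy r4yx); congr (_ + _).
      by apply: eq_bigr => v _; rewrite er8.
    + split; first by lia.
      move=> u v hu hv Zu Zv ru rv; rewrite er8 // /reverse.
      have uy : u != y by apply: contraTneq ru => ->; lia.
      have vy' : v != y by apply: contraTneq rv => ->; lia.
      by rewrite (negPf uy) (negPf vy') andbF /= same //; lia.
move: HI; rewrite /= eM3 => -[y [_ [hy Zy] cas [pr dg] _]].
have ya : y = a by case: cas => // h; have := rankM b bM Zb; lia.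
split=> // u hu ub; rewrite -(flow_deg fl1 hu ub) -(dg u hu ub) ya mulnSr; lia.
Qed.

Lemma flow_spec K E m :
  (forall m' u v, agree (writes (flow E)) m m' -> m' vu 0 = u -> m' vv 0 = v ->
     u < M -> v < M -> truth m' E = r0 u v) ->
  m vM 0 = M -> m vsrc 0 = a -> m vsnk 0 = b -> m vK 0 = K ->
  (forall Z : nat -> bool, Z a -> ~~ Z b -> K <= across M Z r0) ->
  let m' := sem (flow E) m in
  [/\ is_flow M a b r0 (mat ares M m') K,
      forall u v, u < M -> v < M -> mat anet M m' u v = r0 u v &
      set_up m'].
Proof.
move=> hE eM ea eb eK cut m'.
rewrite /m' /flow sem_seq sem_seq; set m1 := sem (table _ _ _) m.
have ag1 : agree (writes (flow E)) m m1.
  apply: agree_sub (@sem_agree (table aoff $vM $vM) m) => x; rewrite /= !inE.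
  by do ![case: (x == _) => //].
have su1 : set_up m1.
  split; try by rewrite ag1.
  move=> j hj; rewrite /m1 (@table_spec aoff $vM $vM) //=; last by rewrite eM.
  by rewrite eM.
set m2 := sem (fill E) m1.
have ag2 : agree (writes (fill E)) m1 m2 by apply: sem_agree.
have su2 : set_up m2 by apply: set_up_agree ag2 _ su1.
have fill2 u v : u < M -> v < M -> mat ares M m2 u v = r0 u v /\ mat anet M m2 u v = r0 u v.
  apply: fill_spec => // m3 u' v' ag3; apply: hE; apply: (agree_trans ag1).
  by apply: agree_sub ag3 => x; rewrite /= !inE; do ![case: (x == _) => //].
have eK2 : m2 vK 0 = K by rewrite ag2 // ag1.
have := @sem_For_ind vit $vK augment m2 (fun t m3 =>
  [/\ is_flow M a b r0 (mat ares M m3) t,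
      forall u v, u < M -> v < M -> mat anet M m3 u v = r0 u v &
      set_up m3]) isT.
rewrite /= eK2; apply.
- have su3 : set_up (update m2 vit 0 0).
    by apply: (@set_up_agree [:: vit] m2) su2 => //; apply: agree_update; rewrite inE.
  split=> //.
    split=> [u v hu hv|u hu _]; last first.
      rewrite muln0 addn0; apply: eq_bigr => v _.
      by have [<- _] := fill2 u v hu (ltn_ord v).
    by have [<- _] := fill2 u v hu hv; have [<- _] := fill2 v u hv hu.
  by move=> u v hu hv; have [_ <-] := fill2 u v hu hv.
- move=> t m3 ht _ _ [fl net3 su3].
  have su4 : set_up (sem augment m3) by apply: set_up_agree (@sem_agree augment m3) _ su3.
  split.
  + have -> : mat ares M (update (sem augment m3) vit 0 t.+1) = mat ares M (sem augment m3) by [].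
    apply: augment_spec => // Z Za Zb; apply: leq_trans (cut Z Za Zb); exact: ht.
  + move=> u v hu hv; rewrite -net3 // /mat update_array //.
    by rewrite (@sem_agree augment).
  + by apply: (@set_up_agree [:: vit]) su4 => //; apply: agree_update; rewrite inE.
Qed.

End FlowProgram.

(** * Construction of the networks *)
Definition any (len e : expr) : cmd :=
  vz <~ #0;; CFor vb len (vz <~ Plus $vz e).

Lemma any_spec len e m (p : nat -> bool) :
  all (fun x => x \notin [:: vz; vb]) (reads len) ->
  (forall j m1, j < eval m len -> agree [:: vz; vb] m m1 -> m1 vb 0 = j ->
     truth m1 e = p j) ->
  (sem (any len e) m vz 0 != 0) = has p (iota 0 (eval m len)).
Proof.
move=> hl he; rewrite /any sem_seq; set m1 := sem _ m.
have ag1 : agree [:: vz; vb] m m1 by rewrite /m1 /=; apply: agree_update; rewrite !inE.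
rewrite -(eval_agree ag1 hl).
apply: (@sem_For_ind vb len _ m1 (fun j m' => (m' vz 0 != 0) = has p (iota 0 j))) => //.
move=> j m2 hj ag ej H.
rewrite -[in iota 0 j.+1]addn1 iotaD has_cat /= orbF add0n update_array //.
rewrite sem_write /= update_same -H -(he j m2) //.
- by rewrite -!lt0n addn_gt0.
- by rewrite -(eval_agree ag1 hl).
by apply: (agree_trans ag1); apply: agree_sub ag => x; rewrite /= !inE orbC.
Qed.

Lemma any_agree len e m : agree [:: vz; vb] m (sem (any len e) m).
Proof.
apply: agree_sub (@sem_agree (any len e) m) => x; rewrite /= !inE.
by do ![case: (x == _) => //].
Qed.

Lemma has_same (p p' : nat -> bool) l :
  (forall i, i < l -> p i = p' i) -> has p (iota 0 l) = has p' (iota 0 l).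
Proof. by move=> h; apply: eq_in_has => i; rewrite mem_iota add0n => /h. Qed.

Definition vn : expr := 0~[#0].
Definition vk : expr := 0~[#1].
Definition inbag (b v : expr) : expr := 2~[Plus aoffn~[b] v].
Definition isarc (u v : expr) : expr := 1~[Plus aoffn~[u] v].

Definition prep : cmd :=
  CFor vv vn
    (any $vnb (And (Not ast~[$vb]) (inbag $vb $vv));;
     aalive@[$vv] <~ $vz;; aalive@[Plus vn $vv] <~ $vz;;
     any $vnb (And (And ast~[$vb] (Le ast~[$vb] $vm)) (inbag $vb $vv));;
     apass@[$vv] <~ Or (Not aalive~[$vv]) $vz;;
     any $vnb (And (Lt $vm ast~[$vb]) (inbag $vb $vv));;
     apass@[Plus vn $vv] <~ Or (Not aalive~[$vv]) $vz).

Definition terms : cmd :=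
  CFor vv $vn2
    (any vk (Or (And $vfS (Eq $vv 4~[$vb])) (And $vfT (Eq $vv (Plus vn 5~[$vb]))));;
     aterm@[$vv] <~ $vz).

Definition isarc2 (x y : expr) : expr :=
  Or (And (Lt x vn) (And (Lt y vn) (isarc x y)))
     (And (Le vn x) (And (Lt x $vn2) (And (Le vn y) (And (Lt y $vn2)
       (isarc (Minus y vn) (Minus x vn)))))).

(** The formula of [net], with [T] for the relation between vertices and targets, the
only part in which rounds and last linkage differ. *)
Definition netE (T : expr) : expr :=
  Or (And (Lt $vu $vn2) (Eq $vv (Plus $vn2 $vu)))
  (Or (And (Le $vn2 $vu) (And (Lt $vu $vn4) (And (Lt $vv $vn2)
        (And (Not (Eq $vv (Minus $vu $vn2))) (And apass~[Minus $vu $vn2]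
          (isarc2 (Minus $vu $vn2) $vv))))))
  (Or (And (Le $vn2 $vu) (And (Lt $vu $vn4) (And (Le $vn4 $vv) (And (Lt $vv $vsrc) T))))
  (Or (And (Le $vn4 $vu) (And (Lt $vu $vsrc) (Eq $vv $vsnk)))
      (And (Eq $vu $vsrc) (And (Lt $vv $vn2) aterm~[$vv]))))).

Section Programs.
Variables (n k c nb mm : nat) (A inc : nat -> nat -> bool) (s : bool -> nat -> nat).

(** What stays true from the initialization to the end: parameters and input, of
which only the first [nb] bags are used. *)
Record base (m : memory) : Prop := Base {
  base_n : m 0 0 = n;
  base_k : m 0 1 = k;
  base_nb : m vnb 0 = nb;
  base_mm : m vm 0 = mm;
  base_n2 : m vn2 0 = n + n;
  base_n4 : m vn4 0 = n + n + (n + n);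
  base_off : forall j, j < n + nb -> m aoffn j = j * n;
  base_A : forall u v, u < n -> v < n -> (m 1 (u * n + v) != 0) = A u v;
  base_inc : forall b v, b < nb -> v < n -> (m 2 (b * n + v) != 0) = inc b v;
  base_s : forall sig i, i < k -> m (if sig then 5 else 4) i = s sig i
}.

Lemma base_agree L m m' : agree L m m' ->
  all (fun x => x \notin L) [:: 0; 1; 2; 4; 5; aoffn; vnb; vm; vn2; vn4] ->
  base m -> base m'.
Proof.
move=> ag h [h1 h2 h3 h4 h5 h6 h7 h8 h9 h10].
have g a x : a \in [:: 0; 1; 2; 4; 5; aoffn; vnb; vm; vn2; vn4] -> m' a x = m a x.
  by move/(allP h) => ha; apply: ag.
split; try by rewrite g.
- by move=> j hj; rewrite g ?h7.
- by move=> u v hu hv; rewrite g ?h8.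
- by move=> b v hb hv; rewrite g ?h9.
- by move=> sig i hi; rewrite g ?h10 //; case: sig.
Qed.

Lemma truth_inbag m b v : base m -> eval m b < nb -> eval m v < n ->
  truth m (inbag b v) = inc (eval m b) (eval m v).
Proof.
by move=> B hb hv; rewrite /= (base_off B) ?(base_inc B) //; lia.
Qed.

Lemma truth_isarc m u v : base m -> eval m u < n -> eval m v < n ->
  truth m (isarc u v) = A (eval m u) (eval m v).
Proof.
by move=> B hu hv; rewrite /= (base_off B) ?(base_A B) //; lia.
Qed.

Lemma truth_isarc2 m x y : base m ->
  truth m (isarc2 x y) = arc2 n A (eval m x) (eval m y).
Proof.
move=> B; rewrite /isarc2 /arc2 truth_Or !truth_And !truth_Lt !truth_Le.
have en : eval m vn = n by rewrite /= (base_n B).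
have en2 : eval m $vn2 = n + n by rewrite /= (base_n2 B).
rewrite en en2; congr (_ || _).
  by do 2!(apply: andb_id2l => ?); rewrite truth_isarc.
do 4!(apply: andb_id2l => ?); rewrite truth_isarc //= (base_n B) //; lia.
Qed.

Lemma prep_spec m : base m ->
  let m' := sem prep m in
  forall x, x < n + n ->
    (m' aalive x != 0) = alive2 n nb inc (m ast) x /\
    (m' apass x != 0) = pass2 n nb inc mm (m ast) x.
Proof.
move=> B m'.
pose I j m1 := forall v, v < j -> v < n ->
  [/\ (m1 aalive v != 0) = alive_at nb inc (m ast) v,
      (m1 aalive (n + v) != 0) = alive_at nb inc (m ast) v,
      (m1 apass v != 0) = pass_at nb inc mm (m ast) false v &
      (m1 apass (n + v) != 0) = pass_at nb inc mm (m ast) true v].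
suff : I (eval m vn) m'.
  rewrite /= (base_n B) => H x hx; rewrite /alive2 /pass2.
  case: (ltnP x n) => hxn; first by have [] := H x hxn hxn.
  have h : x - n < n by lia.
  by have [_ h1 _ h2] := H _ h h; rewrite -h1 -h2 subnKC.
apply: sem_For_ind => // j m1; rewrite [eval m vn](base_n B) => hj ag ej H.
have B1 : base m1 by apply: base_agree ag _ B.
have est b : m1 ast b = m ast b by rewrite ag.
pose q1 b := (m ast b == 0) && inc b j.
pose q2 b := [&& m ast b != 0, (mm < m ast b) == false & inc b j].
pose q3 b := [&& m ast b != 0, (mm < m ast b) == true & inc b j].
rewrite sem_seq; set m2 := sem (any _ _) m1.
have ag2 : agree [:: vz; vb] m1 m2 by apply: any_agree.
have z2 : (m2 vz 0 != 0) = alive_at nb inc (m ast) j.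
  have := @any_spec $vnb _ m1 q1 isT; rewrite /m2 [eval _ $vnb](base_nb B1); apply=> b m3 hb ag3 eb.
  have B3 : base m3 by apply: base_agree ag3 _ B1.
  have ej3 : m3 vv 0 = j by rewrite ag3 // ej.
  by rewrite truth_And truth_Not truth_inbag //= ?eb ?ej3 // ag3 // est negbK.
do 5!rewrite sem_seq; rewrite !sem_write [eval m2 $vv]/= ag2 // ej [eval m2 $vz]/=.
set m3 := update m2 _ _ _.
have en3 : eval m3 (Plus vn $vv) = n + j.
  by rewrite /= /m3 !update_array // !ag2 // ej (base_n B1).
rewrite en3 [eval m3 $vz]/= {2}/m3 update_array //.
set m4 := update m3 _ _ _.
have ag4 : agree [:: aalive; vz; vb] m1 m4.
  apply: (@agree_trans _ _ m2); first by apply: agree_sub ag2; subset_literals.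
  by do 2!apply: agree_then_update => //.
have B4 : base m4 by apply: base_agree ag4 _ B1.
set m5 := sem (any _ _) m4.
have ag5 : agree [:: vz; vb] m4 m5 by apply: any_agree.
have z5 : (m5 vz 0 != 0) = dead_at nb inc mm (m ast) false j.
  have := @any_spec $vnb _ m4 q2 isT; rewrite /m5 [eval _ $vnb](base_nb B4); apply=> b m6 hb ag6 eb.
  have B6 : base m6 by apply: base_agree ag6 _ B4.
  have ej6 : m6 vv 0 = j by rewrite ag6 // ag4 // ej.
  rewrite !truth_And truth_Le truth_inbag //= ?eb ?ej6 // (base_mm B6) ag6 // ag4 // est.
  by rewrite /q2 -andbA leqNgt eqbF_neg.
have a5 x : m5 aalive x = m4 aalive x by rewrite ag5.
have al5 : (m5 aalive j != 0) = alive_at nb inc (m ast) j.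
  by rewrite a5 /m4 updateE; case: (j =P n + j) => _; rewrite /m3 ?update_same.
have ej5 : m5 vv 0 = j by rewrite ag5 // ag4.
have p5 : truth m5 (Or (Not aalive~[$vv]) $vz) = pass_at nb inc mm (m ast) false j.
  by rewrite truth_Or truth_Not /= ej5 al5 z5.
rewrite [eval m5 $vv]/= ej5; set m6 := update m5 apass _ _.
have ag6 : agree [:: apass; aalive; vz; vb] m1 m6.
  apply: (@agree_trans _ _ m4); first by apply: agree_sub ag4; subset_literals.
  apply: (@agree_trans _ _ m5).
    by apply: agree_sub ag5; subset_literals.
  by apply: agree_then_update.
have B6 : base m6 by apply: base_agree ag6 _ B1.
set m7 := sem (any _ _) m6.
have ag7 : agree [:: vz; vb] m6 m7 by apply: any_agree.
have z7 : (m7 vz 0 != 0) = dead_at nb inc mm (m ast) true j.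
  have := @any_spec $vnb _ m6 q3 isT; rewrite /m7 [eval _ $vnb](base_nb B6); apply=> b m8 hb ag8 eb.
  have B8 : base m8 by apply: base_agree ag8 _ B6.
  have ej8 : m8 vv 0 = j by rewrite ag8 // ag6 // ej.
  rewrite !truth_And truth_Lt truth_inbag //= ?eb ?ej8 // (base_mm B8) ag8 // ag6 // est.
  by rewrite /q3 eqb_id andbA; congr (_ && _); case: ltnP => h; [rewrite andbT; lia | rewrite andbF].
have ej7 : m7 vv 0 = j by rewrite ag7 // ag6.
have a7 x : m7 aalive x = m5 aalive x by rewrite ag7 // /m6 update_array.
have p7 : truth m7 (Or (Not aalive~[$vv]) $vz) = pass_at nb inc mm (m ast) true j.
  by rewrite truth_Or truth_Not /= ej7 a7 al5 z7.
have en7 : eval m7 (Plus vn $vv) = n + j by rewrite /= ej7 ag7 // (base_n B6).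
rewrite en7; set m8 := update m7 apass _ _.
have alive8 x : update m8 vv 0 j.+1 aalive x = m4 aalive x.
  by rewrite update_array // /m8 update_array // a7 a5.
have pass8 x : update m8 vv 0 j.+1 apass x =
   if x == n + j then eval m7 (Or (Not aalive~[$vv]) $vz)
   else if x == j then eval m5 (Or (Not aalive~[$vv]) $vz) else m1 apass x.
  rewrite update_array // /m8 updateE; case: eqP => // _.
  rewrite ag7 // /m6 updateE; case: eqP => // _.
  by rewrite ag5 // ag4.
have alive4 x : m4 aalive x = if (x == n + j) || (x == j) then m2 vz 0 else m1 aalive x.
  rewrite /m4 updateE; case: eqP => //= _; rewrite /m3 updateE; case: eqP => // _.
  by rewrite ag2.
move=> v; rewrite ltnS leq_eqVlt !alive8 !pass8 !alive4 => /predU1P[-> _|hv hv'].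
  have nj : j == n + j = false by lia.
  by rewrite nj !eqxx /= z2 p5 p7.
have -> : v == n + j = false by lia.
have -> : v == j = false by lia.
have -> : n + v == n + j = false by lia.
have -> : n + v == j = false by lia.
exact: H.
Qed.

Lemma terms_spec m : base m ->
  forall x, x < n + n ->
  (sem terms m aterm x != 0) =
  term_of n k s (fun sig => if sig then m vfT 0 != 0 else m vfS 0 != 0) x.
Proof.
move=> B; set f := fun sig : bool => _.
suff : forall x, x < eval m $vn2 -> (sem terms m aterm x != 0) = term_of n k s f x.
  by rewrite /= (base_n2 B).
apply: (@sem_For_ind vv $vn2 _ m (fun j m1 => forall x, x < j -> (m1 aterm x != 0) = term_of n k s f x)) => //.
move=> j m1 hj ag ej H x.
have B1 : base m1 by apply: base_agree ag _ B.
rewrite sem_seq; set m2 := sem (any _ _) m1.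
have ag2 : agree [:: vz; vb] m1 m2 by apply: any_agree.
have z2 : (m2 vz 0 != 0) = term_of n k s f j.
  have := @any_spec vk _ m1 (fun i => f false && (j == s false i) || f true && (j == n + s true i)) isT.
  rewrite /m2 [eval _ vk](base_k B1); apply=> i m3 hi ag3 ei; have B3 : base m3 by apply: base_agree ag3 _ B1.
  rewrite truth_Or !truth_And !truth_Eq /= ei (base_s B3 false hi) (base_s B3 true hi).
  have -> : m3 vv 0 = j by rewrite ag3.
  have -> : m3 vfS 0 = m vfS 0 by rewrite ag3 ?ag.
  have -> : m3 vfT 0 = m vfT 0 by rewrite ag3 ?ag.
  by rewrite (base_n B3).
rewrite ltnS leq_eqVlt sem_write /= ag2 // ej => hx.
rewrite update_array // updateE; case: (x =P j) hx => [-> _|_ /= hx]; first exact: z2.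
by rewrite ag2 //; apply: H.
Qed.

Lemma truth_netE m T q tgt u v : base m ->
  m vu 0 = u -> m vv 0 = v -> m vsrc 0 = src (n + n) q -> m vsnk 0 = snk (n + n) q ->
  forall (pass term : nat -> bool),
  (forall x, x < n + n -> (m apass x != 0) = pass x) ->
  (forall x, x < n + n -> (m aterm x != 0) = term x) ->
  (n + n <= u < n + n + (n + n) -> n + n + (n + n) <= v < src (n + n) q ->
     truth m T = tgt (u - (n + n)) (v - (n + n + (n + n)))) ->
  truth m (netE T) = net (n + n) q pass (arc2 n A) tgt term u v.
Proof.
move=> B eu ev es et pass term hp ht hT.
rewrite /netE !truth_Or !truth_And (truth_Not _ (Eq _ _)) !truth_Eq !truth_Lt !truth_Le truth_isarc2 //=.
rewrite eu ev es et (base_n2 B) (base_n4 B) /net.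
congr [|| _, _, _, _ | _].
- do 3!(apply: andb_id2l => ?); congr (_ && _); rewrite hp //; lia.
- do 4!(apply: andb_id2l => ?); apply: hT; lia.
- by do 2!(apply: andb_id2l => ?); rewrite ht.
Qed.

End Programs.

(** * The rounds and the last linkage *)
Definition round_target : expr :=
  And (Eq (Minus $vu $vn2) (Minus $vv $vn4)) aalive~[Minus $vu $vn2].

Definition choose_bag : cmd :=
  vpick <~ #0;;
  CFor vb $vnb (CIf (And (Not ast~[$vb]) (inbag $vb $vv)) (vpick <~ Plus $vb #1) CSkip);;
  CIf $vpick (ast@[Minus $vpick #1] <~ Plus $vr #1) CSkip.

(** Flow that ends in the target of [v] has reversed its edge to the sink, so an
absent entry of [ares] means that a path ends at [v]. *)
Definition choose_bags : cmd :=
  CFor vv vn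
    (CIf $vfS (vx <~ $vv) (vx <~ Plus vn $vv);;
     CIf (And aalive~[$vv] (Not ares~[Plus aoff~[Plus $vn4 $vx] $vsnk]))
       choose_bag CSkip).

Definition round : cmd :=
  vfS <~ Lt $vr $vm;; vfT <~ Not $vfS;;
  prep;; terms;; flow (netE round_target);; choose_bags.

Definition final_target : expr :=
  And (Not ast~[Minus $vv $vn4])
      (Or (And (Lt (Minus $vu $vn2) vn) (inbag (Minus $vv $vn4) (Minus $vu $vn2)))
          (And (Le vn (Minus $vu $vn2))
               (inbag (Minus $vv $vn4) (Minus (Minus $vu $vn2) vn)))).

Definition final_flow : cmd :=
  vfS <~ #1;; vfT <~ #1;; prep;; terms;; flow (netE final_target).

Section Rounds.
Variables (n k c nb mm : nat) (A inc : nat -> nat -> bool) (s : bool -> nat -> nat).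
Hypothesis inst : instance n k A s.
Hypothesis Bs : bags n c nb A inc.
Local Notation base := (base n k nb mm A inc s).
Local Notation alive_at := (alive_at nb inc).
Local Notation pass_at := (pass_at nb inc mm).

Definition stamped (r : nat) (st st' : nat -> nat) : Prop :=
  forall b, b < nb -> st' b = st b \/ st b = 0 /\ st' b = r.+1.

(** A vertex [v] in an available bag may lose all such bags within the same round, to
vertices treated before; then nothing is chosen, and one of them has the stamp. *)
Lemma choose_bag_spec r m v : base m -> m vv 0 = v -> v < n -> m vr 0 = r ->
  let st := m ast in let st' := sem choose_bag m ast in
  (forall b, b < nb -> st b = 0 -> ~~ inc b v) /\ (forall b, st' b = st b) \/
  exists b, [/\ b < nb, st b = 0, inc b v & forall b', st' b' = if b' == b then r.+1 else st b'].
Proof.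
move=> B ev hv er st st'.
rewrite /st' /choose_bag !sem_seq; set m1 := sem (vpick <~ #0) m.
have ag1 : agree [:: vpick] m m1 by apply: (@sem_agree (vpick <~ #0)).
set m2 := sem (CFor _ _ _) m1.
have ag2 : agree [:: vb; vpick] m1 m2.
  by apply: (@sem_agree (CFor vb $vnb (CIf (And (Not ast~[$vb]) (inbag $vb $vv)) (vpick <~ Plus $vb #1) CSkip))).
have [[e2 none]|[b [e2 hb sb bv]]] :
    (m2 vpick 0 = 0 /\ forall b, b < nb -> st b = 0 -> ~~ inc b v) \/
    (exists b, [/\ m2 vpick 0 = b.+1, b < nb, st b = 0 & inc b v]).
  pose I j m' := (m' vpick 0 = 0 /\ forall b, b < j -> st b = 0 -> ~~ inc b v) \/
    (exists b, [/\ m' vpick 0 = b.+1, b < j, st b = 0 & inc b v]).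
  have enb : eval m1 $vnb = nb by rewrite /= ag1 // (base_nb B).
  suff : I (eval m1 $vnb) m2 by rewrite enb.
  apply: sem_For_ind => //; first by left.
  move=> j m3; rewrite enb => hj ag3 ej H.
  have ag : agree [:: vb; vpick] m m3.
    by apply: agree_trans (agree_sub _ ag1) ag3; subset_literals.
  have B3 : base m3 by apply: base_agree ag _ B.
  have ev3 : m3 vv 0 = v by rewrite ag.
  rewrite sem_if truth_And truth_Not (truth_inbag B3) /= ?ej ?ev3 // ag // -/(st j).
  case: ifPn => [/andP[/negPn/eqP sj jv]|no].
    by right; exists j; rewrite update_array // sem_write /= update_same ej addn1.
  case: H => [[e none]|[b [e hb sb bv]]]; [left|right]; rewrite /=.
    split=> // b; rewrite ltnS leq_eqVlt => /predU1P[->|hb]; last exact: none.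
    by move=> sj; move: no; rewrite sj eqxx.
  by exists b; split=> //; lia.
- left; split=> // b; transitivity (m2 ast b); first by rewrite sem_if /= e2.
  by rewrite ag2 // ag1.
right; exists b; split=> // b'.
rewrite sem_if /= e2 /= sem_write /= e2 subn1 /= updateE addn1 ag2 // ag1 // er.
by case: eqP => // _; rewrite ag2 // ag1.
Qed.

(** The invariant of the rounds; number [g] is a round for the side [mm <= g]. *)
Definition progress (r : nat) (st : nat -> nat) : Prop :=
  [/\ forall b, b < nb -> st b <= r,
      cnt (fun b => st b != 0) nb <= r * k &
      forall g, g < r -> robust n k nb A inc s mm st (mm <= g) g.+1].

Section Stamp.
Variables (r : nat) (st st' : nat -> nat).
Hypothesis stp : stamped r st st'.

Lemma stamped_alive v : alive_at st' v -> alive_at st v.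
Proof.
case/has_iotaP=> b hb /andP[/eqP sb bv]; apply/has_iotaP; exists b => //.
by case: (stp hb) => [<-|[_ e]]; [rewrite sb | rewrite e in sb].
Qed.

Lemma stamped_pass sig v : pass_at st sig v -> pass_at st' sig v.
Proof.
case/orP=> [h|/has_iotaP[b hb /and3P[sb eb bv]]]; apply/orP; [left|right].
  by apply: contra h; apply: stamped_alive.
apply/has_iotaP; exists b => //.
by case: (stp hb) => [->|[e _]]; [rewrite sb eb | rewrite e in sb].
Qed.

(** Setting aside further bags only enlarges the set of passable vertices. *)
Lemma stamped_robust sig g : g < r ->
  robust n k nb A inc s mm st sig g.+1 -> robust n k nb A inc s mm st' sig g.+1.
Proof.
move=> hg rb Y W small start closed.
have [|b [v [hb hv sb bv Wv]]] := rb Y W small start.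
  by move=> u v hu hv Wu pu; apply: closed => //; apply: stamped_pass.
exists b, v; split=> //; case: (stp hb) => [->//|[e _]].
by rewrite e in sb.
Qed.
End Stamp.

Lemma choose_bags_spec r m sig (fl : nat -> bool) : base m -> m vr 0 = r ->
  (m vfS 0 != 0) = ~~ sig ->
  (forall v, v < n -> (m aalive v != 0) = alive_at (m ast) v) ->
  (forall v, v < n ->
     (m ares (m aoff (n + n + (n + n) + copy n sig v) + m vsnk 0) == 0) = fl v) ->
  let st := m ast in let st' := sem choose_bags m ast in
  [/\ stamped r st st', cnt (fun b => st' b != st b) nb <= cnt fl n &
      forall v, v < n -> alive_at st v -> fl v ->
        exists b, [/\ b < nb, st' b = r.+1 & inc b v]].
Proof.
move=> B er es hal hfl st.
pose I j (m1 : memory) := [/\ stamped r st (m1 ast),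
  cnt (fun b => m1 ast b != st b) nb <= cnt fl j &
  forall v, v < j -> alive_at st v -> fl v ->
        exists b, [/\ b < nb, m1 ast b = r.+1 & inc b v]].
suff : I (eval m vn) (sem choose_bags m) by rewrite [eval m vn](base_n B).
apply: sem_For_ind => //.
  split=> //; first by move=> b _; left.
  by rewrite [cnt _ nb]big1 // => b _; rewrite update_array // eqxx.
move=> j m1; rewrite [eval m vn](base_n B) => hj ag ej [stp few old].
have B1 : base m1 by apply: base_agree ag _ B.
rewrite /I; have -> : forall m', update m' vv 0 j.+1 ast = m' ast by [].
rewrite sem_seq; set m2 := sem (CIf $vfS _ _) m1.
have ag2 : agree [:: vx] m1 m2.
  apply: agree_sub (@sem_agree (CIf $vfS (vx <~ $vv) (vx <~ Plus vn $vv)) m1).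
  by subset_literals.
have x2 : m2 vx 0 = copy n sig j.
  rewrite /m2 sem_if /= ag // es /copy; case: (sig); rewrite /= sem_write update_same //= ej //.
  by rewrite (base_n B1).
have B2 : base m2 by apply: base_agree ag2 _ B1.
have st2 : m2 ast = m1 ast.
  by rewrite /m2 sem_if; case: ifP.
have e2v : m2 vv 0 = j by rewrite ag2.
have same2 a x : a \in [:: aalive; aoff; vsnk; ares] -> m2 a x = m a x.
  by rewrite !inE => /or4P[]/eqP->; rewrite ag2 ?ag.
rewrite sem_if truth_And truth_Not /= x2 (base_n4 B2) e2v !same2 //.
rewrite hal // negbK hfl //.
case: ifPn => [/andP[aj fj]|no]; last first.
  split; rewrite ?sem_skip ?st2 //; first by rewrite cntS (leq_trans few) ?leq_addr.
  move=> v; rewrite ltnS leq_eqVlt => /predU1P[->|hv]; last exact: old.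
  by move=> a1 f1; move: no; rewrite a1 f1.
have e2r : m2 vr 0 = r by rewrite ag2 // ag.
have [[none same]|[b [hb sb bj chg]]] := choose_bag_spec B2 e2v hj e2r.
  rewrite st2 in none same; split.
  - by move=> b hb; rewrite same; apply: stp.
  - rewrite cntS; apply: leq_trans (leq_trans few (leq_addr _ _)).
    by apply: leq_cnt => b hb; rewrite same.
  move=> v; rewrite ltnS leq_eqVlt => /predU1P[->|hv] a1 f1; last first.
    by have [b [hb sb bv]] := old v hv a1 f1; exists b; rewrite same.
  case/has_iotaP: a1 => b hb /andP[/eqP sb bv]; exists b; rewrite same; split=> //.
  case: (stp b hb) => [e|[_ ->] //].
  by case/negP: (none b hb (etrans e sb)).
rewrite st2 in sb chg; split.
- move=> b' hb'; rewrite chg; case: eqP => [->|_]; last exact: stp.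
  right; split=> //; case: (stp b hb) => [<-|[] //]; exact: sb.
- apply: (@leq_trans (cnt (fun b' => (m1 ast b' != st b') || (b' == b)) nb)).
    by apply: leq_cnt => b' hb'; rewrite chg; case: (b' =P b) => [_ _|_ ->]; rewrite ?orbT.
  apply: leq_trans (cnt_or _ _ _) _; rewrite cntS fj leq_add //.
  have -> : true = cnt predT 1 :> nat by rewrite (cnt_const true).
  by apply: (@leq_cnt_inj _ _ (fun b' _ => b' = b)) => [b' _ /eqP->|b1 b2 ? _ _ _ _ _ _ -> ->]; first by exists 0.
- move=> v; rewrite ltnS leq_eqVlt => /predU1P[->|hv] a1 f1.
    by exists b; rewrite chg eqxx.
  have [b' [hb' sb' bv]] := old v hv a1 f1; exists b'; rewrite chg; split=> //.
  by case: eqP.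
Qed.

Hypothesis mm_def : mm = c * (k - 1) + 1.
Hypothesis nb_large : 2 * k * (mm + 1) + c * (k - 1) <= nb.

(** The number of bags is chosen such that [2 k + c (k - 1)] of them survive all
rounds. *)
Lemma progress_alive r st : progress r st -> r <= mm + mm ->
  nb <= n_alive nb st + 2 * k * mm.
Proof.
case=> _ dead _ hr; have := cntC (fun b => st b == 0) nb; rewrite -/(n_alive nb st) => e.
have : r * k <= 2 * k * mm by rewrite mulnAC leq_mul // mul2n -addnn.
move=> h; apply: (@leq_trans (n_alive nb st + r * k)); last by rewrite leq_add2l.
by apply: leq_trans (eq_leq (esym e)) _; rewrite leq_add2l.
Qed.

Lemma prepare_spec m f : base m ->
  (m vfS 0 != 0) = f false -> (m vfT 0 != 0) = f true ->
  let m' := sem terms (sem prep m) in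
  [/\ base m', forall b, m' ast b = m ast b,
      forall x, x < n + n -> (m' aalive x != 0) = alive2 n nb inc (m ast) x,
      forall x, x < n + n -> (m' apass x != 0) = pass2 n nb inc mm (m ast) x &
      forall x, x < n + n -> (m' aterm x != 0) = term_of n k s f x].
Proof.
move=> B eS eT m'; set m1 := sem prep m.
have ag1 : agree (writes prep) m m1 by apply: sem_agree.
have ag2 : agree (writes terms) m1 m' by apply: sem_agree.
have B1 : base m1 by apply: base_agree ag1 _ B.
split.
- by apply: base_agree ag2 _ B1.
- by move=> b; rewrite ag2 // ag1.
- by move=> x hx; rewrite ag2 //; case: (prep_spec B hx).
- by move=> x hx; rewrite ag2 //; case: (prep_spec B hx).
move=> x hx; rewrite (terms_spec B1 hx); apply: has_same => i _.
by rewrite !ag1 // eS eT.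
Qed.

Lemma round_spec r m : base m -> r < mm + mm -> m vr 0 = r ->
  m vM 0 = nnodes (n + n) (n + n) -> m vsrc 0 = src (n + n) (n + n) ->
  m vsnk 0 = snk (n + n) (n + n) -> m vK 0 = k ->
  progress r (m ast) -> progress r.+1 (sem round m ast).
Proof.
move=> B hr er eM es et eK pr.
set sig := mm <= r.
rewrite /round 5!sem_seq; set m1 := sem (vfT <~ Not $vfS) _.
have ag1 : agree [:: vfS; vfT] m m1.
  by apply: agree_then_update => //; apply: agree_update.
have B1 : base m1 by apply: base_agree ag1 _ B.
have fS : (m1 vfS 0 != 0) = (false == sig).
  rewrite /m1 !sem_write update_array // update_same truth_Lt /= er (base_mm B) /sig.
  by case: ltnP.
have fT : (m1 vfT 0 != 0) = (true == sig).
  rewrite /m1 !sem_write update_same truth_Not.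
  by move: fS; rewrite /m1 sem_write update_array // /= => ->; case: (sig).
have := @prepare_spec m1 (fun b => b == sig) B1 fS fT.
set m2 := sem terms (sem prep m1); case=> B2 st2 al2 pa2 te2.
have ag2 : agree (writes prep ++ writes terms) m1 m2.
  by apply: (@sem_agree (prep;; terms)).
have same a x : a \in [:: vM; vsrc; vsnk; vK; vr] -> m2 a x = m a x.
  by move=> ha; rewrite ag2 ?ag1 //; move: ha; rewrite !inE => /or4P[||| /orP[]]/eqP->.
have {}st2 b : m2 ast b = m ast b by rewrite st2 ag1.
pose st := m ast.
pose r0 := net (n + n) (n + n) (pass2 n nb inc mm st) (arc2 n A)
               (round_tgt n nb inc st) (term_of n k s (fun b => b == sig)).
have lk : linkable (n + n) (n + n) (pass2 n nb inc mm st) (arc2 n A)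
               (round_tgt n nb inc st) (term_of n k s (fun b => b == sig)) k.
  apply: (round_linkable inst Bs); have h : nb <= n_alive nb st + 2 * k * mm := progress_alive pr (ltnW hr).
  have e : 2 * k * (mm + 1) = 2 * k * mm + 2 * k by rewrite mulnDr muln1.
  have := k_gt0 inst; move: h nb_large; rewrite e.
  by move: (2 * k * mm) (c * (k - 1)) (n_alive nb st) => X Y Z; lia.
have [||||||fl nt su] := @flow_spec (nnodes (n + n) (n + n)) (src (n + n) (n + n))
    (snk (n + n) (n + n)) r0 (src_lt _ _) (snk_lt _ _) (src_snk _ _)
    (fun u v _ _ => @net_simple _ _ _ _ _ _ u v) k (netE round_target) m2.
- move=> m' u v ag eu ev hu hv.
  have B' : base m' by apply: base_agree ag _ B2.
  apply: (truth_netE B') => //.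
  + by rewrite ag // same.
  + by rewrite ag // same.
  + by move=> x hx; rewrite ag // pa2.
  + by move=> x hx; rewrite ag // te2.
  move=> hu' hv'; rewrite /round_target truth_And truth_Eq /= eu ev (base_n2 B') (base_n4 B').
  by rewrite /round_tgt ag // al2 //; lia.
- by rewrite same.
- by rewrite same.
- by rewrite same.
- by rewrite same.
- by move=> Z Zs Zt; apply: net_cut.
set m3 := sem (flow _) m2 in fl nt su *.
have ag3 : agree (writes (flow (netE round_target))) m2 m3 by apply: sem_agree.
have B3 : base m3 by apply: base_agree ag3 _ B2.
pose f v := ~~ mat ares (nnodes (n + n) (n + n)) m3 (tg (n + n) (copy n sig v)) (snk (n + n) (n + n)).
have st3 b : m3 ast b = st b by rewrite ag3 // st2.
have [||||stp few found] := @choose_bags_spec r m3 sig f B3.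
- by rewrite ag3 // same.
- by rewrite ag3 // ag2 // fS; case: (sig).
- move=> v hv; rewrite ag3 // al2; last by lia.
  rewrite /alive2 hv; apply: has_same => b _; by rewrite st3 ag1.
- move=> v hv; rewrite /f /mat negbK.
  have -> : m3 vsnk 0 = snk (n + n) (n + n) by rewrite ag3 // same.
  case: su => _ _ _ ->; first by [].
  by have := copy_lt sig hv; rewrite /nnodes /src; lia.
have {}stp : stamped r st (sem choose_bags m3 ast).
  by move=> b hb; rewrite -st3; apply: stp.
have {}found v : v < n -> alive_at st v -> f v ->
    exists b, [/\ b < nb, sem choose_bags m3 ast b = r.+1 & inc b v].
  move=> hv av; apply: found => //; move: av.
  by congr is_true; apply: has_same => b _; rewrite st3.
have few_f : cnt f n <= k.
  have := used_into_target fl; rewrite -/(cnt (fun j => carries r0 _ (tg (n + n) j) _) _) => e.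
  rewrite -[leqRHS]e; apply: leq_trans (cnt_copy _ sig _); apply: leq_cnt => v hv fv.
  by apply/andP; split; [apply/netP; apply: NetSink; apply: copy_lt | exact: fv].
have [le dead rob] := pr; split.
- by move=> b hb; case: (stp b hb) => [->|[_ ->]] //; apply: leqW; apply: le.
- rewrite mulSn addnC; apply: (@leq_trans (cnt (fun b => (st b != 0) ||
      (sem choose_bags m3 ast b != m3 ast b)) nb)).
    by apply: leq_cnt => b hb; rewrite st3; case: (st b =P 0) => //= ->.
  apply: leq_trans (cnt_or _ _ _) (leq_add dead (leq_trans few few_f)).
- move=> g; rewrite ltnS leq_eqVlt => /predU1P[->|hg]; last first.
    by apply: (stamped_robust stp hg); apply: rob.
  apply: (round_robust inst fl) => //.
  by move=> v hv; apply: (stamped_pass stp).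
Qed.

Lemma final_spec m : base m -> m vM 0 = nnodes (n + n) nb ->
  m vsrc 0 = src (n + n) nb -> m vsnk 0 = snk (n + n) nb -> m vK 0 = k + k ->
  progress (mm + mm) (m ast) ->
  let M := nnodes (n + n) nb in
  let r0 := net (n + n) nb (pass2 n nb inc mm (m ast)) (arc2 n A)
               (final_tgt n inc (m ast)) (term_of n k s (fun _ => true)) in
  let m' := sem final_flow m in
  [/\ is_flow M (src (n + n) nb) (snk (n + n) nb) r0 (mat ares M m') (k + k),
      forall u v, u < M -> v < M -> mat anet M m' u v = r0 u v,
      set_up M (src (n + n) nb) (snk (n + n) nb) m' & base m'].
Proof.
move=> B eM es et eK pr M r0.
rewrite /final_flow 4!sem_seq; set m1 := sem (vfT <~ #1) _.
have ag1 : agree [:: vfS; vfT] m m1.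
  by apply: agree_then_update => //; apply: agree_update.
have B1 : base m1 by apply: base_agree ag1 _ B.
have := @prepare_spec m1 (fun => true) B1 isT isT.
set m2 := sem terms (sem prep m1); case=> B2 st2 al2 pa2 te2.
have ag2 : agree (writes prep ++ writes terms) m1 m2.
  by apply: (@sem_agree (prep;; terms)).
have same a x : a \in [:: vM; vsrc; vsnk; vK] -> m2 a x = m a x.
  by move=> ha; rewrite ag2 ?ag1 //; move: ha; rewrite !inE => /or4P[]/eqP->.
have {}st2 b : m2 ast b = m ast b by rewrite st2 ag1.
pose st := m ast.
have lk : linkable (n + n) nb (pass2 n nb inc mm st) (arc2 n A)
               (final_tgt n inc st) (term_of n k s (fun _ => true)) (k + k).
  apply: (final_linkable inst Bs mm_def).
    have h : nb <= n_alive nb st + 2 * k * mm := progress_alive pr (leqnn _).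
    have e : 2 * k * (mm + 1) = 2 * k * mm + 2 * k by rewrite mulnDr muln1.
    move: h nb_large; rewrite e.
    by move: (2 * k * mm) (c * (k - 1)) (n_alive nb st) => X Y Z; lia.
  case: pr => _ _ rob sig g hg; have := rob ((if sig then mm else 0) + g).
  rewrite addnS; have -> : mm <= (if sig then mm else 0) + g = sig by case: (sig); lia.
  by apply; case: (sig); lia.
have [||||||fl nt su] := @flow_spec M (src (n + n) nb) (snk (n + n) nb) r0
    (src_lt _ _) (snk_lt _ _) (src_snk _ _)
    (fun u v _ _ => @net_simple _ _ _ _ _ _ u v) (k + k) (netE final_target) m2.
- move=> m' u v ag eu ev hu hv.
  have B' : base m' by apply: base_agree ag _ B2.
  apply: (truth_netE B') => //.
  + by rewrite ag // same.
  + by rewrite ag // same.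
  + by move=> x hx; rewrite ag // pa2.
  + by move=> x hx; rewrite ag // te2.
  move=> hu' hv'.
  have eb : eval m' (Minus $vv $vn4) = v - (n + n + (n + n)) by rewrite /= ev (base_n4 B').
  have ex : eval m' (Minus $vu $vn2) = u - (n + n) by rewrite /= eu (base_n2 B').
  have en : eval m' vn = n by rewrite /= (base_n B').
  have hb : v - (n + n + (n + n)) < nb by move: hv'; rewrite /src; lia.
  rewrite /final_target truth_And (truth_Not _ (ast~[_])) truth_Or !truth_And truth_Lt truth_Le.
  rewrite ex en /final_tgt; congr (_ && _).
    by rewrite [eval _ ast~[_]]/= ev (base_n4 B') ag // st2 negbK.
  case: ltnP => hx; rewrite ?andTb ?andFb ?orbF ?orFb.
    by rewrite (truth_inbag B') ?eb ?ex.
  have ex' : eval m' (Minus (Minus $vu $vn2) vn) = u - (n + n) - n.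
    by rewrite /= eu (base_n2 B') (base_n B').
  by rewrite (truth_inbag B') ?eb ?ex' //; lia.
- by rewrite same.
- by rewrite same.
- by rewrite same.
- by rewrite same.
- by move=> Z Zs Zt; apply: net_cut.
split=> //.
by apply: base_agree (@sem_agree (flow (netE final_target)) m2) _ B2.
Qed.

End Rounds.

(** * Extraction of the paths *)
(** An additional edge from [x] to [t] makes one search from [x] find what can be
reached from either. *)
Lemma reach_extra M (e : nat -> nat -> bool) x t y : t < M ->
  reach M (fun u v => e u v || (u == x) && (v == t)) x y <-> reach M e x y \/ reach M e t y.
Proof.
move=> ht; split=> [|[]].
- elim=> [|u v _ IH hv /orP[uv|/andP[_ /eqP->]]]; first by left; apply: reach_refl.
    by case: IH => r; [left|right]; apply: reach_step r hv uv.
  by right; apply: reach_refl.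
- elim=> [|u v _ IH hv uv]; first exact: reach_refl.
  by apply: reach_step IH hv _; rewrite uv.
elim=> [|u v _ IH hv uv]; last by apply: reach_step IH hv _; rewrite uv.
by apply: reach_step (reach_refl _ _ _) ht _; rewrite !eqxx orbT.
Qed.

Definition mark_territory : cmd :=
  vstart <~ 4~[$vi];; vtgt <~ Plus vn 5~[$vi];;
  search (Or (And anet~[cell] (Not ares~[cell]))
             (And (Eq $vu $vstart) (Eq $vv $vtgt)));;
  CFor vv vn (any $vnb (And avis~[Plus $vn4 $vb] (inbag $vb $vv));;
              amark@[$vv] <~ Or (Or avis~[$vv] avis~[Plus vn $vv]) $vz).

(** For [c >= k] the paths are unrestricted. *)
Definition mark_all : cmd := CFor vv vn (amark@[$vv] <~ #1).

(** The length of the path is not known in advance; once [vdone] is set, the rest of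
the iterations are idle. *)
Definition write_path : cmd :=
  CFor vj $vM (CIf (Not $vdone)
    (7@[Plus aoffn~[$vi] $vcount] <~ $vy;; vcount <~ Plus $vcount #1;;
     CIf (Eq $vy $vstart) (vdone <~ #1) (vy <~ apar~[$vy])) CSkip).

(** The search runs backwards from the sink, so that following the parents from the
source lists the path in the order of the output. *)
Definition find_path : cmd :=
  vstart <~ 5~[$vi];;
  search (And (And (Lt $vu vn) (Lt $vv vn))
              (And (And amark~[$vu] amark~[$vv]) (isarc $vv $vu)));;
  vy <~ 4~[$vi];; vdone <~ #0;; vcount <~ #0;;
  write_path;; 6@[$vi] <~ $vcount.

Definition solve_paths : cmd :=
  CFor vi vk (CIf (Minus vk 0~[#2]) mark_territory mark_all;; find_path).

Lemma searched_path M e t m y : searched M e t m -> y < M -> m avis y != 0 ->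
  exists q, [/\ path (fun a b => [&& a != t, b == m apar a & e b a]) y q,
    last y q = t, uniq (y :: q) & all (fun v => (v < M) && (m avis v != 0)) (y :: q)].
Proof.
move=> [rank [_ _ _ par]].
suff H d : forall y, rank y < d -> y < M -> m avis y != 0 ->
  exists q, [/\ path (fun a b => [&& a != t, b == m apar a & e b a]) y q,
    last y q = t, uniq (y :: q) &
    all (fun v => [&& v < M, m avis v != 0 & rank v <= rank y]) (y :: q)].
  move=> hy vy; have [q [h1 h2 h3 h4]] := H _ y (ltnSn _) hy vy.
  by exists q; split=> //; apply: sub_all h4 => v /and3P[-> ->].
elim: d => [//|d IH] {}y hd hy vy.
case: (altP (y =P t)) => [e'|yt].
  by exists [::]; split=> //=; rewrite hy vy leqnn.
have [h1 h2 h3 h4] := par y hy vy (elimN eqP yt).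
have [q [p1 p2 p3 p4]] := IH (m apar y) (leq_trans h4 hd) h1 h2.
exists (m apar y :: q); split=> //=.
- by rewrite yt eqxx h3.
- rewrite cons_uniq in p3; rewrite p3 andbT; apply: contraTN h4 => yq.
  by have := allP p4 y yq => /and3P[_ _]; rewrite -leqNgt.
- rewrite hy vy leqnn /=; apply/andP; split; first by rewrite h1 h2 ltnW.
  move: p4 => /= /andP[_]; apply: sub_all => v /and3P[-> -> h] /=.
  exact: leq_trans h (ltnW h4).
Qed.

Section Paths.
Variables (n k c nb mm : nat) (A inc : nat -> nat -> bool) (s : bool -> nat -> nat).
Hypothesis inst : instance n k A s.
Local Notation base := (base n k nb mm A inc s).

Section Territory.
Variables (m0 : memory) (st : nat -> nat).
Local Notation M := (nnodes (n + n) nb).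
Local Notation r := (mat ares M m0).
Local Notation r0 := (net (n + n) nb (pass2 n nb inc mm st) (arc2 n A)
               (final_tgt n inc st) (term_of n k s (fun _ => true))).
Hypothesis nt : forall u v, u < M -> v < M -> mat anet M m0 u v = r0 u v.
Hypothesis off : forall j, j < M -> m0 aoff j = j * M.
Hypothesis eM : m0 vM 0 = M.
Local Notation terr := (territory n k nb A inc s mm st r).

Lemma mark_territory_spec i m : agree (writes solve_paths) m0 m ->
  base m -> m vi 0 = i -> i < k ->
  forall v, v < n -> (sem mark_territory m amark v != 0) <-> terr i v.
Proof.
move=> ag B ei hi.
have hs sig := copy_lt sig (s_lt inst sig hi).
have toM x : x < n + n -> x < M by rewrite /nnodes /src; lia.
rewrite /mark_territory 3!sem_seq; set m1 := sem (vtgt <~ _) _.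
have ag1 : agree [:: vstart; vtgt] m m1.
  by apply: agree_then_update => //; apply: agree_update.
have B1 : base m1 by apply: base_agree ag1 _ B.
have es : m1 vstart 0 = copy n false (s false i).
  by rewrite /m1 !sem_write update_array // update_same /= ei (base_s B false).
have et : m1 vtgt 0 = copy n true (s true i).
  rewrite /m1 sem_write update_same /= !sem_write !update_array //= ei.
  by rewrite (base_s B true) // (base_n B).
pose used := carries r0 r.
pose e u v := used u v || (u == copy n false (s false i)) && (v == copy n true (s true i)).
set E := (X in search X); set m2 := sem (search E) m1.
have ag2 : agree (writes (search E)) m1 m2 by apply: sem_agree.
have B2 : base m2 by apply: base_agree ag2 _ B1.
have se : searched M e (copy n false (s false i)) m2.
  apply: search_spec => //; last by apply: toM; apply: (hs false).
    move=> m3 u v ag3 eu ev hu hv.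
    have g a x : a \in [:: ares; anet; aoff] -> m3 a x = m0 a x.
      by rewrite !inE => /or3P[]/eqP->; rewrite ag3 // ag1 // ag.
    rewrite /E truth_Or !truth_And truth_Not !truth_Eq /= eu ev !(g aoff) //.
    rewrite (off hu) (g ares) // (g anet) //.
    rewrite !ag3 // es et /e /used /carries -(nt hu hv); congr (_ || _).
  by rewrite ag1 // ag // eM.
have vis y : y < M -> (m2 avis y != 0) <->
    exists sig, freach n k nb A inc s mm st r (copy n sig (s sig i)) y.
  move=> hy; have h := searched_reach se (toM _ (hs false)) hy.
  have h' := @reach_extra M used (copy n false (s false i)) _ y (toM _ (hs true)).
  split=> [/h/h'|[[] ry]]; last 2 first.
  - by apply/h/h'; right.
  - by apply/h/h'; left.
  by case=> ry; [exists false | exists true].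
pose p v b := (m2 avis (tg (n + n) b) != 0) && inc b v.
have marks v : v < n -> (sem (CFor vv vn (any $vnb (And avis~[Plus $vn4 $vb] (inbag $vb $vv));;
              amark@[$vv] <~ Or (Or avis~[$vv] avis~[Plus vn $vv]) $vz)) m2 amark v != 0) =
      [|| m2 avis v != 0, m2 avis (n + v) != 0 | has (p v) (iota 0 nb)].
  move: v; set body := (X in CFor _ _ X).
  suff : forall v, v < eval m2 vn -> (sem (CFor vv vn body) m2 amark v != 0) =
      [|| m2 avis v != 0, m2 avis (n + v) != 0 | has (p v) (iota 0 nb)].
    by rewrite [eval _ vn](base_n B2).
  apply: (@sem_For_ind vv vn body m2 (fun j m3 => forall v, v < j -> (m3 amark v != 0) =
      [|| m2 avis v != 0, m2 avis (n + v) != 0 | has (p v) (iota 0 nb)])) => //.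
  move=> j m3; rewrite [eval _ vn](base_n B2) => hj ag3 ej H.
  have B3 : base m3 by apply: base_agree ag3 _ B2.
  rewrite /body sem_seq; set m4 := sem (any _ _) m3.
  have ag4 : agree [:: vz; vb] m3 m4 by apply: any_agree.
  have z4 : (m4 vz 0 != 0) = has (p j) (iota 0 nb).
    have := @any_spec $vnb _ m3 (p j) isT; rewrite /m4 [eval _ $vnb](base_nb B3).
    apply=> b m5 hb ag5 eb; have B5 : base m5 by apply: base_agree ag5 _ B3.
    have evb : eval m5 $vb = b by [].
    have evv : eval m5 $vv = j by rewrite /= ag5.
    rewrite truth_And (truth_inbag B5) ?evb ?evv // [eval _ avis~[_]]/= (base_n4 B5) eb.
    by rewrite ag5 // ag3.
  have ej4 : m4 vv 0 = j by rewrite ag4.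
  move=> v; rewrite ltnS leq_eqVlt sem_write update_array // updateE [eval _ $vv]/= ej4.
  case: (v =P j) => [-> _|_ /= hv]; last by rewrite ag4 // H.
  rewrite !truth_Or /= ej4 z4 -orbA !(ag4 avis) // !(ag3 avis) //.
  by rewrite ag4 // (base_n B3).
move=> v hv; rewrite marks //.
have reach_side sig sig' : freach n k nb A inc s mm st r (copy n sig (s sig i)) (copy n sig' v) -> sig = sig'.
  move=> ry; have hy := copy_lt sig' hv.
  have [|w hw [[e1|e1] _]] := freach_copy inst hi ry; first by lia.
    by have [] := copy_inj hv hw e1.
  by move: hy; rewrite e1 /vout; have := copy_lt sig hw; lia.
have hvM sig : copy n sig v < M by apply: toM; apply: copy_lt.
split=> [/or3P[z|z|/has_iotaP[b hb /andP[z bv]]]|[sig [ry|[b [hb bv ry]]]]].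
- have /(vis _ (hvM false))[sig ry] := z; have e1 := reach_side sig false ry.
  by subst sig; exists false; left.
- have /(vis _ (hvM true))[sig ry] := z; have e1 := reach_side sig true ry.
  by subst sig; exists true; left.
- have /vis [|sig ry] := z; first by rewrite /tg /nnodes /src; lia.
  by exists sig; right; exists b.
- have : m2 avis (copy n sig v) != 0 by apply/vis => //; exists sig.
  by case: (sig) => /= ->; rewrite ?orbT.
- apply/or3P; constructor 3; apply/has_iotaP; exists b => //; rewrite /p bv andbT.
  by apply/vis; [rewrite /tg /nnodes /src; lia | exists sig].
Qed.

End Territory.

Hypothesis kn : k <= n.

Definition found_path (i : nat) (p : seq nat) : Prop :=
  exists q, [/\ p = s false i :: q, path A (s false i) q,
    last (s false i) q = s true i, uniq p & all (fun v => v < n) p].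

Definition written (m : memory) (i : nat) (p : seq nat) : Prop :=
  m 6 i = size p /\ forall j, j < size p -> m 7 (i * n + j) = nth 0 p j.

Lemma write_path_spec m i M t p y q : base m -> m vi 0 = i -> i < k -> m vM 0 = M -> n <= M ->
  m vstart 0 = t -> m vy 0 = y -> m vdone 0 = 0 -> m vcount 0 = 0 ->
  p = y :: q -> path (fun a b => (a != t) && (b == m apar a)) y q -> last y q = t ->
  size p <= n ->
  let m' := sem write_path m in
  [/\ m' vcount 0 = size p, forall j, j < size p -> m' 7 (i * n + j) = nth 0 p j &
      forall i' j, i' <> i -> j < n -> m' 7 (i' * n + j) = m 7 (i' * n + j)].
Proof.
move=> B ei hi eM nM et ey ed ec ep pq lq sp.
pose I j (m1 : memory) := [/\ j < size p -> [/\ m1 vdone 0 = 0, m1 vy 0 = nth 0 p j & m1 vcount 0 = j],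
  size p <= j -> m1 vdone 0 != 0 /\ m1 vcount 0 = size p,
  forall j', j' < j -> j' < size p -> m1 7 (i * n + j') = nth 0 p j' &
  forall i' j, i' <> i -> j < n -> m1 7 (i' * n + j) = m 7 (i' * n + j)].
suff : I (eval m $vM) (sem write_path m).
  rewrite /= eM => -[_ h2 h3 h4]; have h : size p <= M by apply: leq_trans nM.
  by have [_ e] := h2 h; split=> // j hj; apply: h3 => //; apply: leq_trans h.
apply: sem_For_ind => //.
  split=> // [_|]; last by rewrite ep.
  by rewrite !update_array // ep.
move=> j m1 _ ag ej [I1 I2 I3 I4].
have B1 : base m1 by apply: base_agree ag _ B.
rewrite sem_if truth_Not /=.
have step j' : j' < size q -> nth 0 p j' != t /\ nth 0 p j'.+1 = m apar (nth 0 p j').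
  by move=> h; have /andP[nt /eqP nx] := pathP 0 pq j' h; rewrite ep.
have lastp : nth 0 p (size q) = t by rewrite ep -lq (last_nth 0).
have szp : size p = (size q).+1 by rewrite ep.
case: (ltnP j (size p)) => hj; last first.
  have [d1 c1] := I2 hj; rewrite d1 /=; split=> //; first by lia.
  by move=> j' hj' hj2; apply: I3 => //; apply: leq_trans hj2 _.
have [d1 y1 c1] := I1 hj; rewrite d1 /=.
have eo : m1 aoffn i = i * n by apply: (base_off B1); lia.
have ei1 : m1 vi 0 = i by rewrite ag.
rewrite !semE !truth_Eq /= ei1 c1 eo y1 !(update_array _ _ _ (b := vcount)) // c1.
set m2 := update m1 7 _ _; set m3 := update m2 vcount _ _.
have e3 a x : a \notin [:: 7; vcount] -> m3 a x = m1 a x.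
  by rewrite !inE negb_or => /andP[h1 h2]; rewrite /m3 /m2 !update_array.
have c3 : m3 vcount 0 = j.+1 by rewrite /m3 update_same addn1.
rewrite !e3 // y1 ag // et.
set m4 := (X in update X vj 0 j.+1).
have e4 a x : a \notin [:: vdone; vy] -> m4 a x = m3 a x.
  by rewrite !inE negb_or => /andP[h1 h2]; rewrite /m4; case: ifP => _; rewrite update_array.
have out4 : forall j', j' < j.+1 -> j' < size p -> m4 7 (i * n + j') = nth 0 p j'.
  move=> j' hj' hj2; rewrite e4 // /m3 update_array // /m2 updateE.
  case: eqP => [/addnI ->//|ne]; apply: I3 => //; move: hj'; rewrite ltnS leq_eqVlt.
  by case/predU1P=> // e; case: ne; rewrite e.
have rest4 : forall i' j, i' <> i -> j < n -> m4 7 (i' * n + j) = m 7 (i' * n + j).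
  move=> i' j' ne hj'; rewrite e4 // /m3 update_array // /m2 updateE.
  case: eqP => [e|_]; last exact: I4.
  by case: ne; have [] := mat_inj hj' (leq_trans hj sp) e.
have c4 : m4 vcount 0 = j.+1 by rewrite e4.
split=> //.
- move=> hj'; have hjq : j < size q by move: hj'; rewrite szp.
  have [nt nx] := step j hjq; split; rewrite update_array //.
    by rewrite /m4 (negPf nt) update_array // e3 // d1.
  by rewrite /m4 (negPf nt) update_same nx ag.
- move=> hj'; have ejq : j = size q by move: hj hj'; rewrite szp; lia.
  rewrite !update_array // c4; split; last by rewrite szp ejq.
  by rewrite /m4 ejq lastp eqxx update_same.
Qed.

Lemma find_path_spec m i M (mark : nat -> bool) : base m -> m vi 0 = i -> i < k ->
  m vM 0 = M -> n <= M -> (forall v, v < n -> (m amark v != 0) = mark v) ->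
  mark (s true i) ->
  (forall W : nat -> bool, (forall u v, u < n -> v < n -> W v -> mark u -> A u v -> W u) ->
     W (s true i) -> W (s false i)) ->
  let m' := sem find_path m in
  exists p, [/\ found_path i p, forall v, v \in p -> mark v, written m' i p &
    forall i', i' <> i -> m' 6 i' = m 6 i' /\
      forall j, j < n -> m' 7 (i' * n + j) = m 7 (i' * n + j)].
Proof.
move=> B ei hi eM nM hm mt conn m'.
have hs := s_lt inst false hi; have ht := s_lt inst true hi.
rewrite /m' /find_path sem_seq sem_seq; set m1 := sem (vstart <~ _) m.
have ag1 : agree [:: vstart] m m1 by apply: agree_update.
have B1 : base m1 by apply: base_agree ag1 _ B.
have et1 : m1 vstart 0 = s true i.
  by rewrite /m1 sem_write update_same /= ei (base_s B true).
pose e u v := [&& u < n, v < n, mark u, mark v & A v u].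
set E := And _ _; set m2 := sem (search E) m1.
have ag2 : agree (writes (search E)) m1 m2 by apply: sem_agree.
have B2 : base m2 by apply: base_agree ag2 _ B1.
have se : searched M e (s true i) m2.
  apply: search_spec => //; last by lia.
    move=> m3 u v ag3 eu ev hu hv; have B3 : base m3 by apply: base_agree ag3 _ B1.
    have eu' : eval m3 $vu = u by [].
    have ev' : eval m3 $vv = v by [].
    have en : eval m3 vn = n by rewrite /= (base_n B3).
    rewrite /E !truth_And !truth_Lt eu' ev' en /e -!andbA.
    do 2!(apply: andb_id2l => ?); rewrite (truth_isarc B3) ?eu' ?ev' //.
    by rewrite [eval _ amark~[$vu]]/= [eval _ amark~[$vv]]/= eu ev !ag3 // !ag1 // !hm.
have hsM : s false i < M by lia.
have hmarks : m2 avis (s false i) != 0.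
  have [rank [h1 h2 h3 h4]] := se.
  have := conn (fun v => (m2 avis v != 0) && mark v); rewrite h1 mt; case/(_ _ isT)/andP => //.
  move=> u v hu hv /andP[zv mv] mu uv; rewrite mu andbT.
  by apply: (h2 v u) => //; [lia | lia | rewrite /e hv hu mv mu uv].
have [q [q1 q2 q3 q4]] := searched_path se hsM hmarks.
set p := s false i :: q in q3 q4.
have pA : path A (s false i) q.
  by apply: sub_path q1 => u v /and3P[_ _ /and5P[]].
have marked v : v \in p -> v < n /\ mark v.
  rewrite inE => /predU1P[->|vq].
    split=> //; apply: (conn mark) => //.
  have /(nthP 0) [j hj <-] := vq.
  by have /and3P[_ _ /and5P[h _ h' _ _]] := pathP 0 q1 j hj.
rewrite 4!sem_seq; set m3 := sem (vcount <~ _) _.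
have ag3 : agree [:: vy; vdone; vcount] m2 m3.
  by do 2!apply: agree_then_update => //; apply: agree_update.
have B3 : base m3 by apply: base_agree ag3 _ B2.
have ei2 : m2 vi 0 = i by rewrite ag2 // ag1.
have ei3 : m3 vi 0 = i by rewrite ag3.
have [] := write_path_spec (M := M) (t := s true i) (y := s false i) (p := p) (q := q) B3 ei3 hi.
- by rewrite ag3 // ag2 // ag1.
- by [].
- by rewrite ag3 // ag2.
- rewrite /m3 2!sem_write !(update_array) // sem_write update_same /= ei2.
  by rewrite (base_s B2 false).
- by [].
- by [].
- by [].
- by apply: sub_path q1 => u v /and3P[-> /eqP-> _] /=; rewrite ag3.
- by [].
- rewrite -[n](size_iota 0); apply: uniq_leq_size => // v /marked[hv _].
  by rewrite mem_iota.
set m4 := sem write_path m3 => h1 h2 h3.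
have ag4 : agree (writes write_path) m3 m4 by apply: sem_agree.
have ei4 : m4 vi 0 = i by rewrite ag4 // ag3.
exists p; split.
- exists q; split=> //; by apply/allP => v /marked[].
- by move=> v /marked[].
- split; first by rewrite sem_write /= ei4 update_same.
  by move=> j hj; rewrite sem_write update_array // h2.
move=> i' ne; split.
  rewrite sem_write /= ei4 update_cell; last exact/eqP.
  by rewrite ag4 // ag3 // ag2 // ag1.
by move=> j hj; rewrite sem_write update_array // h3 // ag3 // ag2 // ag1.
Qed.

Lemma mark_all_spec m : base m -> forall v, v < n -> sem mark_all m amark v = 1.
Proof.
move=> B; suff : forall v, v < eval m vn -> sem mark_all m amark v = 1.
  by rewrite [eval _ vn](base_n B).
apply: (@sem_For_ind vv vn _ m (fun j m1 => forall v, v < j -> m1 amark v = 1)) => //.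
move=> j m1 _ _ ej H v; rewrite ltnS leq_eqVlt sem_write /= update_array // updateE ej.
by case: (v =P j) => //= _; apply: H.
Qed.

Definition marking : cmd := CIf (Minus vk 0~[#2]) mark_territory mark_all.

Lemma solve_paths_spec m0 (good : nat -> nat -> Prop) : base m0 -> n <= m0 vM 0 ->
  (forall i m, agree (writes solve_paths) m0 m -> base m -> m vi 0 = i -> i < k ->
     let mark v := sem marking m amark v != 0 in
     [/\ forall v, v < n -> mark v -> good i v, mark (s true i) &
         forall W : nat -> bool,
           (forall u v, u < n -> v < n -> W v -> mark u -> A u v -> W u) ->
           W (s true i) -> W (s false i)]) ->
  exists P : nat -> seq nat, forall i, i < k ->
    [/\ found_path i (P i), forall v, v \in P i -> good i v &
        written (sem solve_paths m0) i (P i)].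
Proof.
move=> B nM hmark.
pose I j m := exists P : nat -> seq nat, forall i, i < j ->
    [/\ found_path i (P i), forall v, v \in P i -> good i v & written m i (P i)].
suff : I (eval m0 vk) (sem solve_paths m0) by rewrite [eval _ vk](base_k B).
apply: sem_For_ind => //; first by exists (fun _ => [::]).
move=> i m1; rewrite [eval _ vk](base_k B) => hi ag ei [P HP].
have B1 : base m1 by apply: base_agree ag _ B.
have [mg mt conn] := hmark i m1 ag B1 ei hi.
rewrite sem_seq -/marking; set m2 := sem marking m1 in mg mt conn *.
have ag2 : agree (writes marking) m1 m2 by apply: sem_agree.
have B2 : base m2 by apply: base_agree ag2 _ B1.
have [p [fp pm wp others]] : exists p, [/\ found_path i p,
    forall v, v \in p -> m2 amark v != 0, written (sem find_path m2) i p &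
    forall i', i' <> i -> sem find_path m2 6 i' = m2 6 i' /\
      forall j, j < n -> sem find_path m2 7 (i' * n + j) = m2 7 (i' * n + j)].
  apply: (@find_path_spec m2 i (m0 vM 0) (fun v => m2 amark v != 0)) => //.
    by rewrite ag2.
  by rewrite ag2 // ag.
exists (fun j => if j == i then p else P j) => j; rewrite ltnS leq_eqVlt.
have keep w j' q : written w j' q -> written (update w vi 0 i.+1) j' q.
  by case=> h1 h2; split=> [|l hl]; rewrite update_array // h2.
case: (j =P i) => [-> _|ji /= hj].
  split; [exact: fp | | exact: keep].
  move=> v vp; apply: mg; last exact: pm.
  by case: fp => q [_ _ _ _ /allP h]; apply: h.
have [f1 g1 [w1 w2]] := HP j hj; split=> //; apply: keep.
have [o1 o2] := others j ji; split; first by rewrite o1 ag2.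
move=> l hl; rewrite o2; first by rewrite ag2 // w2.
apply: leq_trans hl _; case: f1 => q [_ _ _ u a].
rewrite -[n](size_iota 0); apply: uniq_leq_size => // v /(allP a) hv.
by rewrite mem_iota.
Qed.

End Paths.

(** * The whole program *)
(** Products are sums over a loop: [vm] becomes [c (k - 1) + 1] and [vnb] becomes
[2 k (vm + 1) + c (k - 1)].  For [c >= k] both stay 0, so that no rounds take place
and the sizes of all loops are bounded without reference to [c]. *)
Definition set_parameters : cmd :=
  CIf (Minus vk 0~[#2])
    (vz <~ #0;; CFor vi vk (vz <~ Plus $vz 0~[#2]);; vz <~ Minus $vz 0~[#2];;
     vm <~ Plus $vz #1;; vm2 <~ Plus $vm $vm;; vnb <~ $vz;;
     CFor vi vk (vnb <~ Plus $vnb (Plus (Plus $vm #1) (Plus $vm #1))))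
    CSkip.

Definition set_sizes : cmd :=
  vn2 <~ Plus vn vn;; vn4 <~ Plus $vn2 $vn2;; vlen <~ Plus vn $vnb;;
  vsrc <~ Plus $vn4 $vn2;; vsnk <~ Plus $vsrc #1;; vM <~ Plus $vsrc #2;; vK <~ vk.

Definition rounds : cmd := table aoffn $vlen vn;; CFor vr $vm2 round.

Definition set_final_size : cmd :=
  vsrc <~ Plus $vn4 $vnb;; vsnk <~ Plus $vsrc #1;; vM <~ Plus $vsrc #2;;
  vK <~ Plus vk vk.

Definition finish : cmd := CIf (Minus vk 0~[#2]) final_flow CSkip;; solve_paths.

Definition main : cmd := set_parameters;; set_sizes;; rounds;; set_final_size;; finish.

Section Main.
Variables (n k c : nat) (m0 : memory).
Hypothesis k0 : 0 < k.
Hypothesis en : m0 0 0 = n.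
Hypothesis ek : m0 0 1 = k.
Hypothesis ec : m0 0 2 = c.
Hypothesis fresh : forall a x, 7 < a -> m0 a x = 0.

(** At most [k^2], even if [c] is large. *)
Definition n_groups := if c < k then c * (k - 1) + 1 else 0.
Definition n_bags := if c < k then 2 * k * (n_groups + 1) + c * (k - 1) else 0.

Lemma iterate_sum a e m v : a != vi -> eval m vk = k ->
  (forall m', agree [:: vi; a] m m' -> eval m' e = v) ->
  sem (CFor vi vk (a <~ Plus $a e)) m a 0 = m a 0 + k * v.
Proof.
move=> avi mk he; rewrite -mk.
apply: (@sem_For_ind vi vk _ m (fun j m1 => m1 a 0 = m a 0 + j * v)).
- by rewrite /= inE eq_sym.
- by rewrite update_array // addn0.
move=> j m1 _ ag _ H; rewrite update_array // sem_write /= update_same H he //.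
by rewrite mulSn; lia.
Qed.

Lemma set_parameters_spec :
  let m := sem set_parameters m0 in
  [/\ m vm 0 = n_groups, m vm2 0 = n_groups + n_groups & m vnb 0 = n_bags].
Proof.
rewrite /set_parameters sem_if /= ek ec /n_bags /n_groups; case: ltnP => ck; last first.
  have -> : (k - c != 0) = false by rewrite subn_eq0 ck.
  by split; rewrite [LHS]fresh.
have -> : k - c != 0 by rewrite subn_eq0 -ltnNge.
rewrite 6!sem_seq; set m2 := sem (vz <~ #0) m0; set m3 := sem (CFor _ _ _) m2.
have ag2 : agree [:: vz] m0 m2 by apply: agree_update.
have z3 : m3 vz 0 = k * c.
  rewrite /m3 (@iterate_sum vz 0~[#2] m2 c) //.
  by move=> m' ag'; rewrite /= ag' // ag2.
have ag3 : agree [:: vi; vz] m2 m3.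
  by apply: (@sem_agree (CFor vi vk (vz <~ Plus $vz 0~[#2]))).
set m4 := sem (vz <~ _) m3; have z4 : m4 vz 0 = c * (k - 1).
  by rewrite /m4 sem_write update_same /= z3 ag3 // ag2 // ec mulnBr muln1 mulnC.
have ag4 : agree [:: vi; vz] m0 m4.
  apply: agree_then_update => //; apply: agree_trans ag3.
  by apply: agree_sub ag2; subset_literals.
set m5 := sem (vm <~ _) m4; set m6 := sem (vm2 <~ _) m5; set m7 := sem (vnb <~ _) m6.
have m5E : m5 vm 0 = c * (k - 1) + 1 by rewrite /m5 sem_write update_same /= z4.
have ag7 : agree [:: vi; vz; vm; vm2; vnb] m0 m7.
  do 3!apply: agree_then_update => //.
  by apply: agree_sub ag4; subset_literals.
have m7E : m7 vm 0 = c * (k - 1) + 1.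
  by rewrite /m7 sem_write update_array // /m6 sem_write update_array.
set m8 := sem (CFor _ _ _) m7.
have ag8 : agree [:: vi; vnb] m7 m8.
  by apply: (@sem_agree (CFor vi vk (vnb <~ Plus $vnb (Plus (Plus $vm #1) (Plus $vm #1))))).
split.
- by rewrite ag8.
- by rewrite ag8 // /m7 sem_write update_array // /m6 sem_write update_same /= m5E.
rewrite /m8 (@iterate_sum _ _ _ ((c * (k - 1) + 1 + 1) * 2)) //.
- rewrite /m7 sem_write update_same /= /m6 sem_write update_array // /m5 sem_write update_array //.
  by rewrite z4 addnC mulnA [k * _ * 2]mulnAC [k * 2]mulnC.
- by rewrite /= ag7.
by move=> m' ag'; rewrite /= ag' // m7E; lia.
Qed.

Lemma set_sizes_spec m : m 0 0 = n -> m 0 1 = k ->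
  let m' := sem set_sizes m in
  [/\ m' vlen 0 = n + m vnb 0, m' vK 0 = k,
      m' vn2 0 = n + n /\ m' vn4 0 = n + n + (n + n) &
      [/\ m' vsrc 0 = src (n + n) (n + n), m' vsnk 0 = snk (n + n) (n + n) &
          m' vM 0 = nnodes (n + n) (n + n)]].
Proof.
move=> emn emk; rewrite /set_sizes 6!sem_seq.
set m1 := sem (vn2 <~ _) _; set m2 := sem (vn4 <~ _) _; set m3 := sem (vlen <~ _) _.
set m4 := sem (vsrc <~ _) _; set m5 := sem (vsnk <~ _) _; set m6 := sem (vM <~ _) _.
have e1 : m1 vn2 0 = n + n by rewrite /m1 sem_write update_same /= emn.
have e2 : m2 vn4 0 = n + n + (n + n) by rewrite /m2 sem_write update_same /= e1.
have e3 : m3 vlen 0 = n + m vnb 0 by rewrite /m3 sem_write update_same /= -emn.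
have e4 : m4 vsrc 0 = src (n + n) (n + n).
  by rewrite /m4 sem_write update_same /= [m3 vn4 0]e2 [m3 vn2 0]e1.
have e5 : m5 vsnk 0 = snk (n + n) (n + n).
  by rewrite /m5 sem_write update_same /= e4.
have e6 : m6 vM 0 = nnodes (n + n) (n + n).
  by rewrite /m6 sem_write update_same /= [m5 vsrc 0]e4.
by split=> //; rewrite sem_write update_same.
Qed.
Lemma set_final_size_spec m :
  let m' := sem set_final_size m in
  [/\ m' vsrc 0 = m vn4 0 + m vnb 0, m' vsnk 0 = m vn4 0 + m vnb 0 + 1,
      m' vM 0 = m vn4 0 + m vnb 0 + 2 & m' vK 0 = m 0 1 + m 0 1].
Proof. by split; rewrite /set_final_size !semE /= /update. Qed.

Definition input_arc u v := m0 1 (u * n + v) != 0.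
Definition input_bag b v := m0 2 (b * n + v) != 0.
Definition input_terminal (sig : bool) i := m0 (if sig then 5 else 4) i.

Hypothesis inst : instance n k input_arc input_terminal.
Hypothesis kn : k <= n.
Hypothesis c2 : 2 <= c.
Hypothesis Bs : c < k -> bags n c n_bags input_arc input_bag.
Local Notation base := (base n k n_bags n_groups input_arc input_bag input_terminal).

Lemma main_base :
  let m := sem (table aoffn $vlen vn) (sem set_sizes (sem set_parameters m0)) in
  [/\ base m, m vm2 0 = n_groups + n_groups, m vK 0 = k /\ (forall b, m ast b = 0) &
      [/\ m vsrc 0 = src (n + n) (n + n), m vsnk 0 = snk (n + n) (n + n) &
          m vM 0 = nnodes (n + n) (n + n)]].
Proof.
have [p1 p2 p3] := set_parameters_spec.
set m1 := sem set_parameters m0 in p1 p2 p3 *.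
have ag1 : agree (writes set_parameters) m0 m1 by apply: sem_agree.
have [||s1 s2 [s3 s4] s5] := @set_sizes_spec m1; try by rewrite ag1.
set m2 := sem set_sizes m1 in s1 s2 s3 s4 s5 *.
have ag2 : agree (writes set_sizes) m1 m2 by apply: sem_agree.
set m3 := sem (table _ _ _) m2.
have ag3 : agree (writes (table aoffn $vlen vn)) m2 m3 by apply: sem_agree.
have low a x : a \in [:: 0; 1; 2; 4; 5; ast] -> m3 a x = m0 a x.
  by rewrite !inE => /or4P[|||/or3P[]] /eqP->; rewrite ag3 // ag2 // ag1.
split.
- split.
  + by rewrite low.
  + by rewrite low.
  + by rewrite ag3 // ag2.
  + by rewrite ag3 // ag2.
  + by rewrite ag3.
  + by rewrite ag3.
  + move=> j hj; rewrite /m3 table_spec //; first by rewrite /= ag2 // ag1 // en.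
    by rewrite /= s1 p3.
  + by move=> u v _ _; rewrite low.
  + by move=> b v _ _; rewrite low.
  + by move=> sig i _; rewrite low //; case: sig.
- by rewrite ag3 // ag2.
- by split=> [|b]; [rewrite ag3 | rewrite low // fresh].
- by case: s5 => h1 h2 h3; split; rewrite ag3.
Qed.

Lemma main_spec :
  exists P : nat -> seq nat,
    (forall i, i < k -> found_path n input_arc input_terminal i (P i) /\ written n (sem main m0) i (P i)) /\
    forall v, v < n -> cnt (fun i => v \in P i) k <= c.
Proof.
have [B1 e2 [eK est] [es et eM]] := main_base.
rewrite /main 4!sem_seq [sem rounds _]sem_seq.
set m1 := sem (table _ _ _) _ in B1 e2 eK est es et eM *.
have : [/\ base (sem (CFor vr $vm2 round) m1) &
   c < k -> progress n k n_bags n_groups input_arc input_bag input_terminal (n_groups + n_groups) (sem (CFor vr $vm2 round) m1 ast)].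
  rewrite -[in n_groups + n_groups]e2.
  apply: (@sem_For_ind vr $vm2 round m1 (fun r m => [/\ base m &
     c < k -> progress n k n_bags n_groups input_arc input_bag input_terminal r (m ast)])) => //.
    split; first by apply: (@base_agree _ _ _ _ _ _ _ [:: vr] m1) => //; apply: agree_update.
    move=> ck; split=> //; first by move=> b _; rewrite update_array // est.
    by rewrite [cnt _ _]big1 // => b _; rewrite update_array // est.
  move=> r m; rewrite [eval _ _]e2 => hr ag er [B pr]; split.
    apply: (@base_agree _ _ _ _ _ _ _ (vr :: writes round)) B => //.
    apply: agree_then_update; first exact: mem_head.
    by apply: agree_sub (@sem_agree round m) => x hx; rewrite in_cons hx orbT.
  move=> ck.
  have -> : update (sem round m) vr 0 r.+1 ast = sem round m ast by [].
  have mmE : n_groups = c * (k - 1) + 1 by rewrite /n_groups ck.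
  have nbE : 2 * k * (n_groups + 1) + c * (k - 1) <= n_bags by rewrite /n_bags ck.
  apply: (round_spec inst (Bs ck) mmE nbE B) => //; last exact: pr.
  - by rewrite ag.
  - by rewrite ag.
  - by rewrite ag.
  - by rewrite ag.
have c1 : m1 0 2 = c.
  rewrite -ec; exact: (@sem_agree (set_parameters;; set_sizes;; table aoffn $vlen vn) m0 0 isT 2).
set m2 := sem (CFor vr _ _) m1; case=> B2 pr.
have cm2 : m2 0 2 = c by rewrite /m2 (@sem_agree (CFor vr $vm2 round)).
clearbody m2; clear m1 B1 e2 eK est es et eM c1.
set m3 := sem set_final_size m2.
have ag3 : agree [:: vsrc; vsnk; vM; vK] m2 m3.
  by do 3!apply: agree_then_update => //; apply: agree_update.
have B3 : base m3 by apply: base_agree ag3 _ B2.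
have [es3 et3 eM3 eK3] := set_final_size_spec m2; rewrite -/m3 in es3 et3 eM3 eK3.
rewrite (base_n4 B2) (base_nb B2) in es3 et3 eM3; rewrite (base_k B2) in eK3.
rewrite /finish sem_seq; set m4 := sem (CIf _ _ _) m3.
have c3 : m3 0 2 = c by rewrite ag3.
have k3 : m3 0 1 = k by apply: base_k B3.
case: (ltnP c k) => ck; last first.
  have e4 : m4 = m3.
    by rewrite /m4 sem_if /= k3 c3; move: ck; rewrite -subn_eq0 => /eqP->.
  have [||i m ag B ei hi mark|P HP] := @solve_paths_spec n k n_bags n_groups input_arc input_bag input_terminal inst kn m4 (fun _ _ => True).
  - by rewrite e4.
  - by rewrite e4 eM3 /nnodes /src; lia.
  - have allm v : v < n -> mark v.
      move=> hv; rewrite /mark /marking sem_if /= (base_k B) ag // e4 c3.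
      by move: ck; rewrite -subn_eq0 => ->; rewrite /= (mark_all_spec B).
    split=> //; first by apply: allm; apply: (s_lt inst).
    move=> W closed Wt.
    apply: (strong inst (sig := true) (Y := fun _ => false) (W := W)) => //.
    + by rewrite (cnt_const false).
    + by exists (input_terminal true i); rewrite ?Wt // (s_lt inst).
    + by move=> u v hu hv Wu /= vu _; apply: closed vu => //; apply: allm.
    + exact: (s_lt inst).
  exists P; split=> [i hi|v hv]; first by have [] := HP i hi.
  by apply: leq_trans ck; apply: cnt_leqn.
have Bs' := Bs ck.
have mmE : n_groups = c * (k - 1) + 1 by rewrite /n_groups ck.
have nbE : 2 * k * (n_groups + 1) + c * (k - 1) <= n_bags by rewrite /n_bags ck.
have {}pr : progress n k n_bags n_groups input_arc input_bag input_terminal (n_groups + n_groups) (m3 ast).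
  by have -> : m3 ast = m2 ast by []; apply: pr.
have e4 : m4 = sem final_flow m3.
  by rewrite /m4 sem_if /= k3 c3 subn_eq0 leqNgt ck.
have [fl nt su B4] := final_spec inst Bs' mmE nbE B3 eM3 es3 et3 eK3 pr.
rewrite -e4 in fl nt su B4.
have ag4 : agree (writes final_flow) m3 m4 by rewrite e4; apply: sem_agree.
pose st := m3 ast; pose r := mat ares (nnodes (n + n) n_bags) m4.
pose terr := territory n k n_bags input_arc input_bag input_terminal n_groups st r.
have eM4 : m4 vM 0 = nnodes (n + n) n_bags by rewrite ag4.
have [//|||P HP] := @solve_paths_spec n k n_bags n_groups input_arc input_bag input_terminal inst kn m4 terr.
- by rewrite eM4 /nnodes /src; lia.
- move=> i m ag B ei hi mark.
  have markE v : v < n -> mark v <-> terr i v.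
    move=> hv; rewrite /mark /marking sem_if /= (base_k B) ag // ag4 // c3 subn_eq0 leqNgt ck /=.
    by apply: (mark_territory_spec inst nt _ eM4 ag B ei hi) => //; case: su.
  split.
  + by move=> v hv /(markE v hv).
  + apply/markE; first exact: (s_lt inst).
    by exists true; left; apply: reach_refl.
  + move=> W; apply: (territory_connected inst Bs' fl (mark := mark)) => //.
exists P; split=> [i hi|v hv]; first by have [] := HP i hi.
apply: (territory_congestion inst Bs' fl (P := fun i w => w \in P i)) => // i hi.
by have [_ h _] := HP i hi; apply: h.
Qed.
End Main.

(** * Running time *)
(* The five parts of the program are treated separately, because each changes loop
bounds of the next; within a part the bounds do not change. *)
Lemma set_parameters_wf : well_formed set_parameters. Proof. by vm_compute. Qed.
Lemma set_sizes_wf : well_formed set_sizes. Proof. by vm_compute. Qed.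
Lemma rounds_wf : well_formed rounds. Proof. by vm_compute. Qed.
Lemma set_final_size_wf : well_formed set_final_size. Proof. by vm_compute. Qed.
Lemma finish_wf : well_formed finish. Proof. by vm_compute. Qed.

Section Cost.
Variable m : memory.
Local Notation n := (m 0 0).
Local Notation k := (m 0 1).
Local Notation nb := (m vnb 0).
Local Notation M := (m vM 0).
Local Notation K := (m vK 0).

Lemma cost_prep : cost m prep <= 400 * (n * (nb + 1) + 1).
Proof. rewrite /prep /=; nia. Qed.

Lemma cost_terms : cost m terms <= 400 * (m vn2 0 * (k + 1) + 1).
Proof. rewrite /terms /=; nia. Qed.

Lemma cost_search E : cost m (search E) <= (expr_cost E + 200) * (M * M + 1).
Proof. rewrite /search /scan /visit /=; move: (expr_cost E) => x; nia. Qed.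

Lemma cost_augment : cost m augment <= 500 * (M * M + 1).
Proof.
have := cost_search ares~[cell]; rewrite /augment.
move: (search _) => p h /=; move: h => /=; move: (cost m p) => x; nia.
Qed.

Lemma cost_flow E :
  cost m (flow E) <= (2 * expr_cost E + 1000) * ((K + 1) * (M * M + 1)).
Proof.
have := cost_augment; rewrite /flow; move: augment => p h.
rewrite /table /fill /=; move: h; move: (cost m p) (expr_cost E) => x y h.
have -> : (2 * y + 1000) * ((K + 1) * (M * M + 1)) =
    2 * y * (K * (M * M + 1)) + 2 * (M * M * y) + 2 * y
    + 1000 * (K * (M * M + 1)) + 1000 * (M * M) + 1000 by nia.
have h1 : K * x <= 500 * (K * (M * M + 1)) by rewrite mulnCA leq_mul2l h orbT.
have h2 : K <= K * (M * M + 1) by rewrite leq_pmulr // addn1.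
have h3 : M <= M * M by case: (M) => // a; rewrite leq_pmulr.
by nia.
Qed.

Lemma cost_choose_bags : cost m choose_bags <= 400 * (n * (nb + 1) + 1).
Proof. rewrite /choose_bags /choose_bag /=; nia. Qed.

(** The time for one linkage up to a constant factor: tables of the bags, tables of
the terminals, and [K] augmentations in a network of [M] nodes. *)
Definition stage_size :=
  n * (nb + 1) + m vn2 0 * (k + 1) + (K + 1) * (M * M + 1) + 1.

Lemma cost_round : cost m round <= 4000 * stage_size.
Proof.
have := cost_prep; have := cost_terms; have := cost_choose_bags; have := cost_flow (netE round_target).
rewrite /round /stage_size; move: prep terms (flow _) choose_bags => p1 p2 p3 p4 /=.
move: (cost m p1) (cost m p2) (cost m p3) (cost m p4) => x1 x2 x3 x4.
lia.
Qed.
Lemma cost_rounds :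
  cost m rounds <= 100 * (m vlen 0 + 1) + m vm2 0 * (4100 * stage_size).
Proof.
have := cost_round; rewrite /rounds /table; move: round => p h /=.
have h1 : m vm2 0 * (cost m p + 2 + 10) <= m vm2 0 * (4100 * stage_size).
  by rewrite leq_mul2l; apply/orP; right; move: h; rewrite /stage_size; lia.
lia.
Qed.

Lemma cost_final_flow : cost m final_flow <= 4000 * stage_size.
Proof.
have := cost_prep; have := cost_terms; have := cost_flow (netE final_target).
rewrite /final_flow /stage_size; move: prep terms (flow _) => p1 p2 p3 /=.
move: (cost m p1) (cost m p2) (cost m p3) => x1 x2 x3.
lia.
Qed.

Lemma cost_solve_paths :
  cost m solve_paths <= 2000 * ((k + 1) * (M * M + n * (nb + 1) + 1)).
Proof.
rewrite /solve_paths /mark_territory /find_path /mark_all /write_path.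
have := cost_search (Or (And anet~[cell] (Not ares~[cell])) (And (Eq $vu $vstart) (Eq $vv $vtgt))).
have := cost_search (And (And (Lt $vu vn) (Lt $vv vn))
              (And (And amark~[$vu] amark~[$vv]) (isarc $vv $vu))).
move: (search _) (search _) => p1 p2 /=.
move: (cost m p1) (cost m p2) => x1 x2 h1 h2.
nia.
Qed.

Lemma cost_finish : cost m finish <= 4000 * stage_size + 3000 * ((k + 1) * (M * M + n * (nb + 1) + 1)).
Proof.
have := cost_final_flow; have := cost_solve_paths.
rewrite /finish /stage_size; move: final_flow solve_paths => p1 p2 /=.
nia.
Qed.
End Cost.

Section Total.
Variables n k nb mm : nat.
Hypothesis k0 : 0 < k.
Hypothesis kn : k <= n.
Hypothesis hnb : nb <= 3 * k ^ 3.
(* Without this, the [k^3] target nodes of the last network could make it too big. *)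
Hypothesis cas : nb = 0 \/ k ^ 2 <= n.
Hypothesis hmm : mm <= k ^ 2.

Definition stage M K := n * (nb + 1) + (n + n) * (k + 1) + (K + 1) * (M * M + 1) + 1.
Local Notation Z := (k ^ 4 * n ^ 2).

Let n0 : 0 < n. Proof. exact: leq_trans k0 kn. Qed.
Let k3n2 : k ^ 2 * (k * n ^ 2) <= Z.
Proof. by rewrite mulnA -expnSr leq_mul2r leq_pexp2l ?orbT. Qed.
Let kn2 : k * n ^ 2 <= Z.
Proof. by rewrite leq_mul2r (@leq_pexp2l k 1) ?orbT. Qed.
Let k3n1 : n * k ^ 3 <= Z.
Proof. by rewrite mulnC leq_mul ?leq_pexp2l ?(@leq_pexp2l n 1). Qed.
Let k5n : k ^ 2 * (n * k ^ 3) <= Z.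
Proof.
have -> : k ^ 2 * (n * k ^ 3) = k ^ 4 * (k * n) by rewrite !expnS expn0; lia.
by rewrite -mulnn leq_mul2l leq_mul2r kn !orbT.
Qed.
Let nn : n ^ 2 <= k * n ^ 2. Proof. exact: leq_pmull. Qed.
Let nkn : n * k <= k * n ^ 2.
Proof. by rewrite mulnC leq_mul2l (@leq_pexp2l n 1) ?orbT. Qed.
Let nk : n <= n * k. Proof. exact: leq_pmulr. Qed.
Let kk : k <= n * k. Proof. exact: leq_pmull. Qed.
Let nnb : n * nb <= 3 * (n * k ^ 3).
Proof. by rewrite mulnCA leq_mul2l hnb orbT. Qed.

Let stage1 : stage (6 * n + 2) k <= 200 * (k * n ^ 2) + 3 * (n * k ^ 3).
Proof.
rewrite /stage.
have -> : n * (nb + 1) + (n + n) * (k + 1) + (k + 1) * ((6 * n + 2) * (6 * n + 2) + 1) + 1 =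
  n * nb + 36 * (k * n ^ 2) + 26 * (n * k) + 36 * n ^ 2 + 27 * n + 5 * k + 6.
  by rewrite expnS expn1; lia.
by move: nkn nk kk nn nnb n0; lia.
Qed.

Let part1 : (mm + mm) * (4100 * stage (6 * n + 2) k) <= 1000 * (2000 * Z).
Proof.
apply: (@leq_trans (2 * k ^ 2 * (4100 * stage (6 * n + 2) k))).
  by rewrite leq_mul2r; apply/orP; right; lia.
have : k ^ 2 * stage (6 * n + 2) k <= 200 * Z + 3 * Z.
  apply: (@leq_trans (k ^ 2 * (200 * (k * n ^ 2) + 3 * (n * k ^ 3)))).
    by rewrite leq_mul2l stage1 orbT.
  by rewrite mulnDr (mulnCA (k ^ 2) 200) (mulnCA (k ^ 2) 3); move: k3n2 k5n; lia.
by move: (stage _ _) (k ^ 2) Z => x y z; lia.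
Qed.

Local Notation M := (4 * n + nb + 2).

Let kM2 : k * (M * M) <= 200 * Z.
Proof.
have h1 : M * M <= 72 * n ^ 2 + 2 * nb ^ 2.
  have hM : M <= 6 * n + nb by move: n0; lia.
  apply: leq_trans (leq_mul hM hM) _; rewrite !expnS !expn0.
  have : 2 * ((6 * n) * nb) <= (6 * n) * (6 * n) + nb * nb.
    by have [h _] := nat_Cauchy (6 * n) nb; rewrite !mulnn.
  by lia.
have h2 : k * nb ^ 2 <= 9 * Z.
  case: cas => [->|k2n]; first by rewrite exp0n ?muln0.
  apply: (@leq_trans (k * (3 * k ^ 3) ^ 2)); first by rewrite leq_mul2l leq_exp2r ?hnb ?orbT.
  have -> : k * (3 * k ^ 3) ^ 2 = 9 * (k ^ 4 * k ^ 3) by rewrite !expnS !expn0; lia.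
  rewrite leq_mul2l leq_mul2l /=; apply/orP; right.
  apply: (@leq_trans ((k ^ 2) ^ 2)); last by rewrite leq_exp2r.
  by rewrite -expnM leq_pexp2l.
apply: (@leq_trans (k * (72 * n ^ 2 + 2 * nb ^ 2))); first by rewrite leq_mul2l h1 orbT.
by rewrite mulnDr (mulnCA k 72) (mulnCA k 2); move: kn2 h2; lia.
Qed.

Let MM : M * M <= k * (M * M). Proof. exact: leq_pmull. Qed.
Let knb : k * (n * nb) <= 3 * Z.
Proof.
apply: (@leq_trans (k * (3 * (n * k ^ 3)))); first by rewrite leq_mul2l nnb orbT.
have -> : k * (3 * (n * k ^ 3)) = 3 * (k ^ 4 * n) by rewrite !expnS !expn0; lia.
by rewrite leq_mul2l leq_mul2l (@leq_pexp2l n 1) ?orbT.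
Qed.

Let stage2 : stage M (k + k) <= 1000 * Z.
Proof.
rewrite /stage; have -> : n * (nb + 1) + (n + n) * (k + 1) + (k + k + 1) * (M * M + 1) + 1 =
  n * nb + 3 * n + 2 * (n * k) + 2 * (k * (M * M)) + 2 * k + M * M + 2 by lia.
by move: nkn nk kk nn nnb n0 kM2 MM kn2 k3n1; lia.
Qed.

(** The dominant terms are the [2 mm <= 2 k^2] rounds of [k] searches in [O(n)] nodes
each, [O(k^3 n^2)]; their preparation, [O(k^2 (n k^3))]; and the [2 k] searches
in a network of [O(n + k^3)] nodes, where [k (k^3)^2 <= k^4 n^2] by [k^2 <= n]. *)
Lemma total_bound :
  100 * (n + nb + 1) + (mm + mm) * (4100 * stage (6 * n + 2) k) +
    (4000 * stage M (k + k) + 3000 * ((k + 1) * (M * M + n * (nb + 1) + 1))) +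
    1000 * (k + 1)
  <= 1000 * (1000 * (20 * Z)).
Proof.
have -> : (k + 1) * (M * M + n * (nb + 1) + 1) =
  k * (M * M) + M * M + k * (n * nb) + n * nb + n * k + n + k + 1 by lia.
have : nb <= n * nb by apply: leq_pmull.
by move: part1 stage2 nkn nk kk nn nnb n0 kM2 MM kn2 k3n1 knb; lia.
Qed.
End Total.

(** * From digraphs to numbered vertices *)
Lemma connect_closed (T : finType) (e : rel T) (P : T -> Prop) x y :
  connect e x y -> (forall u v, e u v -> P u -> P v) -> P x -> P y.
Proof.
case/connectP=> p pth -> closed; elim: p x pth => //= z p IH x /andP[xz pth] Px.
by apply: IH pth (closed _ _ xz Px).
Qed.

Lemma connect_closed_back (T : finType) (e : rel T) (P : T -> Prop) x y :
  connect e x y -> (forall u v, e u v -> P v -> P u) -> P y -> P x.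
Proof.
case/connectP=> p pth -> closed; elim: p x pth => //= z p IH x /andP[xz pth] Py.
by apply: closed xz (IH _ pth Py).
Qed.

Lemma vnum_lt (G : digraph) (v : vert G) : vnum v < #|vert G|.
Proof. exact: ltn_ord. Qed.

Lemma vnum_inj (G : digraph) : injective (@vnum G).
Proof. by move=> u v /val_inj/enum_rank_inj. Qed.

Lemma vnum_onto (G : digraph) x : x < #|vert G| -> exists v : vert G, vnum v = x.
Proof. by move=> hx; exists (enum_val (Ordinal hx)); rewrite /vnum enum_valK. Qed.

Lemma exec_seq p q m1 m2 m3 t u :
  exec (compile p) m1 t m2 -> exec (compile q) m2 u m3 ->
  exec (compile (p;; q)) m1 (t + u) m3.
Proof. exact: ExecSeq. Qed.

Section Graph.
Variables (G : digraph) (k c : nat) (B : seq (subgraph G)) (S T : k.-tuple (vert G)).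
Local Notation V := (vert G).
Local Notation n := #|V|.
Local Notation m0 := (input_memory c B S T).
Local Notation A := (input_arc n m0).
Local Notation inc := (input_bag n m0).
Local Notation s := (input_terminal m0).

Lemma cnt_vnum (P : nat -> bool) : cnt P n = #|[set v : V | P (vnum v)]|.
Proof.
rewrite /cnt (reindex (@enum_rank V)) /=; last exact/onW_bij/enum_rank_bij.
by rewrite -[RHS]sum1_card [RHS]big_mkcond; apply: eq_bigr => v _; rewrite inE; case: (P _).
Qed.

Lemma input_adj (u v : V) : A (vnum u) (vnum v) = adj u v.
Proof.
rewrite /input_arc /=; case: existsP => [[u' /existsP[v' /andP[/eqP e uv]]]|no].
  have [/vnum_inj -> /vnum_inj ->] := mat_inj (vnum_lt v) (vnum_lt v') e.
  by rewrite uv.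
by case uv: (adj u v) => //; case: no; exists u; apply/existsP; exists v; rewrite eqxx uv.
Qed.

Lemma input_inc b (v : V) : b < size B -> inc b (vnum v) = (v \in sub_verts (bag B b)).
Proof.
move=> hb; rewrite /input_bag /=.
case: existsP => [[b' /existsP[v' /andP[/eqP e bv]]]|no].
  have [-> /vnum_inj ->] := mat_inj (vnum_lt v) (vnum_lt v') e.
  by rewrite bv.
case bv: (v \in _) => //; case: no; exists (Ordinal hb); apply/existsP; exists v.
by rewrite eqxx bv.
Qed.

Definition terminals (sig : bool) : k.-tuple V := if sig then T else S.

Lemma input_s sig i (hi : i < k) : s sig i = vnum (tnth (terminals sig) (Ordinal hi)).
Proof.
have in_tuple (U : k.-tuple V) : nth 0 (map (@vnum G) U) i = vnum (tnth U (Ordinal hi)).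
  rewrite (nth_map (tnth U (Ordinal hi))) ?size_tuple //.
  by congr vnum; apply/esym/tnth_nth.
by rewrite /input_terminal /terminals; case: sig; apply: in_tuple.
Qed.

Lemma input_fresh a x : 7 < a -> m0 a x = 0.
Proof. by do 8 case: a => [|a] //. Qed.

Hypothesis k0 : 0 < k.
Hypothesis kstr : k_strong G k.
Hypothesis uS : uniq S.
Hypothesis uT : uniq T.

Lemma k_lt_n : k < n. Proof. by case/andP: kstr. Qed.

Lemma input_instance : instance n k A s.
Proof.
split=> //.
- by move=> sig i hi; rewrite (input_s sig hi) vnum_lt.
- move=> sig i j hi hj; rewrite (input_s sig hi) (input_s sig hj) => /vnum_inj e.
  have u : uniq (terminals sig) by rewrite /terminals; case: sig {e}.
  by have /(congr1 val) := (tuple_uniqP _ u) _ _ e.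
move=> sig Y W small [u hu /andP[Wu Yu]] closed v hv Yv.
pose X := [set w : V | Y (vnum w)].
have sX : #|X| < k by rewrite -cnt_vnum.
have sc : strongly_connected (delete X).
  have /andP[_ /forallP/(_ X)] := kstr; rewrite leqNgt sX implybF negb_or negbK.
  by case/andP.
have [u' eu] := vnum_onto hu; have [v' ev] := vnum_onto hv; subst u v.
have inX w : (w \in sub_verts (delete X)) = ~~ Y (vnum w) by rewrite !inE.
have conn x y : ~~ Y (vnum x) -> ~~ Y (vnum y) -> connect (sub_adj (delete X)) x y.
  move=> hx hy; have /andP[_ /forallP/(_ x)/implyP] := sc.
  by rewrite inX => /(_ hx)/forallP/(_ y)/implyP; rewrite inX; apply.
have step x y : sub_adj (delete X) x y -> [/\ adj x y, ~~ Y (vnum x) & ~~ Y (vnum y)].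
  case/existsP=> e /andP[]; rewrite !inE => /andP[h1 h2] /andP[/eqP<- /eqP<-]; split=> //.
  by apply/existsP; exists e; rewrite !inE !eqxx.
case: sig closed => closed.
- apply: (@connect_closed_back _ _ (fun w => W (vnum w)) _ _ (conn _ _ Yv Yu)) => // x y.
  case/step=> xy Yx Yy Wy; apply: closed Wy _ Yx; rewrite ?vnum_lt //.
  by rewrite /darc input_adj.
apply: (@connect_closed _ _ (fun w => W (vnum w)) _ _ (conn _ _ Yu Yv)) => // x y.
case/step=> xy Yx Yy Wx; apply: closed Wx _ Yy; rewrite ?vnum_lt //.
by rewrite /darc input_adj.
Qed.

Hypothesis Bb : bramble B.
Hypothesis cong : has_congestion c B.

Lemma bag_ok b : b < size B ->
  is_subgraph (bag B b) /\ strongly_connected (bag B b).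
Proof.
by move=> hb; case: Bb => _ h _; apply/andP; apply: h; apply: mem_nth.
Qed.

Lemma cong_all v : cnt (fun b => inc b (vnum v)) (size B) = count (fun H => v \in sub_verts H) B.
Proof.
rewrite -sum1_count (big_nth (set0, set0)) big_mkord /cnt [RHS]big_mkcond /=.
by apply: eq_bigr => b _; rewrite (input_inc v (ltn_ord b)); case: (_ \in _).
Qed.

Lemma input_bags nb : nb <= size B -> bags n c nb A inc.
Proof.
move=> hnb; have lt b : b < nb -> b < size B by move=> hb; apply: leq_trans hnb.
split.
- move=> b /lt hb; have [_ /andP[/set0Pn[v bv] _]] := bag_ok hb.
  by exists (vnum v); rewrite ?vnum_lt ?input_inc.
- move=> sig b W /lt hb [u [hu bu Wu]] closed v hv bv.
  have [/forallP sub sc] := bag_ok hb.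
  have [u' eu] := vnum_onto hu; have [v' ev] := vnum_onto hv; subst u v.
  rewrite input_inc // in bu; rewrite input_inc // in bv.
  have conn x y : x \in sub_verts (bag B b) -> y \in sub_verts (bag B b) ->
      connect (sub_adj (bag B b)) x y.
    move=> hx hy; have /andP[_ /forallP/(_ x)/implyP] := sc.
    by move=> /(_ hx)/forallP/(_ y)/implyP; apply.
  have step x y : sub_adj (bag B b) x y ->
      [/\ adj x y, inc b (vnum x) & inc b (vnum y)].
    case/existsP=> e /andP[he /andP[/eqP<- /eqP<-]]; rewrite !input_inc //.
    have /implyP/(_ he)/andP[h1 h2] := sub e; split=> //.
    by apply/existsP; exists e; rewrite !inE !eqxx.
  case: sig closed => closed.
  + apply: (@connect_closed_back _ _ (fun w => W (vnum w)) _ _ (conn _ _ bv bu)) => // x y.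
    case/step=> xy bx by' Wy; apply: closed Wy _; rewrite ?vnum_lt //.
    by rewrite /darc input_adj.
  apply: (@connect_closed _ _ (fun w => W (vnum w)) _ _ (conn _ _ bu bv)) => // x y.
  case/step=> xy bx by' Wx; apply: closed Wx _; rewrite ?vnum_lt //.
  by rewrite /darc input_adj.
- move=> b b' /lt hb /lt hb'; case: Bb => _ _ /(_ (bag B b) (bag B b')).
  rewrite !mem_nth // => /(_ isT isT) /orP[/set0Pn[v]|/andP[/existsP[e /andP[h1 h2]] _]].
    by rewrite inE => /andP[h1 h2]; left; exists (vnum v); rewrite vnum_lt !input_inc.
  right; exists (vnum (tail e)), (vnum (Defs.head e)); rewrite !vnum_lt !input_inc // input_adj.
  by split=> //; apply/existsP; exists e; rewrite !inE !eqxx.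
move=> v hv; have [v' ev] := vnum_onto hv; subst v.
apply: leq_trans (cong v'); rewrite -cong_all -(subnKC hnb) cnt_shift.
exact: leq_addr.
Qed.

Hypothesis c2 : 2 <= c.
Hypothesis large : 2 * k * (c * k - c + 2) + c * (k - 1) <= size B.

Lemma nb_le_size : n_bags k c <= size B.
Proof.
rewrite /n_bags; case: ltnP => // ck; apply: leq_trans large.
by rewrite /n_groups ck leq_add2r leq_mul2l mulnBr muln1; lia.
Qed.

(** Every bag has a vertex, and every vertex lies in at most [c] bags. *)
Lemma size_le_congestion : size B <= c * n.
Proof.
have Bs := input_bags (leqnn (size B)).
apply: (@leq_trans (\sum_(b < size B) \sum_(v < n) inc b v)).
  rewrite -[leqLHS]card_ord -sum1_card leq_sum // => b _.
  by have [v hv bv] := bag_ne Bs (ltn_ord b); apply: (@cnt_gt0 (inc b) n v).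
rewrite exchange_big mulnC -[n in leqRHS]card_ord -sum_nat_const leq_sum // => v _.
exact: (bag_cong Bs (ltn_ord v)).
Qed.

Lemma input_sizes : [/\ n_bags k c <= 3 * k ^ 3, n_bags k c = 0 \/ k ^ 2 <= n & n_groups k c <= k ^ 2].
Proof.
rewrite /n_bags /n_groups; case: ltnP => ck; last by split=> //; left.
have ck2 : c * (k - 1) + 1 <= k ^ 2.
  by rewrite expnS expn1; have := leq_mul (ltnW ck) (leqnn (k - 1)); rewrite mulnBr muln1; nia.
split=> //; last right.
  apply: (@leq_trans (2 * k * (k ^ 2) + k ^ 2)).
    apply: leq_add; last by apply: leq_trans ck2; rewrite leq_addr.
    rewrite leq_mul2l; apply/orP; right.
    by move: ck k0 c2; rewrite expnS expn1; nia.
  by move: k0; rewrite !expnS expn0; nia.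
have := leq_trans large size_le_congestion; move: ck c2 k0; rewrite expnS expn1.
by nia.
Qed.

(** The inverse of the numbering, as the program returns numbers. *)
Definition vertex_of (v0 : V) (x : nat) : V := nth v0 (enum V) x.

Lemma vertex_ofK v0 x : x < n -> vnum (vertex_of v0 x) = x.
Proof.
move=> hx; have [v ev] := vnum_onto hx; subst x.
by rewrite /vertex_of /vnum nth_enum_rank.
Qed.

Lemma input_solved : exists P : 'I_k -> seq V,
  outputs (sem main m0) P /\ congested_solution c S T P.
Proof.
have inst := input_instance.
have [P [good cg]] := @main_spec n k c m0 k0 erefl erefl erefl input_fresh inst
  (ltnW k_lt_n) c2 (fun _ => input_bags nb_le_size).
pose v0 := tnth S (Ordinal k0).
pose Q (i : 'I_k) := map (vertex_of v0) (P i).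
have Pn (i : 'I_k) x : x \in P i -> x < n.
  by have [[q [_ _ _ _ /allP h]] _] := good i (ltn_ord i); apply: h.
have QK i : map (@vnum G) (Q i) = P i.
  rewrite -map_comp -[RHS]map_id; apply/eq_in_map => x hx /=.
  by rewrite vertex_ofK // (Pn i).
exists Q; split=> [i|].
  have [_ [h1 h2]] := good i (ltn_ord i); rewrite QK size_map; split=> //.
split=> [i|v].
  have [[q [eP pq lq uq _]] _] := good i (ltn_ord i).
  have uQ : uniq (Q i) by rewrite -(map_inj_uniq (@vnum_inj G)) QK.
  move: uQ (QK i); rewrite /is_dipath eP; case: (Q i) => //= x r uQ [ex er].
  have hi := ltn_ord i; have e : Ordinal hi = i by apply: val_inj.
  apply/and4P; split=> //.
  - by apply/eqP/vnum_inj; rewrite ex (input_s false hi) e.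
  - move: pq; rewrite -er -ex; elim: (r) (x) => //= y r' IH x' /andP[xy pth].
    by rewrite -input_adj xy IH.
  apply/eqP/vnum_inj; rewrite -last_map er ex lq (input_s true hi) e.
  by [].
apply: leq_trans (cg (vnum v) (vnum_lt v)).
rewrite /cnt -sum1_card big_mkcond leq_sum // => i _; rewrite inE -QK.
by rewrite mem_map //; exact: vnum_inj.
Qed.

Lemma main_exec : exists2 t, exec (compile main) m0 t (sem main m0) &
  t <= 1000 * (1000 * (20 * (k ^ 4 * n ^ 2))).
Proof.
have [p1 p2 p3] := @set_parameters_spec n k c m0 k0 erefl erefl erefl input_fresh.
have [t1 e1 c1] := exec_compile m0 set_parameters_wf.
set m1 := sem set_parameters m0 in p1 p2 p3 e1.
have ag1 : agree (writes set_parameters) m0 m1 by apply: sem_agree.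
have [||s1 s2 [s3 s4] [s5 s6 s7]] := @set_sizes_spec n k m1; try by rewrite ag1.
have [t2 e2 c2'] := exec_compile m1 set_sizes_wf.
set m2 := sem set_sizes m1 in s1 s2 s3 s4 s5 s6 s7 e2.
have ag2 : agree (writes set_sizes) m1 m2 by apply: sem_agree.
have [t3 e3 c3] := exec_compile m2 rounds_wf.
set m3 := sem rounds m2 in e3.
have ag3 : agree (writes rounds) m2 m3 by apply: sem_agree.
have [t4 e4 c4] := exec_compile m3 set_final_size_wf.
set m4 := sem set_final_size m3 in e4.
have ag4 : agree (writes set_final_size) m3 m4 by apply: sem_agree.
have [t5 e5 c5] := exec_compile m4 finish_wf.
exists (t1 + (t2 + (t3 + (t4 + t5)))).
  rewrite /main 4!sem_seq -/m1 -/m2 -/m3 -/m4.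
  by apply: exec_seq e1 (exec_seq e2 (exec_seq e3 (exec_seq e4 e5))).
have [i1 i2 i3] := input_sizes.
apply: leq_trans (total_bound k0 (ltnW k_lt_n) i1 i2 i3).
have [f1 f2 f3 f4] := set_final_size_spec m3; rewrite -/m4 in f1 f2 f3 f4.
have n1 : m1 0 0 = n /\ m1 0 1 = k by rewrite !ag1.
have n2 : m2 0 0 = n /\ m2 0 1 = k by rewrite !ag2.
have n3 : m3 0 1 = k by rewrite ag3 //; case: n2.
have n4 : m4 0 0 = n /\ m4 0 1 = k by rewrite !ag4 // !ag3.
have b2 : m2 vnb 0 = n_bags k c by rewrite ag2.
have b4 : m4 vnb 0 = n_bags k c by rewrite ag4 // ag3.
have st2 : stage_size m2 = stage n k (n_bags k c) (6 * n + 2) k.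
  rewrite /stage_size /stage b2 s2 s3 s7; case: n2 => -> ->.
  by rewrite (_ : nnodes (n + n) (n + n) = 6 * n + 2) // /nnodes /src; lia.
have M4 : m4 vM 0 = 4 * n + n_bags k c + 2.
  by rewrite f3 ag3 // s4 ag3 // b2; lia.
have st4 : stage_size m4 = stage n k (n_bags k c) (4 * n + n_bags k c + 2) (k + k).
  rewrite /stage_size /stage b4 f4 M4 n3 (ag4 vn2) // ag3 // s3.
  by case: n4 => -> ->.
have r3 := leq_trans c3 (cost_rounds m2); have r5 := leq_trans c5 (cost_finish m4).
rewrite st2 s1 (ag2 vm2) // p2 p3 in r3; case: n4 => n4 k4.
rewrite st4 M4 n4 k4 b4 in r5.
have r1 : t1 <= 400 * (k + 1) by apply: leq_trans c1 _; rewrite /set_parameters /=; lia.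
have r2 : t2 <= 300 by apply: leq_trans c2' _; rewrite /set_sizes /=; lia.
have r4 : t4 <= 300 by apply: leq_trans c4 _; rewrite /set_final_size /=; lia.
move: r1 r2 r3 r4 r5; move: (_ * (4100 * _)) (4000 * _) (3000 * _) => x y z.
by lia.
Qed.

End Graph.

Theorem theorem34 :
  exists (p : program) (C : nat),
    forall (k c n : nat) (G : digraph) (B : seq (subgraph G))
           (S T : k.-tuple (vert G)),
      0 < k -> 2 <= c -> #|vert G| = n -> k_strong G k ->
      bramble B -> has_congestion c B ->
      2 * k * (c * k - c + 2) + c * (k - 1) <= size B ->
      uniq S -> uniq T ->
      positive_instance c S T /\
      solved_within p (C * (k ^ 4 * n ^ 2)) c B S T.
Proof.
exists (compile main), (1000 * (1000 * 20)).
move=> k c n G B S T k0 c2 <- kstr Bb cong large uS uT.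
have [P [outP solP]] := input_solved k0 kstr uS uT Bb cong c2 large.
split; first by exists P.
have [t ex le] := main_exec k0 kstr uS uT Bb cong c2 large.
rewrite -[20 * _]/(20 * (k ^ 4 * #|vert G| ^ 2)) (mulnA 1000 20) (mulnA 1000) in le.
by exists t, (sem main (input_memory c B S T)), P; split.
Qed.
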